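(* Let $n\ge1$. If $Q_1$ and $Q_2$ are quivers in $\mathcal{Q}_n$, and $Q_1$ and $Q_2$ have the same parameters $r_1, r_2, s_1$ and $s_2$ (up to changing the roles of $r_i$ and $s_i$, $i\in\{1,2\}$, i.e. up to simultaneously interchanging $r_1$ with $s_1$ and $r_2$ with $s_2$), then $Q_2$ can be obtained from $Q_1$ by iterated mutation, where all the intermediate quivers have the same parameters as well.
   Context: Quivers and mutation. A quiver is a finite directed graph. Let $Q$ be a quiver without loops and oriented $2$-cycles. The mutation of $Q$ at a vertex $k$ is the quiver $Q^*$ obtained as follows: add a new vertex $k^*$; if there are $r>0$ arrows $i\to k$, $s>0$ arrows $k\to j$ and $t\in\mathbb{Z}$ arrows $j\to i$ in $Q$, then there are $t-rs$ arrows $j\to i$ in $Q^*$ (a negative number of arrows means arrows in the opposite direction); for any vertex $i$ replace all arrows $i\to k$ by arrows $k^*\to i$ and all arrows $k\to i$ by arrows $i\to k^*$; remove $k$. Quivers are considered up to isomorphism. Two quivers are mutation equivalent if one can be obtained from the other by a finite sequence of mutations. A non-oriented cycle of length $m\ge 2$ is a quiver whose underlying graph is a cycle with $m$ vertices and $m$ edges (for $m=2$, a double arrow) and which is not an oriented cycle. Quivers of type $A_k$. Below, a quiver of type $A_k$ means a quiver mutation equivalent to an orientation of the Dynkin diagram $A_k$; equivalently (Buan-Vatne), a connected quiver with $k$ vertices such that all non-trivial cycles in the underlying graph (not passing through the same edge twice) are oriented and of length $3$; each vertex has at most four incident arrows; if a vertex has four incident arrows, two of them belong to one oriented $3$-cycle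 and the other two to another oriented $3$-cycle; if a vertex has three incident arrows, two of them belong to an oriented $3$-cycle and the third does not belong to any oriented $3$-cycle. The class $\mathcal{Q}_n$. It is the class of connected quivers $Q$ with $n+1$ vertices such that: (i) there is precisely one full subquiver which is a non-oriented cycle of length $\ge 2$ (if the length is two, it is a double arrow); (ii) for each arrow $\alpha: x\to y$ of this non-oriented cycle there may (or may not) be a vertex $z_\alpha$ not on the non-oriented cycle such that there is an oriented $3$-cycle $x\xrightarrow{\alpha} y\to z_\alpha\to x$, and apart from the arrows of these oriented $3$-cycles there are no other arrows incident to vertices on the non-oriented cycle; (iii) if all vertices of the non-oriented cycle and their incident arrows are removed, the result is a disjoint union of quivers $Q_\alpha$, one for each $z_\alpha$ (with $z_\alpha$ a vertex of $Q_\alpha$), each $Q_\alpha$ is a quiver of type $A_{k_\alpha}$ for some $k_\alpha\ge1$, the vertex $z_\alpha$ has at most two incident arrows in $Q_\alpha$, and if it has two, then $z_\alpha$ is a vertex of an oriented $3$-cycle in $Q_\alpha$. Convention: if the non-oriented cycle is a double arrow, only one of the two arrows is chosen to be part of the oriented $3$-cycle through a given vertex $z_\alpha$ (different vertices $z$ being attached to different arrows). (The class $\mathcal{Q}_n$ is closed under mutation, so all intermediate quivers lie in $\mathcal{Q}_n$ and have parameters.) Parameters. For $Q\in\mathcal{Q}_n$ fix a drawing of $Q$ in the plane without arrow-crossing, so that each arrow of the non-oriented cycle is clockwise or anti-clockwise oriented; this is unique up to reflection of the non-oriented cycle, i.e. up to changing the roles of clockwise and anti-clockwise. Then $r_1$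 is the number of arrows that are not part of any oriented $3$-cycle and that either lie on the non-oriented cycle and are oriented anti-clockwise, or lie in some $Q_\alpha$ with $\alpha$ an anti-clockwise arrow of the non-oriented cycle. And $r_2$ is the number of oriented $3$-cycles that either share an arrow $\alpha$ with the non-oriented cycle where $\alpha$ is oriented anti-clockwise, or lie in some $Q_\alpha$ with $\alpha$ an anti-clockwise arrow of the non-oriented cycle. The parameters $s_1,s_2$ are defined in the same way with ''clockwise'' instead of ''anti-clockwise''. *)

(* Defs.v *)
From mathcomp Require Import all_boot.

Set Implicit Arguments.
Unset Strict Implicit.
Unset Printing Implicit Defensive.

(* A quiver without loops and oriented 2-cycles on the vertex set T;
   [Q i j] is the number of arrows i -> j. *)
Record quiver (T : finType) := Quiver {
  narr :> T -> T -> nat;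
  no_loop : forall i, narr i i = 0;
  no_2cycle : forall i j, (narr i j == 0) || (narr j i == 0)
}.

Section Mutation.
Variables (T : finType) (Q : quiver T) (k : T).

(* The new vertex k* is again called k.  For i, j != k, truncated subtraction
   yields the number of arrows i -> j of the mutated quiver from the signed
   count: with r arrows i -> k, s arrows k -> j and t (signed) arrows j -> i,
   the value at (j, i) is max(t - rs, 0) and the value at (i, j) is
   max(rs - t, 0). *)
Definition mutate_narr (i j : T) : nat :=
  if (i == k) || (j == k) then Q j i
  else (Q i j + Q i k * Q k j) - (Q j i + Q j k * Q k i).

Lemma mutate_no_loop i : mutate_narr i i = 0.
Proof. by rewrite /mutate_narr subnn no_loop; case: ifP. Qed.

Lemma mutate_no_2cycle i j : (mutate_narr i j == 0) || (mutate_narr j i == 0).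
Proof.
rewrite /mutate_narr [(j == k) || _]orbC.
case: ifP => _; first exact: no_2cycle.
by rewrite !subn_eq0 leq_total.
Qed.

Definition mutate : quiver T := Quiver mutate_no_loop mutate_no_2cycle.

End Mutation.

(* Successive mutation, the head of the list first. *)
Definition mutate_seq (T : finType) (Q : quiver T) (ks : seq T) : quiver T :=
  foldl (@mutate T) Q ks.

Definition quiver_iso (T T' : finType) (Q : quiver T) (Q' : quiver T') : Prop :=
  exists2 f : T -> T', bijective f & forall i j, Q' (f i) (f j) = Q i j.

Definition mutation_equivalent (T T' : finType) (Q : quiver T) (Q' : quiver T')
  : Prop :=
  exists ks : seq T, quiver_iso (mutate_seq Q ks) Q'.

Definition dynkin_A_orientation (k : nat) (O : quiver 'I_k) : Prop :=
  forall i j : 'I_k, O i j + O j i = ((i.+1 == j) || (j.+1 == i)).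

Definition type_A (k : nat) (T : finType) (Q : quiver T) : Prop :=
  exists2 O : quiver 'I_k, dynkin_A_orientation O & mutation_equivalent O Q.

Section Subquiver.
Variables (T : finType) (Q : quiver T) (S : {set T}).

Definition sub_narr (i j : {x : T | x \in S}) : nat := Q (val i) (val j).

Lemma sub_no_loop i : sub_narr i i = 0.
Proof. exact: no_loop. Qed.

Lemma sub_no_2cycle i j : (sub_narr i j == 0) || (sub_narr j i == 0).
Proof. exact: no_2cycle. Qed.

Definition full_subquiver : quiver {x : T | x \in S} :=
  Quiver sub_no_loop sub_no_2cycle.

End Subquiver.

Section Arrows.
Variables (T : finType) (Q : quiver T).

(* Individual arrows, so that parallel arrows can be told apart. *)
Definition arrow : Type := {p : T * T & 'I_(Q p.1 p.2)}.

Definition src (a : arrow) : T := (tag a).1.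
Definition tgt (a : arrow) : T := (tag a).2.

Definition adjacent (x y : T) : bool := (0 < Q x y) || (0 < Q y x).

Definition connected : Prop := forall x y, connect adjacent x y.

(* The connected component of v in the full subquiver on S (for v in S). *)
Definition component (S : {set T}) (v : T) : {set T} :=
  [set u | connect (fun x y => [&& x \in S, y \in S & adjacent x y]) v u].

Definition arrows_in (S : {set T}) : {set arrow} :=
  [set a | (src a \in S) && (tgt a \in S)].

Definition oriented_3cycle (D : {set arrow}) : bool :=
  [exists a, exists b, exists c,
    [&& tgt a == src b, tgt b == src c, tgt c == src a & D == [set a; b; c]]].

(* A step traverses an arrow from source to target (true) or from target to
   source (false). *)
Definition step : Type := (arrow * bool)%type.
Definition step_start (s : step) : T := if s.2 then src s.1 else tgt s.1.
Definition step_end (s : step) : T := if s.2 then tgt s.1 else src s.1.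

Definition walk_verts (w : seq step) : {set T} :=
  [set x | x \in map step_start w].

(* The closed walk w runs once around a non-oriented cycle of length
   [size w] >= 2, and that cycle is a full subquiver.  Distinctness of the
   arrows only matters for length 2, where the two steps are the two arrows of
   a double arrow. *)
Definition full_nonoriented_cycle (w : seq step) : Prop :=
  [/\ 2 <= size w,
      cycle (fun s t => step_end s == step_start t) w,
      uniq (map step_start w) /\ uniq (map fst w),
      arrows_in (walk_verts w) = [set a | a \in map fst w] &
      has (fun s => s.2) w && has (fun s => ~~ s.2) w].

Section Drawing.
(* w runs clockwise around the non-oriented cycle, so that (a, true) \in w
   means that the arrow a is clockwise and (a, false) \in w that it is
   anti-clockwise; [z a] is the vertex z_a, if there is one. *)
Variables (w : seq step) (z : arrow -> option T).

Definition piece (v : T) : {set T} := component (~: walk_verts w) v.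

Record drawing : Prop := {
  draw_cycle : full_nonoriented_cycle w;
  draw_unique : forall w', full_nonoriented_cycle w' ->
    walk_verts w' = walk_verts w;
  (* Exactly one arrow, since a parallel one would be a further arrow incident
     to the cycle that belongs to no 3-cycle of an arrow of the cycle with its
     vertex z. *)
  draw_triangle : forall a v, z a = Some v ->
    [/\ a \in map fst w, v \notin walk_verts w,
        Q (tgt a) v = 1 & Q v (src a) = 1];
  draw_incident : forall b,
    (src b \in walk_verts w) || (tgt b \in walk_verts w) ->
    b \in map fst w \/
    exists a v, z a = Some v /\
      ((src b = tgt a /\ tgt b = v) \/ (src b = v /\ tgt b = src a));
  draw_cover : forall u, u \notin walk_verts w ->
    exists a v, z a = Some v /\ u \in piece v;
  draw_disjoint : forall a b v v', z a = Some v -> z b = Some v' ->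
    v' \in piece v -> a = b;
  draw_type_A : forall a v, z a = Some v ->
    exists2 k, 1 <= k & type_A k (full_subquiver Q (piece v));
  draw_valency : forall a v, z a = Some v ->
    #|[set b in arrows_in (piece v) | (src b == v) || (tgt b == v)]| <= 2;
  draw_valency2 : forall a v, z a = Some v ->
    #|[set b in arrows_in (piece v) | (src b == v) || (tgt b == v)]| = 2 ->
    exists D, [/\ oriented_3cycle D, D \subset arrows_in (piece v) &
                  exists2 b, b \in D & src b = v]
}.

(* If the non-oriented cycle is a double arrow, an oriented 3-cycle through it
   only counts if it consists of an arrow a and its own vertex z_a.  In all
   other cases the second condition is automatic for a drawing. *)
Definition chosen_3cycle (D : {set arrow}) : bool :=
  oriented_3cycle D &&
  [forall a in D, (a \in map fst w) ==>
    [exists b in D, z a == Some (src b)]].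

(* The arrow a has direction d on the cycle and e lies in Q_a. *)
Definition in_piece_of (d : bool) (a : arrow) (e : {set arrow}) : bool :=
  ((a, d) \in w) &&
  (if z a is Some v then e \subset arrows_in (piece v) else false).

Definition num_arrows (d : bool) : nat :=
  #|[set b | [forall D, chosen_3cycle D ==> (b \notin D)] &&
             (((b, d) \in w) || [exists a, in_piece_of d a [set b]])]|.

Definition num_3cycles (d : bool) : nat :=
  #|[set D | chosen_3cycle D &&
             ([exists a in D, (a, d) \in w] || [exists a, in_piece_of d a D])]|.

End Drawing.

Definition in_Qn (n : nat) : Prop :=
  [/\ #|T| = n.+1, connected & exists w z, drawing w z].

Definition has_params (r1 r2 s1 s2 : nat) : Prop :=
  exists w z, [/\ drawing w z,
    r1 = num_arrows w z false, r2 = num_3cycles w z false,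
    s1 = num_arrows w z true & s2 = num_3cycles w z true].

End Arrows.

(* Main.v *)
(* Quivers in Q_n are encoded by cyclic words.  A letter records a vertex of the
   non-oriented cycle, the direction of the arrow to the next vertex, and
   possibly the rooted type A quiver glued to this arrow; a type A quiver rooted
   at a vertex of valency at most two is a tree of single arrows and oriented
   3-cycles.  Mutation at the root of a glued tree that is not a single vertex
   lengthens the cycle by one arrow, distributes the branches over the two new
   arrows and keeps the parameters.  Iterating, every glued quiver becomes a
   single vertex, so that the letters are of four kinds, whose multiplicities
   are r1, r2, s1 and s2.  Adjacent letters can then be exchanged: at a sink or
   source of the cycle this is one mutation; two letters of the same direction
   are merged into one (the inverse of the move above), the leaf created is
   flipped, and the letter is split again in the other order.  Hence quivers
   with equal parameters reach isomorphic quivers, and mutation is involutive.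

   Every drawing of a quiver has such a word, because the class of trees is
   closed under mutation.  Conversely, words are drawn with the expected
   parameters, because a quiver built from a non-oriented cycle by successively
   attaching vertices along one arrow or over one arrow of a 3-cycle has no
   other full non-oriented cycle and no other oriented 3-cycles, and because
   the triangles of a tree can be opened by mutations away from its root. *)

From HB Require Import structures.
Require Import Defs.
From mathcomp Require Import all_boot.
From mathcomp Require Import zify.

Set Implicit Arguments.
Unset Strict Implicit.
Unset Printing Implicit Defensive.

(** * Arrow lists and non-oriented cycles *)

(** The conclusion asks each intermediate quiver for an actual drawing, with its uniqueness clause
    and its type A pieces. Hence words must be translated into drawings and back, and mutation is
    computed only on words and trees. These list arrows with multiplicity, so one calculation covers
    every cycle length, the double arrow included, and everything away from the mutated vertex stays
    opaque. The price is that parallel arrows have equal endpoints; they are told apart by the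
    direction in which the cycle traverses them.

    Uniqueness of the cycle is a degree argument: the vertex attached last has degree 1, or degree 2
    with both arrows in an oriented triangle. A full non-oriented cycle through it would contain
    that triangle, but such a cycle has a sink or a source and contains no oriented one.

    Interchanging the two directions means reading the word backwards. The final sequence follows
    [Q1] to a word with the letters of a word reached from [Q2], then retraces the way of [Q2]
    through an isomorphism, so each quiver of the second half is a relabelled quiver with known
    parameters. *)

Section ArrowLists.
Variable L : eqType.
Implicit Types (A N C M R : seq (L * L)) (X V I O : seq L) (TL : seq (L * L * L)).

Definition ori (d : bool) (x y : L) : L * L := if d then (x, y) else (y, x).
Definition ends A : seq L := unzip1 A ++ unzip2 A.

Lemma ends_cat A C v : count_mem v (ends (A ++ C)) = count_mem v (ends A) + count_mem v (ends
    C).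
Proof. by rewrite /ends /unzip1 /unzip2 !map_cat !count_cat; lia. Qed.

Lemma mem_ends A v : (v \in ends A) = has (fun a => (a.1 == v) || (a.2 == v)) A.
Proof.
rewrite mem_cat; elim: A => //= a A <-; rewrite !inE ![v == _]eq_sym.
by case: eqP; case: eqP; rewrite ?orbT.
Qed.

Lemma endsP A v : reflect (exists2 a, a \in A & (a.1 == v) || (a.2 == v)) (v \in ends A).
Proof. by rewrite mem_ends; apply: hasP. Qed.

Lemma ends1 A a : a \in A -> a.1 \in ends A.
Proof. by move=> aA; apply/endsP; exists a; rewrite ?eqxx. Qed.

Lemma ends2 A a : a \in A -> a.2 \in ends A.
Proof. by move=> aA; apply/endsP; exists a; rewrite ?eqxx ?orbT. Qed.

Lemma perm_ends A C v : perm_eq A C -> count_mem v (ends A) = count_mem v (ends C).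
Proof.
by move=> h; rewrite /ends !count_cat; congr (_ + _); apply/permP; apply: perm_map.
Qed.

Lemma perm_to_mask C A : uniq C -> {subset C <= A} -> exists R, perm_eq A (C ++ R).
Proof.
move=> uC sCA.
have /count_subseqP [s ss ps] : forall x, count_mem x C <= count_mem x A.
  by move=> x; apply: leq_uniq_count.
have [R pR] := perm_to_subseq ss; exists R.
by apply: (perm_trans pR); rewrite perm_cat2r perm_sym.
Qed.

(* An abstract non-oriented cycle with vertices [X] and arrows [A]; the last
   clause provides a sink or a source, since all degrees are 2. *)
Record ring X A : Prop := {
  ring_supp : {subset ends A <= X};
  ring_deg v : v \in X -> count_mem v (ends A) = 2;
  ring_conn (P : pred L) : (forall a, a \in A -> P a.1 = P a.2) -> has P X -> all P X;
  ring_turn : exists2 v, v \in X & count_mem v (unzip2 A) != 1 }.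

(* The vertices of [C] have degree 2 in [C] already, so [C] exhausts [A]. *)
Lemma ring_no_oriented X A C : ring X A -> uniq C -> {subset C <= A} -> C != [::] ->
  (forall v, v \in ends C -> count_mem v (unzip1 C) = 1 /\ count_mem v (unzip2 C) = 1) -> False.
Proof.
move=> [sup deg conn [v vX turn]] uC sCA C0 hC.
have [R pA] := perm_to_mask uC sCA.
have disj u : u \in ends C -> u \notin ends R.
  move=> uC'; have [h1 h2] := hC u uC'; rewrite -has_pred1 has_count -leqNgt leqn0.
  have uX : u \in X.
    by apply: sup; have /endsP [a aC h] := uC'; apply/endsP; exists a => //; apply: sCA.
  have := deg u uX; rewrite (perm_ends _ pA) ends_cat {1}/ends count_cat h1 h2; lia.
have hP a : a \in A -> (a.1 \in ends C) = (a.2 \in ends C).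
  rewrite (perm_mem pA) mem_cat => /orP[aC|aR]; first by rewrite ends1 ?ends2.
  have n1 := ends1 aR; have n2 := ends2 aR.
  case: (boolP (a.1 \in ends C)) => [/disj|_]; first by rewrite n1.
  by case: (boolP (a.2 \in ends C)) => [/disj|_]; first by rewrite n2.
have /allP hX : all (mem (ends C)) X.
  apply: conn => //; case: C C0 {hP hC disj pA uC} sCA => // a C _ sCA.
  have aA : a \in A by apply: sCA; rewrite inE eqxx.
  apply/hasP; exists a.1; first by apply: sup; apply: ends1.
  by apply: (@ends1 (a :: C)); rewrite inE eqxx.
have vC := hX v vX; have [h1 h2] := hC v vC.
have := disj v vC; rewrite mem_cat negb_or => /andP[_ vR].
move: turn; rewrite /unzip2 (permP (perm_map _ pA)) map_cat count_cat.
by rewrite -/(unzip2 C) h2 (count_memPn vR).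
Qed.

Lemma ring_no_loop X A p : ring X A -> (p, p) \notin A.
Proof.
move=> rg; apply/negP => pA; apply: (@ring_no_oriented X A [:: (p, p)]) => //.
  by move=> a; rewrite inE => /eqP->.
by move=> v /=; rewrite !inE orbb => /eqP->; rewrite eqxx.
Qed.

Lemma ring_no_2cycle X A p q : ring X A -> (p, q) \in A -> (q, p) \notin A.
Proof.
move=> rg h1; apply/negP => h2.
have npq : p != q by apply: contraTneq h1 => ->; apply: ring_no_loop rg.
apply: (@ring_no_oriented X A [:: (p, q); (q, p)]) => //.
- by rewrite /= inE xpair_eqE (negbTE npq).
- by move=> a; rewrite !inE => /orP[]/eqP->.
- move=> v /=; rewrite !inE ![_ == v]eq_sym.
  have [->|] := eqVneq v p; first by rewrite (negbTE npq).
  by have [->|] := eqVneq v q.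
Qed.

Lemma ring_no_3cycle X A p q r : ring X A ->
  (p, q) \in A -> (q, r) \in A -> (r, p) \notin A.
Proof.
move=> rg h1 h2; apply/negP => h3.
have npq : p != q by apply: contraTneq h1 => ->; apply: ring_no_loop rg.
have nqr : q != r by apply: contraTneq h2 => ->; apply: ring_no_loop rg.
have nrp : r != p by apply: contraTneq h3 => ->; apply: ring_no_loop rg.
apply: (@ring_no_oriented X A [:: (p, q); (q, r); (r, p)]) => //.
- by rewrite /= !inE !xpair_eqE (negbTE npq) (eq_sym p r) (negbTE nqr) (negbTE nrp) !andbF.
- by move=> a; rewrite !inE => /or3P[]/eqP->.
- move=> v /=; rewrite !inE ![_ == v]eq_sym.
  have [->|vp] := eqVneq v p.
    by rewrite (negbTE npq) eq_sym (negbTE nrp).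
  have [->|vq] := eqVneq v q; first by rewrite (negbTE nqr).
  by have [_|] := eqVneq v r.
Qed.

(* Quivers obtained from [X], [A0] by attaching new vertices, either by a
   single arrow or by closing an arrow to an oriented triangle.  [N] collects
   the new arrows, [TL] the triangles with the new vertex last. *)
Inductive built X A0 : seq L -> seq (L * L) -> seq (L * L * L) -> Prop :=
| Built0 : built X A0 X [::] [::]
| BuiltLeaf V N TL d u v : built X A0 V N TL -> v \in V -> u \notin V ->
    built X A0 (u :: V) (ori d v u :: N) TL
| BuiltTri V N TL a b u : built X A0 V N TL -> (a, b) \in A0 ++ N -> u \notin V ->
    built X A0 (u :: V) [:: (b, u), (u, a) & N] ((a, b, u) :: TL)
| BuiltPerm V V' N N' TL TL' : built X A0 V N TL -> perm_eq V V' -> perm_eq N N' ->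
    perm_eq TL TL' -> built X A0 V' N' TL'.

Lemma notin_ends V A u a : {subset ends A <= V} -> u \notin V -> a \in A ->
  (a.1 != u) * (a.2 != u).
Proof.
move=> sA uV aA; have h1 := sA _ (ends1 aA); have h2 := sA _ (ends2 aA).
by split; apply: contraNneq uV => <-.
Qed.

Lemma ends_subset V A : (forall a, a \in A -> (a.1 \in V) && (a.2 \in V)) <->
    {subset ends A <= V}.
Proof.
split=> [h v /endsP [a aA e]|h a aA]; last by rewrite !h ?ends1 ?ends2.
by have /andP[h1 h2] := h _ aA; case/orP: e => /eqP <-.
Qed.

(** The last clause keeps the start a full subquiver: every later arrow touches a later vertex, so
    none is added between vertices of [X]. *)
Lemma built_basic X A0 V N TL : built X A0 V N TL -> uniq X -> {subset ends A0 <= X} ->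
  [/\ uniq V, {subset X <= V}, {subset ends (A0 ++ N) <= V}, uniq N &
      forall a, a \in N -> (a.1 \notin X) || (a.2 \notin X)].
Proof.
move=> bt uX sup; elim: bt => {V N TL}.
- by split=> //; rewrite cats0.
- move=> V N TL d u v _ [uV sXV sN uN nX] vV uV'.
  have uX' : u \notin X by apply: contra uV' => /sXV.
  split=> /=.
  + by rewrite uV'.
  + by move=> x /sXV; rewrite inE orbC => ->.
  + move/ends_subset in sN; apply/ends_subset => a.
    rewrite mem_cat inE orbCA -mem_cat => /orP[/eqP->|/sN/andP[h1 h2]].
      by case: d; rewrite /= !inE eqxx vV ?orbT.
    by rewrite !inE h1 h2 !orbT.
  + rewrite uN andbT; apply/negP => h.
    have [] := @notin_ends V (A0 ++ N) u (ori d v u) sN uV'.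
      by rewrite mem_cat h orbT.
    by case: (d); rewrite /= eqxx.
  + move=> a; rewrite inE => /orP[/eqP->|/nX//].
    by case: (d); rewrite /= uX' ?orbT.
- move=> V N TL a b u _ [uV sXV sN uN nX] abN uV'.
  have uX' : u \notin X by apply: contra uV' => /sXV.
  have nu c : c \in N -> (c.1 != u) * (c.2 != u).
    by move=> cN; apply: (@notin_ends V (A0 ++ N)) => //; rewrite mem_cat cN orbT.
  have [/= au bu] := notin_ends sN uV' abN.
  split=> /=.
  + by rewrite uV'.
  + by move=> x /sXV; rewrite inE orbC => ->.
  + move/ends_subset in sN; apply/ends_subset => c.
    have /andP[/= aV bV] := sN _ abN.
    rewrite mem_cat !inE orbCA (orbCA (c \in A0)) -mem_cat.
    by case/or3P => [/eqP->|/eqP->|/sN/andP[h1 h2]]; rewrite /= ?eqxx ?aV ?bV ?h1 ?h2 ?orbT.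
  + rewrite uN inE xpair_eqE negb_or negb_and bu /= andbT.
    by apply/andP; split; apply/negP => /nu [] /=; rewrite eqxx.
  + by move=> c; rewrite !inE => /or3P[/eqP->|/eqP->|/nX//]; rewrite /= uX' ?orbT.
- move=> V V' N N' TL TL' _ [uV sXV sN uN nX] pV pN _; split.
  + by rewrite -(perm_uniq pV).
  + by move=> x; rewrite -(perm_mem pV); apply: sXV.
  + move/ends_subset in sN; apply/ends_subset => a.
    by rewrite mem_cat -(perm_mem pN) -!(perm_mem pV) -mem_cat; apply: sN.
  + by rewrite -(perm_uniq pN).
  + by move=> a; rewrite -(perm_mem pN); apply: nX.
Qed.

Section BuiltFacts.
Variables (X : seq L) (A0 : seq (L * L)).
Hypotheses (uX : uniq X) (sup : {subset ends A0 <= X}).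
Hypothesis no2 : forall p q, (p, q) \in A0 -> (q, p) \notin A0.
Hypothesis no3 : forall p q r, (p, q) \in A0 -> (q, r) \in A0 -> (r, p) \notin A0.

Lemma built_no_2cycle V N TL p q : built X A0 V N TL ->
  (p, q) \in A0 ++ N -> (q, p) \notin A0 ++ N.
Proof.
move=> bt; elim: bt p q => {V N TL}.
- by move=> p q; rewrite cats0; apply: no2.
- move=> V N TL d u v bt IH vV uV p q.
  have [_ _ sN _ _] := built_basic bt uX sup.
  rewrite !mem_cat !inE !(orbCA (_ \in A0)) -!mem_cat => h.
  have uv : u != v by apply: contraNneq uV => ->.
  apply/negP => h'; case/orP: h => [/eqP e|h]; case/orP: h' => [/eqP e'|h'].
  + by move: e e' uv; case: (d) => -[-> ->] [->]; rewrite eqxx.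
  + have [/=] := notin_ends sN uV h'.
    by move: e; case: (d) => -[-> ->]; rewrite eqxx.
  + have [/=] := notin_ends sN uV h.
    by move: e'; case: (d) => -[-> ->]; rewrite eqxx.
  + by move: h'; apply/negP; apply: IH.
- move=> V N TL a b u bt IH abN uV p q.
  have [_ _ sN _ _] := built_basic bt uX sup.
  have [/= au bu] := notin_ends sN uV abN.
  (* A loop is its own opposite, so the induction hypothesis excludes it. *)
  have nab : a != b by apply/eqP => e; move: abN; rewrite -e => h; move: (IH a a h); rewrite h.
  rewrite !mem_cat !inE !(orbCA (_ \in A0)) -!mem_cat => h; apply/negP => h'.
  have key x y : (x, y) \in A0 ++ N ->
      ((x, y) == (b, u)) || ((x, y) == (u, a)) = false /\
      ((y, x) == (b, u)) || ((y, x) == (u, a)) = false.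
    move=> /(notin_ends sN uV) [/= xu yu].
    by rewrite !xpair_eqE (negbTE xu) (negbTE yu) !andbF.
  move: h h'; rewrite !orbA => /orP[h|h] /orP[h'|h'].
  + case/orP: h => /eqP[e1 e2]; case/orP: h' => /eqP[e3 e4]; move: au bu nab.
    * by rewrite -e2 -e3 eqxx.
    * by rewrite -e1 -e4 eqxx.
    * by rewrite -e2 -e3 eqxx.
    * by rewrite -e2 -e3 eqxx.
  + by have [_] := key _ _ h'; rewrite h.
  + by have [_] := key _ _ h; rewrite h'.
  + by move: h'; apply/negP; apply: IH.
- move=> V V' N N' TL TL' _ IH pV pN pT p q.
  by rewrite !mem_cat -!(perm_mem pN) -!mem_cat; apply: IH.
Qed.

Lemma built_no_loop V N TL p : built X A0 V N TL -> (p, p) \notin A0 ++ N.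
Proof. by move=> bt; apply/negP => h; move: (built_no_2cycle bt h); rewrite h. Qed.

(** When it is attached, a leaf has a single arrow, so no 3-cycle passes through it, and an apex has
    one arrow in and one out, so its recorded triangle is the only 3-cycle through it. The
    disjunction accounts for the starting point. *)
Lemma built_3cycle V N TL p q r : built X A0 V N TL ->
  (p, q) \in A0 ++ N -> (q, r) \in A0 ++ N -> (r, p) \in A0 ++ N ->
  [|| (p, q, r) \in TL, (q, r, p) \in TL | (r, p, q) \in TL].
Proof.
move=> bt; elim: bt p q r => {V N TL}.
- by move=> p q r; rewrite cats0 => h1 h2; rewrite (negbTE (no3 h1 h2)).
- move=> V N TL d u v bt IH vV uV.
  have [_ _ sN _ _] := built_basic bt uX sup.
  have uv : u != v by apply: contraNneq uV => ->.
  have nl := built_no_loop _ (BuiltLeaf d bt vV uV).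
  have old x y : x != u -> y != u -> (x, y) \in A0 ++ ori d v u :: N -> (x, y) \in A0 ++ N.
    move=> xu yu; rewrite !mem_cat inE orbCA; case/orP=> // /eqP e.
    by move: e xu yu; case: (d) => -[-> ->]; rewrite eqxx.
  have new x : ((u, x) \in A0 ++ ori d v u :: N -> (u, x) = ori d v u) *
               ((x, u) \in A0 ++ ori d v u :: N -> (x, u) = ori d v u).
    rewrite !mem_cat !inE !(orbCA (_ \in A0)) -!mem_cat.
    by split=> /orP[/eqP//|/(notin_ends sN uV)[/=]]; rewrite eqxx.
  have hu x y : (u, x) \in A0 ++ ori d v u :: N -> (y, u) \in A0 ++ ori d v u :: N -> False.
    move=> h1 h2; have e1 := (new x).1 h1; have e2 := (new y).2 h2.
    by move: (congr1 fst e1) (congr1 snd e2) uv; case: (d) => /= f1 f2; rewrite ?f1 ?f2 eqxx.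
  move=> p q r h1 h2 h3.
  have [e|pu] := eqVneq p u; first by subst p; case: (hu _ _ h1 h3).
  have [e|qu] := eqVneq q u; first by subst q; case: (hu _ _ h2 h1).
  have [e|ru] := eqVneq r u; first by subst r; case: (hu _ _ h3 h2).
  by apply: IH; apply: old.
- move=> V N TL a b u bt IH abN uV.
  have [_ _ sN _ _] := built_basic bt uX sup.
  have [/= au bu] := notin_ends sN uV abN.
  set A' := A0 ++ _.
  have old x y : x != u -> y != u -> (x, y) \in A' -> (x, y) \in A0 ++ N.
    move=> xu yu; rewrite /A' !mem_cat !inE !(orbCA (_ \in A0)).
    by rewrite !xpair_eqE (negbTE xu) (negbTE yu) andbF.
  have new x : ((u, x) \in A' -> x = a) * ((x, u) \in A' -> x = b).
    rewrite /A' !mem_cat !inE !(orbCA (_ \in A0)) -!mem_cat !xpair_eqE eqxx (eq_sym u b)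
        (eq_sym u a).
    rewrite (negbTE bu) (negbTE au) !andbF !andbT /=.
    by split=> /orP[/eqP//|/(notin_ends sN uV)[/=]]; rewrite eqxx.
  have hu x y : (u, x) \in A' -> (y, u) \in A' -> (x, y, u) = (a, b, u).
    by move=> h1 h2; rewrite ((new x).1 h1) ((new y).2 h2).
  move=> p q r h1 h2 h3; rewrite !inE.
  have [e|pu] := eqVneq p u; first by subst p; rewrite (hu _ _ h1 h3) eqxx !orbT.
  have [e|qu] := eqVneq q u; first by subst q; rewrite (hu _ _ h2 h1) eqxx !orbT.
  have [e|ru] := eqVneq r u; first by subst r; rewrite (hu _ _ h3 h2) eqxx ?orbT.
  have /or3P [] := IH _ _ _ (old _ _ pu qu h1) (old _ _ qu ru h2) (old _ _ ru pu h3);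
    by move=> ->; rewrite !orbT.
- move=> V V' N N' TL TL' _ IH pV pN pT p q r.
  by rewrite !mem_cat -!(perm_mem pN) -!(perm_mem pT) -!mem_cat; apply: IH.
Qed.

Lemma built_conn V N TL (P : pred L) : built X A0 V N TL ->
  (forall a, a \in A0 ++ N -> P a.1 = P a.2) -> all P X -> all P V.
Proof.
move=> bt; elim: bt => {V N TL} //.
- move=> V N TL d u v _ IH vV _ cl PX.
  have PV : all P V.
    by apply: IH PX => a aN; apply: cl; move: aN; rewrite !mem_cat inE => /orP[]->;
        rewrite ?orbT.
  rewrite /= PV andbT; have := allP PV _ vV.
  have := cl (ori d v u); rewrite mem_cat inE eqxx orbT => /(_ isT).
  by case: (d) => /= ->.
- move=> V N TL a b u bt IH abN _ cl PX.
  have PV : all P V.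
    by apply: IH PX => c cN; apply: cl; move: cN; rewrite !mem_cat !inE => /orP[]->;
        rewrite ?orbT.
  have [_ _ sN _ _] := built_basic bt uX sup.
  rewrite /= PV andbT -(cl (b, u)) ?mem_cat ?inE ?eqxx ?orbT //=.
  by apply: (allP PV); apply: sN; apply: (ends2 abN).
- move=> V V' N N' TL TL' _ IH pV pN _ cl PX.
  by rewrite -(perm_all _ pV); apply: IH PX => a; rewrite mem_cat (perm_mem pN) -mem_cat;
      apply: cl.
Qed.

Lemma built_TL V N TL p q r : built X A0 V N TL -> (p, q, r) \in TL ->
  [/\ (p, q) \in A0 ++ N, (q, r) \in N, (r, p) \in N & r \notin X].
Proof.
move=> bt; elim: bt p q r => {V N TL} //.
- move=> V N TL d u v _ IH _ _ p q r /IH [h1 h2 h3 h4].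
  by rewrite mem_cat !inE orbCA -mem_cat h1 h2 h3 !orbT.
- move=> V N TL a b u bt IH abN uV p q r; have [_ sX _ _ _] := built_basic bt uX sup.
  rewrite inE => /orP[/eqP[-> -> ->]|/IH [h1 h2 h3 h4]].
    rewrite mem_cat !inE !(orbCA (_ \in A0)) -mem_cat abN !eqxx !orbT; split=> //.
    by apply: contra uV => /sX.
  by rewrite mem_cat !inE !(orbCA (_ \in A0)) -mem_cat h1 h2 h3 !orbT.
- move=> V V' N N' TL TL' _ IH _ pN pT p q r.
  by rewrite mem_cat -!(perm_mem pN) -(perm_mem pT) -mem_cat; apply: IH.
Qed.

End BuiltFacts.

Definition restr (V : seq L) A := [seq a <- A | (a.1 \in V) && (a.2 \in V)].

Lemma ring_perm X A A' : perm_eq A A' -> ring X A -> ring X A'.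
Proof.
move=> pA [s d c [v vX t]]; split.
- apply/ends_subset => a; rewrite -(perm_mem pA); move/ends_subset: s; exact.
- by move=> u uX; rewrite -(perm_ends _ pA) d.
- by move=> P h; apply: c => a; rewrite (perm_mem pA); apply: h.
- by exists v => //; rewrite -(permP (perm_map _ pA)).
Qed.

Lemma count_ends_filter P A v : count_mem v (ends (filter P A)) <= count_mem v (ends A).
Proof. by elim: A => //= a A; rewrite /ends /= !count_cat /=; case: (P a) => /=;
    rewrite ?count_cat; lia. Qed.

(** Induction on the construction keeps the newest vertex out of [V']: a leaf has degree at most 1,
    and an apex reaches degree 2 only if both ends of its base are in [V'], which puts an oriented
    triangle into the ring. What remains lies in [X], where degree 2 in both rings makes [V'] closed
    under adjacency. *)
Lemma ring_unique X A0 V N TL (V' : seq L) : uniq X -> ring X A0 -> built X A0 V N TL ->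
  {subset V' <= V} -> ring V' (restr V' (A0 ++ N)) -> V' =i X.
Proof.
move=> uX rX bt; have sup := ring_supp rX; elim: bt => {V N TL}.
- rewrite cats0 => sV rV.
  have cl a : a \in A0 -> (a.1 \in V') = (a.2 \in V').
    have aux v w : (v \in V') -> has (fun a => ((a.1 == v) && (a.2 == w)) || ((a.1 == w) &&
        (a.2 == v))) A0 -> w \in V'.
      move=> vV h; apply: contraTT h => wV; rewrite -all_predC.
      (* Both degrees are 2, so the restriction to [V'] loses no arrow at [v]. *)
      have e : count_mem v (ends (restr V' A0)) = count_mem v (ends A0).
        by rewrite (ring_deg rV vV) (ring_deg rX) ?sV.
      apply/allP => b bA /=; apply/negP => hb.
      have bR : b \in restr V' A0 = false.
        rewrite mem_filter; case/orP: hb => /andP[/eqP e1 /eqP e2];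
          by rewrite e1 e2 (negbTE wV) ?andbF.
      have [B pB] : exists B, perm_eq A0 (b :: B) by exists (rem b A0); apply: perm_to_rem.
      move: e; rewrite /restr (perm_ends _ (perm_filter _ pB)) (perm_ends _ pB) -/(restr _ _).
      rewrite (_ : restr V' (b :: B) = restr V' B); last first.
        by move: bR; rewrite /restr /= mem_filter bA andbT => ->.
      have := count_ends_filter (fun a => (a.1 \in V') && (a.2 \in V')) B v.
      rewrite -/(restr V' B) /ends /= !count_cat /= => le.
      case/orP: hb => /andP[/eqP e1 /eqP e2]; rewrite ?e1 ?e2 eqxx; lia.
    move=> aA; apply/idP/idP => h; apply: aux h _; apply/hasP; exists a => //;
        by rewrite !eqxx ?orbT.
  have [v vV _] := ring_turn rV.
  have /allP all' : all (mem V') X.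
    by apply: (ring_conn rX) => //; apply/hasP; exists v => //; apply: sV.
  by move=> x; apply/idP/idP => [/sV|/all'].
- move=> V N TL d u v bt IH vV uV sV rV.
  have [_ _ sN _ _] := built_basic bt uX sup.
  have uV' : u \notin V'.
    apply/negP => uV'; have := ring_deg rV uV'.
    have := count_ends_filter (fun a => (a.1 \in V') && (a.2 \in V')) (A0 ++ ori d v u :: N) u.
    rewrite -/(restr _ _) => + e; rewrite e.
    have pA : perm_eq (A0 ++ ori d v u :: N) (ori d v u :: (A0 ++ N)) by apply/permP => z;
        rewrite /= !count_cat /=; lia.
    have e0 : count_mem u (ends (A0 ++ N)) = 0 by apply/count_memPn; apply: contra uV => /sN.
    rewrite (perm_ends _ pA) -cat1s ends_cat e0.
    have uv : u != v by apply: contraNneq uV => ->.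
    by case: (d); rewrite /= eqxx eq_sym (negbTE uv).
  apply: IH; first by move=> x xV; have := sV _ xV; rewrite inE; case: eqP xV uV' => [->->|].
  move: rV; rewrite /restr !filter_cat /=; case: ifP => // /andP[].
  by case: (d) => /=; rewrite (negbTE uV').
- move=> V N TL a b u bt IH abN uV sV rV.
  have [_ _ sN _ _] := built_basic bt uX sup.
  have [/= au bu] := notin_ends sN uV abN.
  have uV' : u \notin V'.
    apply/negP => uV'; have dg := ring_deg rV uV'.
    have pA : perm_eq (A0 ++ [:: (b, u), (u, a) & N]) ([:: (b, u); (u, a)] ++ (A0 ++ N)).
      by apply/permP => z; rewrite /= !count_cat /=; lia.
    move: dg; rewrite (perm_ends _ (perm_filter _ pA)) filter_cat ends_cat.
    rewrite (_ : count_mem u (ends (filter _ (A0 ++ N))) = 0); last first.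
      apply/count_memPn/negP => /endsP [c]; rewrite mem_filter =>
          /andP[_ /(notin_ends sN uV) [h1 h2]].
      by rewrite (negbTE h1) (negbTE h2).
    have [aV|] := boolP (a \in V'); last first.
      by move=> /negbTE na; rewrite /= uV' na !andbF andbT; case: (b \in V');
          rewrite /ends /= ?(negbTE bu) ?eqxx.
    have [bV|] := boolP (b \in V'); last first.
      by move=> /negbTE nb; rewrite /= uV' nb aV /ends /= (negbTE au) eqxx.
    move=> _.
    have := @ring_no_3cycle _ _ b u a rV; rewrite !mem_filter uV' aV bV /= !mem_cat !inE !eqxx
        !orbT.
    by move=> /(_ isT isT); rewrite !(orbCA (_ \in A0)) -mem_cat abN !orbT.
  apply: IH; first by move=> x xV; have := sV _ xV; rewrite inE; case: eqP xV uV' => [->->|].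
  by move: rV; rewrite /restr !filter_cat /= (negbTE uV') andbF.
- move=> V V1 N N' TL TL' bt IH pV pN _ sV rV; apply: IH.
    by move=> x /sV; rewrite (perm_mem pV).
  by apply: ring_perm rV; apply: perm_filter; rewrite perm_cat2l perm_sym.
Qed.

End ArrowLists.

(* Generalizing the atoms first keeps lia from reasoning about booleans. *)
Ltac natlia := try change (nat_of_bool true) with 1; try change (nat_of_bool false) with 0;
    repeat match goal with
  | |- context [nat_of_bool ?b] => move: (nat_of_bool b) => ?
  | |- context [count ?p ?s] => move: (count p s) => ?
  end; clear; lia.
Ltac permlia := apply/permP => ?; repeat (progress rewrite /= ?(count_cat, cats0)); natlia.

(** * Mutation of arrow lists *)

Section MutRel.
Variable L : eqType.
Implicit Types (A N C M R : seq (L * L)) (I O : seq L).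

(* Mutation at [k] of the arrow list [A]: [I] are the sources of the arrows into
   [k], [O] the targets of those out of [k], [R] is not affected.  The last
   clause is the mutation rule for signed numbers of arrows; in this form the
   relation is symmetric in [A] and [A']. *)
Definition mutrel (k : L) A A' : Prop := exists I O M M' R,
  [/\ perm_eq A ([seq (a, k) | a <- I] ++ [seq (k, b) | b <- O] ++ M ++ R),
      perm_eq A' ([seq (k, a) | a <- I] ++ [seq (b, k) | b <- O] ++ M' ++ R),
      k \notin I ++ O ++ ends (M ++ M' ++ R) &
      forall p q,
        count_mem (p, q) M + count_mem p I * count_mem q O + count_mem (q, p) M' =
        count_mem (q, p) M + count_mem q I * count_mem p O + count_mem (p, q) M'].

Lemma mem_ends_cat A C v : (v \in ends (A ++ C)) = (v \in ends A) || (v \in ends C).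
Proof. by rewrite !mem_ends has_cat. Qed.

Lemma notin_mut k I O A C R : k \notin I ++ O ++ ends (A ++ C ++ R) =
  [&& k \notin I, k \notin O, k \notin ends A, k \notin ends C & k \notin ends R].
Proof. by rewrite mem_cat negb_or mem_cat negb_or !mem_ends_cat !negb_or. Qed.

Lemma mutrel_sym k A A' : mutrel k A A' -> mutrel k A' A.
Proof.
move=> [I [O [M [M' [R [pA pA' kN H]]]]]]; exists O, I, M', M, R; split.
- by apply: perm_trans pA' _; rewrite perm_catCA.
- by apply: perm_trans pA _; rewrite perm_catCA.
- by move: kN; rewrite !notin_mut => /and5P[-> -> -> -> ->].
- by move=> p q; move: (H p q); rewrite [count_mem p O * _]mulnC [count_mem q O * _]mulnC; lia.
Qed.

Lemma mutrel_perm k A A' B B' : perm_eq A B -> perm_eq A' B' -> mutrel k A A' -> mutrel k B B'.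
Proof.
move=> pB pB' [I [O [M [M' [R [pA pA' kN H]]]]]]; exists I, O, M, M', R; split=> //.
  by apply: perm_trans pA; rewrite perm_sym.
by apply: perm_trans pA'; rewrite perm_sym.
Qed.

Lemma count_allpairs I O p q :
  count_mem (p, q) [seq (a, b) | a <- I, b <- O] = count_mem p I * count_mem q O.
Proof.
elim: I => //= a I IH; rewrite count_cat IH mulnDl; congr (_ + _).
rewrite count_map; case: eqP => [->|ne] /=.
  by rewrite mul1n; apply: eq_count => b /=; rewrite xpair_eqE eqxx.
by rewrite mul0n -(count_pred0 O); apply: eq_count => b /=; rewrite xpair_eqE; case: eqP ne.
Qed.

(* [C] lists the pairs of opposite arrows that cancel. *)
Lemma mutrelI k I O M M' C R A A' :
  perm_eq (M ++ [seq (a, b) | a <- I, b <- O]) (M' ++ C ++ [seq (c.2, c.1) | c <- C]) ->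
  perm_eq A ([seq (a, k) | a <- I] ++ [seq (k, b) | b <- O] ++ M ++ R) ->
  perm_eq A' ([seq (k, a) | a <- I] ++ [seq (b, k) | b <- O] ++ M' ++ R) ->
  k \notin I ++ O ++ ends (M ++ M' ++ R) -> mutrel k A A'.
Proof.
move=> pM pA pA' kN; exists I, O, M, M', R; split=> // p q.
have sw x y : count_mem (x, y) [seq (c.2, c.1) | c <- C] = count_mem (y, x) C.
  by rewrite count_map; apply: eq_count => -[c d] /=; rewrite !xpair_eqE andbC.
have := permP pM (pred1 (p, q)); have := permP pM (pred1 (q, p)).
by rewrite !count_cat !count_allpairs !sw; lia.
Qed.

Lemma count_ends0 A p q : q \notin ends A -> (count_mem (p, q) A = 0) * (count_mem (q,
    p) A = 0).
Proof.
by move=> h; split; apply/count_memPn; apply: contra h => /[dup] /ends1 + /ends2.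
Qed.

(** The signed rule in [mutrel] fixes only the difference of opposite counts in [A']. As [A'] has no
    2-cycles, one of the two counts vanishes, and the other is then the truncated difference in
    [mutate_narr]. *)
Lemma mutP (T : finType) (f : T -> L) (Q : quiver T) k A A' : injective f ->
  (forall i j, Q i j = count_mem (f i, f j) A) -> mutrel (f k) A A' ->
  (forall p q, (p, q) \in A' -> (q, p) \notin A') ->
  forall i j, mutate Q k i j = count_mem (f i, f j) A'.
Proof.
move=> fI QA [I [O [M [M' [R [pA pA' kN H]]]]]] no2.
have [kI kO kM kM' kR] : [/\ f k \notin I, f k \notin O, f k \notin ends M,
    f k \notin ends M' & f k \notin ends R].
  by move: kN; rewrite notin_mut => /and5P.
have cin x y : count_mem (x, y) [seq (a, f k) | a <- I] = (y == f k) * count_mem x I.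
  rewrite count_map; case: eqP => [->|ne]; rewrite ?mul1n ?mul0n.
    by apply: eq_count => z /=; rewrite xpair_eqE eqxx andbT.
  by rewrite -(count_pred0 I); apply: eq_count => z /=; rewrite xpair_eqE andbC;
      case: eqP => // e; case: ne.
have cin' x y : count_mem (x, y) [seq (f k, a) | a <- I] = (x == f k) * count_mem y I.
  rewrite count_map; case: eqP => [->|ne]; rewrite ?mul1n ?mul0n.
    by apply: eq_count => z /=; rewrite xpair_eqE eqxx.
  by rewrite -(count_pred0 I); apply: eq_count => z /=; rewrite xpair_eqE; case: eqP => // e;
      case: ne.
have cou x y : count_mem (x, y) [seq (f k, a) | a <- O] = (x == f k) * count_mem y O.
  rewrite count_map; case: eqP => [->|ne]; rewrite ?mul1n ?mul0n.
    by apply: eq_count => z /=; rewrite xpair_eqE eqxx.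
  by rewrite -(count_pred0 O); apply: eq_count => z /=; rewrite xpair_eqE; case: eqP => // e;
      case: ne.
have cou' x y : count_mem (x, y) [seq (a, f k) | a <- O] = (y == f k) * count_mem x O.
  rewrite count_map; case: eqP => [->|ne]; rewrite ?mul1n ?mul0n.
    by apply: eq_count => z /=; rewrite xpair_eqE eqxx andbT.
  by rewrite -(count_pred0 O); apply: eq_count => z /=; rewrite xpair_eqE andbC;
      case: eqP => // e; case: ne.
have EA x y : count_mem (x, y) A = (y == f k) * count_mem x I + (x == f k) * count_mem y O
    + count_mem (x, y) M + count_mem (x, y) R.
  by rewrite (permP pA) !count_cat cin cou !addnA.
have EA' x y : count_mem (x, y) A' = (x == f k) * count_mem y I + (y == f k) * count_mem x O
    + count_mem (x, y) M' + count_mem (x, y) R.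
  by rewrite (permP pA') !count_cat cin' cou' !addnA.
have I0 := count_memPn kI; have O0 := count_memPn kO.
have M0 x := count_ends0 x kM; have M0' x := count_ends0 x kM'; have R0 x := count_ends0 x kR.
have fE i : (f i == f k) = (i == k) by apply: inj_eq.
move=> i j; rewrite /mutate /= /mutate_narr !QA EA' !EA !fE eqxx.
have [ik|nik] := eqVneq i k; first by subst i; rewrite !M0 !M0' !R0 /= ?I0 ?O0 ?muln0 ?mul0n
    ?mul1n ?addn0.
have [jk|njk] := eqVneq j k; first by subst j; rewrite !M0 !M0' !R0 /= ?I0 ?O0 ?muln0 ?mul0n
    ?mul1n ?addn0.
rewrite /= ?mul0n ?mul1n !M0 !R0 ?add0n ?addn0.
have := H (f i) (f j).
have : count_mem (f i, f j) A' = 0 \/ count_mem (f j, f i) A' = 0.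
  have [h|h] := boolP ((f i, f j) \in A'); last by left; apply/count_memPn.
  by right; apply/count_memPn; apply: no2.
rewrite !EA' !fE (negbTE nik) (negbTE njk) !mul0n !add0n.
by move: (_ * _) (_ * _) => a b; natlia.
Qed.

End MutRel.

(** * Type A quivers as trees *)

Section Branches.
Variable L : eqType.

(* The part of a type A quiver hanging at a vertex [v]: empty, an arrow between
   [v] and [x] (outgoing for [true]), or an oriented 3-cycle v -> x -> y -> v. *)
Inductive branch :=
| Nil
| Ar of bool & L & branch
| Tr of L & branch & L & branch.

Fixpoint branch_verts (b : branch) : seq L :=
  match b with
  | Nil => [::]
  | Ar _ x b => x :: branch_verts b
  | Tr x b y c => x :: y :: branch_verts b ++ branch_verts c
  end.

Fixpoint branch_arrows (v : L) (b : branch) : seq (L * L) :=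
  match b with
  | Nil => [::]
  | Ar d x b => ori d v x :: branch_arrows x b
  | Tr x b y c => [:: (x, y), (y, v), (v, x) & branch_arrows x b ++ branch_arrows y c]
  end.

(** The arrows on no triangle of the branch; they are counted by r_1 and s_1. *)
Fixpoint branch_free (v : L) (b : branch) : seq (L * L) :=
  match b with
  | Nil => [::]
  | Ar d x b => ori d v x :: branch_free x b
  | Tr x b y c => branch_free x b ++ branch_free y c
  end.

Fixpoint branch_tris (v : L) (b : branch) : seq (L * L * L) :=
  match b with
  | Nil => [::]
  | Ar d x b => branch_tris x b
  | Tr x b y c => (v, x, y) :: branch_tris x b ++ branch_tris y c
  end.

Fixpoint branch_eq (b c : branch) : bool :=
  match b, c with
  | Nil, Nil => true
  | Ar d x b, Ar e y c => [&& d == e, x == y & branch_eq b c]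
  | Tr x b1 y b2, Tr z c1 w c2 => [&& x == z, y == w, branch_eq b1 c1 & branch_eq b2 c2]
  | _, _ => false
  end.

Lemma branch_eqP : Equality.axiom branch_eq.
Proof.
elim=> [|d x b IH|x b1 IH1 y b2 IH2] [|e z c|z c1 w c2] /=; try by constructor.
  have [->|ne] := eqVneq d e; last by constructor=> h; injection h; intros; subst;
      rewrite eqxx in ne.
  have [->|ne'] := eqVneq x z; last by constructor=> h; injection h; intros; subst;
      rewrite eqxx in ne'.
  by apply: (iffP (IH c)) => [->|[->]].
have [->|ne] := eqVneq x z; last by constructor=> h; injection h; intros; subst;
    rewrite eqxx in ne.
have [->|ne'] := eqVneq y w; last by constructor=> h; injection h; intros; subst;
    rewrite eqxx in ne'.
rewrite /=; apply: (iffP andP) => [[/IH1-> /IH2->]//|[e1 e2]].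
by split; [apply/IH1 | apply/IH2].
Qed.

HB.instance Definition _ := hasDecEq.Build branch branch_eqP.

Lemma ends_branch v b : {subset ends (branch_arrows v b) <= v :: branch_verts b}.
Proof.
apply/ends_subset; elim: b v => //= [d x b IH|x b IHb y c IHc] v a; rewrite !inE.
  case/orP=> [/eqP->|/IH]; first by case: d; rewrite /= ?eqxx ?orbT.
  by rewrite !inE => /andP[-> ->]; rewrite !orbT.
rewrite !mem_cat.
case/or4P => [/eqP->|/eqP->|/eqP->|/orP[/IHb|/IHc]] /=; rewrite ?eqxx ?orbT // !inE.
  by case/andP=> /orP[]-> /orP[]->; rewrite ?orbT.
by case/andP=> /orP[]-> /orP[]->; rewrite ?orbT.
Qed.

Lemma notin_ends_branch k v b : k != v -> k \notin branch_verts b ->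
    k \notin ends (branch_arrows v b).
Proof. by move=> kv kb; apply/negP => /ends_branch; rewrite inE (negbTE kv) (negbTE kb). Qed.

Lemma uniq_perm_eq (s t : seq L) : uniq s -> perm_eq s t -> uniq t.
Proof. by move=> u /perm_uniq <-. Qed.

Lemma built_branch X A0 V N TL v b : built X A0 V N TL -> v \in V ->
    uniq (branch_verts b ++ V) ->
  built X A0 (branch_verts b ++ V) (branch_arrows v b ++ N) (branch_tris v b ++ TL).
Proof.
elim: b v V N TL => //= [d x b IH|x b IHb y c IHc] v V N TL bt vV u.
  have /andP[] := u; rewrite mem_cat negb_or => /andP[_ xV] _.
  have bt' := BuiltLeaf d bt vV xV.
  have u2 : uniq (branch_verts b ++ x :: V) by apply: (@uniq_perm_eq (x :: branch_verts b ++
      V)) => //; permlia.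
  by apply: (BuiltPerm (IH x _ _ _ bt' _ u2)); rewrite ?inE ?eqxx //; permlia.
have /and3P[] := u; rewrite inE !mem_cat !negb_or => /and3P[xy _ xV] /andP[_ yV] _.
(* A triangle is attached in two steps: [x] as a leaf along v -> x, then [y] as the apex over this
   arrow. *)
have bt1 := BuiltLeaf true bt vV xV.
have bt2 : built X A0 [:: y, x & V] [:: (x, y), (y, v), (v, x) & N] ((v, x, y) :: TL).
  apply: (BuiltTri bt1); first by rewrite mem_cat inE eqxx orbT.
  by rewrite inE negb_or eq_sym xy.
have u4 : uniq (branch_verts c ++ branch_verts b ++ [:: y,
    x & V]) by apply: (@uniq_perm_eq ([:: x, y & branch_verts b ++ branch_verts c] ++ V)) =>
    //; permlia.
have u3 : uniq (branch_verts b ++ [:: y, x & V]) by move: u4; rewrite cat_uniq => /and3P[].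
have bt3 := IHb x _ _ _ bt2 (mem_behead (s := [:: y, x & V]) (mem_head _ _)) u3.
have yb : y \in branch_verts b ++ [:: y, x & V] by rewrite mem_cat mem_head orbT.
have bt4 := IHc y _ _ _ bt3 yb u4.
by apply: (BuiltPerm bt4); permlia.
Qed.

(* The triple (v, b, b') is the type A quiver with two branches at [v]; any of its
   vertices can serve as [v]. *)
Definition tree_verts (c : L * branch * branch) : seq L := c.1.1 :: branch_verts c.1.2 ++
    branch_verts c.2.
Definition tree_arrows (c : L * branch * branch) : seq (L * L) :=
    branch_arrows c.1.1 c.1.2 ++ branch_arrows c.1.1 c.2.

(** A tree is built from the one-vertex quiver without arrows, so [built_no_2cycle] applies. *)
Lemma tree_no_2cycle c p q : uniq (tree_verts c) -> (p, q) \in tree_arrows c ->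
    (q, p) \notin tree_arrows c.
Proof.
case: c => [[v h1] h2]; rewrite /tree_verts /tree_arrows /= => u.
have uh1 : uniq (branch_verts h1 ++ branch_verts h2 ++ [:: v]) by apply: (@uniq_perm_eq (v ::
    branch_verts h1 ++ branch_verts h2)) => //; permlia.
have uh2 : uniq (branch_verts h2 ++ [:: v]) by move: uh1; rewrite cat_uniq => /and3P[].
have bt0 : built [:: v] [::] [:: v] [::] [::] by apply: Built0.
have bt1 := built_branch bt0 (mem_head _ _) uh2.
have vi : v \in branch_verts h2 ++ [:: v] by rewrite mem_cat mem_head orbT.
have := built_branch bt1 vi uh1; rewrite !cats0 => bt2.
by apply: (built_no_2cycle _ _ _ bt2).
Qed.

End Branches.

Lemma ends_cons (L : eqType) (a : L * L) A v :
  (v \in ends (a :: A)) = [|| v == a.1, v == a.2 | v \in ends A].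
Proof. by rewrite !mem_ends /= !(eq_sym v) orbA. Qed.

Ltac kside := rewrite notin_mut ?(mem_ends_cat, ends_cons) /= ?inE ?negb_or /= ?inE ?negb_or /=;
  repeat match goal with |- is_true (_ && _) => apply/andP; split end;
  try done; try (by apply: notin_ends_branch); try (by rewrite eq_sym).

Ltac splithyps := repeat match goal with
  | H : is_true (_ && _) |- _ => let h1 := fresh "n" in let h2 := fresh "n" in
      move/andP: H => [h1 h2]
  end.

Section TreeMoves.
Variables (L : eqType).
Implicit Types (h b c e g : branch L) (k v x y z w : L).
Local Notation Nil := (@Nil L).

(** It suffices to list moves at the root, since re-rooting brings any vertex there. *)
Definition tree_move k (p q : L * branch L * branch L) : Prop :=
  perm_eq (tree_verts p) (tree_verts q) /\ (uniq (tree_verts p) ->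
      mutrel k (tree_arrows p) (tree_arrows q)).

Ltac amv := split; [rewrite /tree_verts; permlia | rewrite /tree_verts /tree_arrows /=
    ?(mem_cat, inE) /= ?negb_or => /andP[? _]; splithyps].

Lemma tree_move_Nil k : tree_move k (k, Nil, Nil) (k, Nil, Nil).
Proof.
split=> // _.
by apply: (@mutrelI _ k [::] [::] [::] [::] [::] [::]).
Qed.

Lemma tree_move_Ar k d x b : tree_move k (k, Ar d x b, Nil) (k, Ar (~~ d) x b, Nil).
Proof.
amv; case: d.
  by apply: (@mutrelI _ k [::] [:: x] [::] [::] [::] (branch_arrows x b)); try permlia; kside.
by apply: (@mutrelI _ k [:: x] [::] [::] [::] [::] (branch_arrows x b)); try permlia; kside.
Qed.

Lemma tree_move_ArAr k d x b y c :
  tree_move k (k, Ar d x b, Ar d y c) (k, Ar (~~ d) x b, Ar (~~ d) y c).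
Proof.
amv; case: d.
  by apply: (@mutrelI _ k [::] [:: x; y] [::] [::] [::] (branch_arrows x b ++
      branch_arrows y c)); try permlia; kside.
by apply: (@mutrelI _ k [:: x; y] [::] [::] [::] [::] (branch_arrows x b ++
    branch_arrows y c)); try permlia; kside.
Qed.

Lemma tree_move_ArAr' k x b y c :
  tree_move k (k, Ar true x b, Ar false y c) (k, Tr y c x b, Nil).
Proof.
amv.
by apply: (@mutrelI _ k [:: y] [:: x] [::] [:: (y, x)] [::] (branch_arrows x b ++
    branch_arrows y c)); try permlia; kside.
Qed.

Lemma tree_move_TrNil k x b y c :
  tree_move k (k, Tr x b y c, Nil) (k, Ar true y c, Ar false x b).
Proof.
amv.
by apply: (@mutrelI _ k [:: y] [:: x] [:: (x, y)] [::] [:: (x,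
    y)] (branch_arrows x b ++ branch_arrows y c)); try permlia; kside.
Qed.

(** The path through [k] inside the triangle cancels its third side, while the path using the arrow
    at [z] creates a new one. The triangle thus moves over to [z], and one of its old vertices is
    left on a single arrow. *)
Lemma tree_move_TrAr k d x b y c z e :
  tree_move k (k, Tr x b y c, Ar d z e)
    (if d then (k, Tr y c z e, Ar false x b) else (k, Tr z e x b, Ar true y c)).
Proof.
case: d; amv.
  by apply: (@mutrelI _ k [:: y] [:: x; z] [:: (x, y)] [:: (y, z)] [:: (x,
      y)] (branch_arrows x b ++ branch_arrows y c ++ branch_arrows z e)); try permlia; kside.
by apply: (@mutrelI _ k [:: y; z] [:: x] [:: (x, y)] [:: (z, x)] [:: (x,
    y)] (branch_arrows x b ++ branch_arrows y c ++ branch_arrows z e)); try permlia; kside.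
Qed.

(** The two paths through [k] inside a triangle cancel the opposite sides, and the two mixed paths
    become the new sides, so the triangles exchange partners. *)
Lemma tree_move_TrTr k x b y c z e w g :
  tree_move k (k, Tr x b y c, Tr z e w g) (k, Tr y c z e, Tr w g x b).
Proof.
amv.
by apply: (@mutrelI _ k [:: y; w] [:: x; z] [:: (x, y); (z, w)] [:: (y, z); (w, x)]
  [:: (x, y); (z, w)] (branch_arrows x b ++ branch_arrows y c ++ branch_arrows z e ++
      branch_arrows w g)); try permlia; kside.
Qed.

Section Rep.
Variables (T : finType) (f : T -> L).
Implicit Types Q : quiver T.

(* The labels [f] allow for quivers on a subset of the vertices of another one. *)
Definition tree_rep Q (p : L * branch L * branch L) : Prop :=
  [/\ injective f, uniq (tree_verts p), codom f =i tree_verts p &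
      forall i j, Q i j = count_mem (f i, f j) (tree_arrows p)].

Lemma tree_rep_perm Q p q : perm_eq (tree_verts p) (tree_verts q) ->
    perm_eq (tree_arrows p) (tree_arrows q) ->
  tree_rep Q p -> tree_rep Q q.
Proof.
move=> pv pa [fI u cf QE]; split=> //.
- by rewrite -(perm_uniq pv).
- by move=> l; rewrite cf (perm_mem pv).
- by move=> i j; rewrite QE (permP pa).
Qed.

Lemma tree_rep_mut Q (k : T) p q : tree_move (f k) p q -> tree_rep Q p ->
    tree_rep (mutate Q k) q.
Proof.
move=> [pv /[swap] -[fI u cf QE] /(_ u) mr]; have uq : uniq (tree_verts q) by rewrite
    -(perm_uniq pv).
split=> //; first by move=> l; rewrite cf (perm_mem pv).
by apply: mutP QE mr _ => // x y; apply: tree_no_2cycle.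
Qed.

Lemma tree_rep_swap Q v h b : tree_rep Q (v, h, b) -> tree_rep Q (v, b, h).
Proof. by apply: tree_rep_perm; rewrite /tree_verts /tree_arrows; permlia. Qed.

(** Re-rooting does not touch the quiver: the old root, with its other branch, becomes part of a
    branch at the new root. *)
Lemma tree_rep_rerootAr Q v h d x b : tree_rep Q (v, h, Ar d x b) ->
    tree_rep Q (x, Ar (~~ d) v h, b).
Proof. by apply: tree_rep_perm; rewrite /tree_verts /tree_arrows; [|case: d]; permlia. Qed.

Lemma tree_rep_rerootTr1 Q v h x b y c : tree_rep Q (v, h, Tr x b y c) ->
    tree_rep Q (x, Tr y c v h, b).
Proof. by apply: tree_rep_perm; rewrite /tree_verts /tree_arrows; permlia. Qed.

Lemma tree_rep_rerootTr2 Q v h x b y c : tree_rep Q (v, h, Tr x b y c) ->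
    tree_rep Q (y, Tr v h x b, c).
Proof. by apply: tree_rep_perm; rewrite /tree_verts /tree_arrows; permlia. Qed.

Lemma tree_rep_reroot Q v h b l : tree_rep Q (v, h, b) -> l \in tree_verts (v, h, b) ->
  exists h' b', tree_rep Q (l, h', b').
Proof.
have aux b' : forall v' h', l \in branch_verts b' -> tree_rep Q (v', h', b') ->
    exists h2 b2, tree_rep Q (l, h2, b2).
  elim: b' => //= [d x b1 IH|x b1 IHb y c IHc] v' h'; rewrite inE.
    case/orP=> [/eqP->|lb] /tree_rep_rerootAr ar; last exact: IH ar.
    by exists (Ar (~~ d) v' h'), b1.
  rewrite inE mem_cat; case/or4P=> [/eqP->|/eqP->|lb|lc] ar.
  - by exists (Tr y c v' h'), b1; apply: tree_rep_rerootTr1.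
  - by exists (Tr v' h' x b1), c; apply: tree_rep_rerootTr2.
  - by apply: (IHb _ _ lb (tree_rep_rerootTr1 ar)).
  - by apply: (IHc _ _ lc (tree_rep_rerootTr2 ar)).
move=> ar; rewrite /tree_verts /= inE mem_cat; case/or3P=> [/eqP->|lh|lb].
- by exists h, b.
- by apply: (aux _ _ _ lh (tree_rep_swap ar)).
- by apply: (aux _ _ _ lb ar).
Qed.

Lemma tree_rep_closed Q (k : T) p : tree_rep Q p -> exists h b, tree_rep (mutate Q k) (f k,
    h, b).
Proof.
case: p => [[v h] b] ar.
have kv : f k \in tree_verts (v, h, b) by case: ar => _ _ <- _; apply: codom_f.
have [h' [b' {kv}ar']] := tree_rep_reroot ar kv.
(* [mv] and its twin [mv'] for the exchanged branches allow each move to be stated for one order of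
   the two branches only. *)
have mv q : tree_move (f k) (f k, h', b') q -> q.1.1 = f k ->
    exists h b, tree_rep (mutate Q k) (f k, h, b).
  by case: q => [[k1 h1] b1] am /= e; subst k1; exists h1, b1; apply: tree_rep_mut ar'.
have mv' q : tree_move (f k) (f k, b', h') q -> q.1.1 = f k ->
    exists h b, tree_rep (mutate Q k) (f k, h, b).
  by case: q => [[k1 h1] b1] am /= e; subst k1; exists h1, b1;
      apply: tree_rep_mut (tree_rep_swap ar').
clear ar ar'; case: h' b' mv mv' => [|d x b1|x b1 y c1] [|d' x' b1'|x' b1' y' c1'] mv mv'.
- exact: mv (tree_move_Nil _) _.
- exact: mv' (tree_move_Ar _ _ _ _) _.
- exact: mv' (tree_move_TrNil _ _ _ _ _) _.
- exact: mv (tree_move_Ar _ _ _ _) _.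
- case: d d' mv mv' => -[] mv mv'.
  + exact: mv (tree_move_ArAr _ _ _ _ _ _) _.
  + exact: mv (tree_move_ArAr' _ _ _ _ _) _.
  + exact: mv' (tree_move_ArAr' _ _ _ _ _) _.
  + exact: mv (tree_move_ArAr _ _ _ _ _ _) _.
- by apply: mv' (tree_move_TrAr _ _ _ _ _ _ _ _) _; case: (d).
- exact: mv (tree_move_TrNil _ _ _ _ _) _.
- by apply: mv (tree_move_TrAr _ _ _ _ _ _ _ _) _; case: (d').
- exact: mv (tree_move_TrTr _ _ _ _ _ _ _ _ _) _.
Qed.

Lemma tree_rep_seq Q (ks : seq T) p : tree_rep Q p -> exists p', tree_rep (mutate_seq Q ks) p'.
Proof.
elim: ks Q p => [|k ks IH] Q p ar; first by exists p.
by have [h [b /IH]] := tree_rep_closed k ar.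
Qed.

End Rep.
End TreeMoves.

(** * Involutivity of mutation and its invariance under isomorphism *)

Section MutationFacts.
Variables (T T' : finType).

Lemma mutate_eq (Q Q' : quiver T) k : (forall i j, Q i j = Q' i j) ->
  forall i j, mutate Q k i j = mutate Q' k i j.
Proof. by move=> e i j; rewrite /= /mutate_narr !e. Qed.

(** All arrows at [k] are reversed in between, so the second mutation adds the products that the
    first one subtracted and conversely. Truncation loses nothing because [Q i j] or [Q j i] is
    zero. *)
Lemma mutate_invol (Q : quiver T) k i j : mutate (mutate Q k) k i j = Q i j.
Proof.
rewrite /= {1}/mutate_narr /=; case: ifP => [h|/norP[/negbTE ik /negbTE jk]].
  by rewrite /mutate_narr orbC h.
rewrite /mutate_narr ik jk !eqxx /=.
have := no_2cycle Q i j; move: (Q i j) (Q j i) => a b.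
by rewrite (mulnC (Q k i)) (mulnC (Q k j)); move: (Q i k * _) (Q j k * _) => c d; lia.
Qed.

Lemma mutate_seq_cat (Q : quiver T) s t : mutate_seq Q (s ++ t) = mutate_seq (mutate_seq Q s) t.
Proof. by rewrite /mutate_seq foldl_cat. Qed.

Lemma mutate_seq_rev (Q : quiver T) ks i j : mutate_seq (mutate_seq Q ks) (rev ks) i j = Q i j.
Proof.
elim: ks Q i j => // k ks IH Q i j; rewrite rev_cons -cats1 mutate_seq_cat.
exact: etrans (mutate_eq k (IH (mutate Q k)) i j) (mutate_invol _ _ _ _).
Qed.

Lemma mutate_iso (f : T -> T') (Q : quiver T) (Q' : quiver T') k : injective f ->
  (forall i j, Q' (f i) (f j) = Q i j) ->
  forall i j, mutate Q' (f k) (f i) (f j) = mutate Q k i j.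
Proof. by move=> fI e i j; rewrite /= /mutate_narr !e !(inj_eq fI). Qed.

Lemma mutate_seq_iso (f : T -> T') (Q : quiver T) (Q' : quiver T') ks : injective f ->
  (forall i j, Q' (f i) (f j) = Q i j) ->
  forall i j, mutate_seq Q' (map f ks) (f i) (f j) = mutate_seq Q ks i j.
Proof. by move=> fI; elim: ks Q Q' => //= k ks IH Q Q' e; apply: IH; apply: mutate_iso. Qed.

Section Comap.
Variables (h : T -> T') (Q : quiver T').
Lemma comap_no_loop i : Q (h i) (h i) = 0. Proof. exact: no_loop. Qed.
Lemma comap_no_2cycle i j : (Q (h i) (h j) == 0) || (Q (h j) (h i) == 0).
Proof. exact: no_2cycle. Qed.
Definition comap : quiver T := Quiver comap_no_loop comap_no_2cycle.
End Comap.
End MutationFacts.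

(** * Straightening trees into Dynkin orientations, and back *)

Section Linear.
Variable L : eqType.
Implicit Types (h b c : branch L) (v x y : L).

Fixpoint linear b : bool :=
  match b with Nil => true | Ar _ _ b => linear b | Tr _ _ _ _ => false end.

(** This is the condition [dynkin_A_orientation], with positions along the branch as the vertices of
    the diagram. *)
Lemma linear_count v b p q : linear b -> uniq (v :: branch_verts b) ->
  p \in v :: branch_verts b -> q \in v :: branch_verts b ->
  count_mem (p, q) (branch_arrows v b) + count_mem (q, p) (branch_arrows v b) =
  ((index p (v :: branch_verts b)).+1 == index q (v :: branch_verts b)) || ((index q (v ::
      branch_verts b)).+1 == index p (v :: branch_verts b)).
Proof.
elim: b v p q => [|d x b IH|] // v p q.
  by move=> _ _; rewrite /= !inE => /eqP-> /eqP->; rewrite eqxx.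
move=> /= lb u pv qv.
have ux : uniq (x :: branch_verts b) by case/andP: u.
have vE : v \notin ends (branch_arrows x b).
  by have /andP[h _] := u; apply: contra h => /ends_branch.
have [vx _] : v != x /\ v \notin branch_verts b by have /andP[] := u;
    rewrite inE negb_or => /andP[].
have V0 r := count_ends0 r vE.
have ne (r : L) : r != v -> (v == r) = false by rewrite eq_sym => /negbTE.
have o r s : (ori d v x == (r, s)) + (ori d v x == (s, r)) = ((r == v) &&
    (s == x)) || ((r == x) && (s == v)).
  rewrite /ori; case: (d); rewrite !xpair_eqE !(eq_sym v) !(eq_sym x);
  by have [->|] := eqVneq r v; have [->|] := eqVneq s v; rewrite ?(negbTE vx) ?(eq_sym x v)
      ?(negbTE vx) ?andbF ?orbF ?addn0 ?andbT.
rewrite addnACA o; move: pv qv; rewrite !(@in_cons _ v).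
have [->|pv] := eqVneq p v => [_|/= pv'].
  have [->|qv] := eqVneq q v => [_|/= qv']; first by rewrite !V0 (negbTE vx).
  by rewrite !V0 ?(ne _ qv) /= andbF orbF addn0 (eq_sym x); case: (q == x).
have [->|qv] := eqVneq q v => [_|/= qv'].
  by rewrite !V0 ?(ne _ pv) /= andbT addn0 (eq_sym x); case: (p == x).
have := IH x p q lb ux pv' qv'; rewrite ?(ne _ pv) ?(ne _ qv) andbF /= => ->.
by rewrite !eqSS.
Qed.

Section Rep.
Variables (T : finType) (f : T -> L).
Implicit Types Q : quiver T.

Lemma tree_rep_vertex Q p l : tree_rep f Q p -> l \in tree_verts p -> exists k, f k = l.
Proof. by case=> _ _ <- _ /codomP [k ->]; exists k. Qed.

(* The triangle is moved along its first branch, which becomes shorter each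
   time, until it can be opened. *)
Lemma linearize_Tr Q v h x b1 y b2 : linear b1 -> linear b2 ->
    tree_rep f Q (v, h, Tr x b1 y b2) ->
  exists ks b', linear b' /\ tree_rep f (mutate_seq Q ks) (v, h, b').
Proof.
elim: b1 Q v h x y b2 => [|d x' b IH|] // Q v h x y b2 lb1 lb2 ar.
  have [k kx] : exists k, f k = x by apply: (tree_rep_vertex ar);
      rewrite /tree_verts !inE mem_cat !inE eqxx !orbT.
  have ar1 := tree_rep_swap (tree_rep_rerootTr1 ar).
  exists [:: k], (Ar false x (Ar false y b2)); split=> //.
  have mv := tree_move_TrNil x y b2 v h; rewrite -{1}kx in mv.
  exact: tree_rep_swap (tree_rep_rerootAr (tree_rep_swap (tree_rep_mut mv (tree_rep_swap
      ar1)))).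
have [k kx] : exists k, f k = x by apply: (tree_rep_vertex ar);
    rewrite /tree_verts !inE mem_cat !inE eqxx !orbT.
have ar1 := tree_rep_rerootTr1 ar.
have mv := tree_move_TrAr x d y b2 v h x' b; rewrite -{1}kx in mv.
have ar2 := tree_rep_mut mv ar1; case: d {mv ar ar1} lb1 ar2 => lb1 ar2.
  have ar3 := tree_rep_rerootTr1 (tree_rep_swap ar2).
  have [ks [b' [lb' ar4]]] := IH _ _ _ _ _ (Ar false y b2) lb1 lb2 (tree_rep_swap ar3).
  by exists (k :: ks), b'.
have [ks [b' [lb' ar4]]] := IH _ _ _ _ _ _ lb1 lb2 (tree_rep_swap ar2).
exists (k :: ks), (Ar false x b'); split=> //.
exact: tree_rep_swap (tree_rep_rerootAr (tree_rep_swap ar4)).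
Qed.

(** The branch [h] is arbitrary and preserved, so a sub-branch can be straightened after re-rooting
    at its base, with the rest of the tree collected in [h]. *)
Lemma linearize Q v h b : tree_rep f Q (v, h, b) ->
  exists ks b', linear b' /\ tree_rep f (mutate_seq Q ks) (v, h, b').
Proof.
elim: b Q v h => [|d x b IH|x b1 IH1 y b2 IH2] Q v h ar.
- by exists [::], (@Nil L).
- have [ks [b' [lb ar']]] := IH _ _ _ (tree_rep_rerootAr ar).
  exists ks, (Ar d x b'); split=> //.
  by have := tree_rep_swap (tree_rep_rerootAr (tree_rep_swap ar')); rewrite negbK.
- have [ks1 [b1' [lb1 ar1]]] := IH1 _ _ _ (tree_rep_rerootTr1 ar).
  have [ks2 [b2' [lb2 ar2]]] := IH2 _ _ _ (tree_rep_rerootTr1 (tree_rep_swap ar1)).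
  have ar3 := tree_rep_swap (tree_rep_rerootTr1 (tree_rep_swap ar2)).
  have [ks3 [b' [lb ar4]]] := linearize_Tr lb1 lb2 ar3.
  by exists (ks1 ++ ks2 ++ ks3), b'; rewrite !mutate_seq_cat.
Qed.

Lemma tree_rep_type_A Q v b : tree_rep f Q (v, @Nil L, b) ->
    type_A (size (v :: branch_verts b)) Q.
Proof.
move=> ar; have [ks [b' [lb [fI u cf QE]]]] := linearize ar.
have sz : size (v :: branch_verts b') = size (v :: branch_verts b).
  case: ar => _ u0 cf0 _; apply/eqP; rewrite -(uniq_size_uniq u0) ?u // => l.
  by rewrite -cf0 cf.
rewrite -sz; pose s := v :: branch_verts b'.
have us : uniq s := u.
have cs l : (l \in codom f) = (l \in s) := cf l.
have fS k : f k \in s by rewrite -cs codom_f.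
have fs k : index (f k) s < size s by rewrite index_mem.
(* The position along the straightened tree identifies the vertices with ordinals; [h] below is the
   inverse. *)
pose g k := Ordinal (fs k).
have gI : injective g.
  move=> i j e; apply: fI; have {}e : index (f i) s = index (f j) s := congr1 val e.
  by rewrite -(nth_index v (fS i)) e nth_index.
have hP (i : 'I_(size s)) : exists k, f k == nth v s i.
  by have : nth v s i \in codom f by [rewrite cs mem_nth]; case/codomP => k ->; exists k.
pose h i := xchoose (hP i).
have fh i : f (h i) = nth v s i by apply/eqP; exact: (xchooseP (hP i)).
have gh : cancel h g by move=> i; apply: val_inj; change (index (f (h i)) s = i);
    rewrite fh index_uniq.
have hg : cancel g h by move=> k; apply: gI; rewrite gh.
(* The straightened quiver, moved to the ordinals, is the Dynkin orientation; by involutivity the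
   reversed sequence leads from it back to [Q]. *)
exists (comap h (mutate_seq Q ks)).
  move=> i j; rewrite /= !QE /tree_arrows /= !fh linear_count ?mem_nth //.
  by rewrite -/s !index_uniq.
exists (map g (rev ks)), h; first by exists g.
move=> i j; rewrite -[i in RHS]gh -[j in RHS]gh.
rewrite (@mutate_seq_iso _ _ g (mutate_seq Q ks)) ?mutate_seq_rev // => k l.
by rewrite /= !hg.
Qed.

(** A Dynkin orientation is a linear tree, and trees are closed under mutation. *)
Lemma type_A_tree_rep Q k : injective f -> 1 <= k -> type_A k Q -> exists p, tree_rep f Q p.
Proof.
case: k => // k fI _ [O dO [ks [g [g' gK g'K] gE]]].
(* Diagram vertices carry the labels of their images under the final isomorphism [g], so the tree
   obtained after the mutations describes [Q] itself. [B] is the path, each arrow directed as in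
   [O]. *)
pose F m := f (g (inord m : 'I_k.+1)).
pose B := fix B n m := if n is n'.+1
  then Ar (0 < O (inord m) (inord m.+1)) (F m.+1) (B n' m.+1) else @Nil L.
have BV n m : branch_verts (B n m) = map F (iota m.+1 n) by elim: n m => //= n IH m; rewrite IH.
have BL n m : linear (B n m) by elim: n m => //= n IH m.
have sE : F 0 :: branch_verts (B k 0) = map F (iota 0 k.+1) by rewrite BV.
have Fi (i : 'I_k.+1) : F i = f (g i) by rewrite /F inord_val.
have u : uniq (F 0 :: branch_verts (B k 0)).
  rewrite sE map_inj_in_uniq ?iota_uniq // => i j; rewrite !mem_iota !add0n =>
      /andP[_ li] /andP[_ lj].
  rewrite -[i]/(val (Ordinal li)) -[j]/(val (Ordinal lj)) !Fi.
  by move=> /fI /(can_inj gK) ->.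
have ix (i : 'I_k.+1) : index (F i) (F 0 :: branch_verts (B k 0)) = i.
  rewrite sE -[F i](_ : nth (F 0) (map F (iota 0 k.+1)) i = _); last first.
    by rewrite (nth_map 0) ?size_iota // nth_iota.
  by rewrite index_uniq ?size_map ?size_iota // -sE.
have iM (i : 'I_k.+1) : F i \in F 0 :: branch_verts (B k 0).
  by rewrite sE map_f // mem_iota /= add0n ltn_ord.
have pos n m a : m + n < k.+1 -> a \in branch_arrows (F m) (B n m) ->
    exists i j, a = (F (val (i : 'I_k.+1)), F (val (j : 'I_k.+1))) /\ 0 < O i j.
  elim: n m => //= n IH m lt; rewrite inE => /orP[/eqP->|]; last by apply: IH; rewrite addSnnS.
  have l1 : m < k.+1 by lia.
  have l2 : m.+1 < k.+1 by lia.
  have dm : O (inord m) (inord m.+1) + O (inord m.+1) (inord m) = 1.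
    by rewrite dO !inordK ?eqxx.
  have [h|h] := boolP (0 < O (inord m) (inord m.+1)).
    by exists (inord m), (inord m.+1); rewrite /= !inordK.
  exists (inord m.+1), (inord m); rewrite /= !inordK //; split=> //.
  by move: h dm; clear; lia.
have arO : tree_rep (f \o g) O (F 0, @Nil L, B k 0).
  split=> //.
  - exact: inj_comp fI (can_inj gK).
  - move=> l; rewrite /tree_verts /= -/(branch_verts (B k 0)) -[_ :: _]/(F 0 ::
      branch_verts (B k 0)) sE.
    apply/codomP/mapP => [[i ->]|[m]]; first by exists (val i);
        rewrite ?Fi // mem_iota /= add0n ltn_ord.
    by rewrite mem_iota /= add0n => lm ->; exists (Ordinal lm); rewrite /= -Fi.
  - move=> i j; rewrite /tree_arrows /= -!Fi.
    have := linear_count (BL k 0) u (iM i) (iM j); rewrite !ix -dO.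
    have no2 := no_2cycle O i j.
    have pos' (i' j' : 'I_k.+1) : 0 < count_mem (F i', F j') (branch_arrows (F 0) (B k 0)) ->
        0 < O i' j'.
      rewrite -has_count has_pred1 => /(pos k 0 _ (ltnSn k)) [i2 [j2 [[e1 e2]]]].
      by rewrite -(ord_inj (etrans (esym (ix i2)) (etrans (congr1 (index^~ _) (esym e1)) (ix
          i'))))
        -(ord_inj (etrans (esym (ix j2)) (etrans (congr1 (index^~ _) (esym e2)) (ix j')))).
    (* The total numbers of arrows between two vertices agree, and a listed arrow occurs in [O]; as
       [O] has no 2-cycles, the directions agree too. *)
    by have := pos' i j; have := pos' j i; move: no2; natlia.
have [c [cI u' cf QE]] := tree_rep_seq ks arO.
exists c; split=> //.
  move=> l; rewrite -cf; apply/codomP/codomP => [[x ->]|[i ->]]; last by exists (g i).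
  by exists (g' x); rewrite /= g'K.
by move=> x y; rewrite -{1}(g'K x) -{1}(g'K y) gE QE /= !g'K.
Qed.

End Rep.
End Linear.

(** * Codes of quivers with a non-oriented cycle *)

Section Codes.
Variable L : eqType.
Implicit Types (h b : branch L) (v x y z k e : L).

(* A vertex of the non-oriented cycle, the direction of the arrow joining it to
   the next vertex, and the tree glued to this arrow, with its root. *)
Definition cell : Type := (L * bool * option (L * branch L))%type.
Definition cell_vertex (c : cell) : L := c.1.1.
Definition cell_dir (c : cell) : bool := c.1.2.
Definition cell_glued (c : cell) := c.2.
Implicit Types (cs p q : seq cell).

(* A cell together with the next vertex. *)
Definition ecell : Type := (L * L * bool * option (L * branch L))%type.
Implicit Types (E : ecell).

(** [e] closes the list: it is the first vertex again for a whole cyclic word, and the vertex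
    following the segment for a part of one. *)
Definition next_vertex cs e : L := if cs is c :: _ then cell_vertex c else e.

Fixpoint ecells cs e : seq ecell :=
  if cs is c :: cs' then (cell_vertex c, next_vertex cs' e, cell_dir c,
      cell_glued c) :: ecells cs' e else [::].

Definition code_ecells cs : seq ecell := if cs is c :: _ then ecells cs (cell_vertex c) else
    [::].

Definition ecell_arrow E : L * L := let: (x, y, d, o) := E in ori d x y.
Definition ecell_glued E : seq (L * L) :=
  let: (x, y, d, o) := E in
  if o is Some (z, b) then ((ori d x y).2, z) :: (z, (ori d x y).1) ::
      branch_arrows z b else [::].
Definition ecell_free E : seq (L * L) :=
  let: (x, y, d, o) := E in if o is Some (z, b) then branch_free z b else [:: ori d x y].
Definition ecell_tris E : seq (L * L * L) :=
  let: (x, y, d, o) := E in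
  if o is Some (z, b) then ((ori d x y), z) :: branch_tris z b else [::].

Definition glued_verts (o : option (L * branch L)) : seq L := if o is Some (z,
    b) then z :: branch_verts b else [::].

Definition code_verts cs : seq L := flatten [seq cell_vertex c ::
    glued_verts (cell_glued c) | c <- cs].
Definition code_ring cs := map ecell_arrow (code_ecells cs).
Definition code_glued cs := flatten (map ecell_glued (code_ecells cs)).
Definition code_arrows cs := code_ring cs ++ code_glued cs.

Definition valid_code cs := [&& uniq (code_verts cs), has cell_dir cs & has (fun c =>
    ~~ cell_dir c) cs].

(** A cycle arrow with a tree glued to it is a side of the triangle at the root. It is therefore no
    longer free, and this triangle is the successor in [ntri]. *)
Definition nfree (c : cell) := if cell_glued c is Some (z,
    b) then size (branch_free z b) else 1.
Definition ntri (c : cell) := if cell_glued c is Some (z,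
    b) then (size (branch_tris z b)).+1 else 0.
Definition pfree (d : bool) cs := sumn [seq nfree c | c <- cs & cell_dir c == d].
Definition ptri (d : bool) cs := sumn [seq ntri c | c <- cs & cell_dir c == d].

Lemma ecells_cat p q e : ecells (p ++ q) e = ecells p (next_vertex q e) ++ ecells q e.
Proof. by elim: p => //= c p ->; case: p. Qed.

Arguments ecell_glued : simpl never.
Arguments ecell_arrow : simpl never.
Arguments cell_vertex !c /.

Lemma next_cat p q e : next_vertex (p ++ q) e = next_vertex p (next_vertex q e).
Proof. by case: p. Qed.

Lemma code_ecells_cat p c q : code_ecells (p ++ c :: q) = ecells p (cell_vertex c) ++
    ecells (c :: q) (next_vertex p (cell_vertex c)).
Proof. by case: p => //= c' p; rewrite ecells_cat next_cat. Qed.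

Definition segment_arrows cs e := map ecell_arrow (ecells cs e) ++
    flatten (map ecell_glued (ecells cs e)).

(** The cyclic word is cut at one cell. The segment [q] is closed by the first vertex of the word,
    which is [next_vertex p x] also when [p] is empty; both segments then enter a mutation only as
    unaffected arrows. *)
Lemma arrows_cat p x d o q :
  perm_eq (code_arrows (p ++ (x, d, o) :: q))
    (ori d x (next_vertex q (next_vertex p x)) :: ecell_glued (x,
        next_vertex q (next_vertex p x), d, o) ++ segment_arrows p x ++
        segment_arrows q (next_vertex p x)).
Proof.
rewrite /code_arrows /code_ring /code_glued code_ecells_cat !map_cat flatten_cat
    /segment_arrows /=.
rewrite -[ori d x _]/(ecell_arrow (x, _, d, o)).
by move: (ecell_glued _) (ecell_arrow _) (map ecell_arrow _) (map ecell_arrow _) (flatten _)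
    (flatten _) => *; permlia.
Qed.

Lemma arrows_cat2 p x d o x' d' o' q :
  perm_eq (code_arrows (p ++ (x, d, o) :: (x', d', o') :: q))
    (ori d x x' :: ori d' x' (next_vertex q (next_vertex p x)) :: ecell_glued (x, x', d, o) ++
     ecell_glued (x', next_vertex q (next_vertex p x), d',
         o') ++ segment_arrows p x ++ segment_arrows q (next_vertex p x)).
Proof.
rewrite /code_arrows /code_ring /code_glued code_ecells_cat !map_cat flatten_cat
    /segment_arrows /=.
rewrite -[ori d x _]/(ecell_arrow (x, _, d, o)) -[ori d' x' _]/(ecell_arrow (x', _, d', o')).
by move: (ecell_glued _) (ecell_glued _) (ecell_arrow _) (ecell_arrow _) (map ecell_arrow _)
    (map ecell_arrow _) (flatten _) (flatten _)  => *; permlia.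
Qed.

Lemma next_in cs e : next_vertex cs e \in e :: code_verts cs.
Proof. by case: cs => [|c cs]; rewrite /= ?inE ?eqxx ?orbT. Qed.

Lemma ends_segment cs e : {subset ends (segment_arrows cs e) <= e :: code_verts cs}.
Proof.
apply/ends_subset; elim: cs => //= c cs IH a.
have sub u : u \in e :: code_verts cs -> u \in e :: code_verts (c :: cs).
  by rewrite /code_verts /= !inE !mem_cat => /orP[]->; rewrite ?orbT.
have hs := sub _ (next_in cs e).
have cxs : cell_vertex c \in e :: code_verts (c :: cs) by rewrite !inE eqxx orbT.
have [o1 o2] : (ori (cell_dir c) (cell_vertex c) (next_vertex cs e)).1 \in e ::
    code_verts (c :: cs) /\
    (ori (cell_dir c) (cell_vertex c) (next_vertex cs e)).2 \in e :: code_verts (c ::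
        cs) by case: (cell_dir c).
move=> aI; have {aI} : [|| a == ecell_arrow (cell_vertex c, next_vertex cs e, cell_dir c,
    cell_glued c), a \in map ecell_arrow (ecells cs e),
    a \in ecell_glued (cell_vertex c, next_vertex cs e, cell_dir c,
        cell_glued c) | a \in flatten (map ecell_glued (ecells cs e))].
  by move: aI; rewrite mem_cat /= inE mem_cat -!orbA.
case/or4P=> [/eqP->|aE|aE|aE].
- by apply/andP.
- by have := IH a; rewrite mem_cat aE => /(_ isT)/andP[h1 h2]; rewrite !sub.
- move: aE; rewrite /ecell_glued; case ce : (cell_glued c) => [[z b]|] // aE.
  have zs u : u \in z :: branch_verts b -> u \in e :: code_verts (c :: cs).
    by rewrite /code_verts /= ce inE /= !inE !mem_cat /= => /orP[]->; rewrite ?orbT.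
  have zz := zs z (mem_head _ _).
  have : [|| a == ((ori (cell_dir c) (cell_vertex c) (next_vertex cs e)).2, z),
    a == (z, (ori (cell_dir c) (cell_vertex c) (next_vertex cs e)).1) | a \in branch_arrows z
        b] by move: aE; rewrite !inE.
  case/or3P => [/eqP->|/eqP->|/[dup]/ends1/ends_branch/zs h1 /ends2/ends_branch/zs h2] /=.
  + by rewrite o2 zz.
  + by rewrite o1 zz.
  + by rewrite h1 h2.
- by have := IH a; rewrite mem_cat aE orbT => /(_ isT)/andP[h1 h2]; rewrite !sub.
Qed.

Lemma notin_segment k cs e : k != e -> k \notin code_verts cs ->
    k \notin ends (segment_arrows cs e).
Proof. by move=> ke kc; apply/negP => /ends_segment; rewrite inE (negbTE ke) (negbTE kc). Qed.

Lemma neq_next k cs e : k != e -> k \notin code_verts cs -> k != next_vertex cs e.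
Proof.
move=> ke kc; have := next_in cs e; rewrite inE => /orP[/eqP->//|h].
by apply: contraNneq kc => ->.
Qed.

Lemma verts_cat p q : code_verts (p ++ q) = code_verts p ++ code_verts q.
Proof. by rewrite /code_verts map_cat flatten_cat. Qed.

Lemma pfree_cat d p q : pfree d (p ++ q) = pfree d p + pfree d q.
Proof. by rewrite /pfree filter_cat map_cat sumn_cat. Qed.

Lemma ptri_cat d p q : ptri d (p ++ q) = ptri d p + ptri d q.
Proof. by rewrite /ptri filter_cat map_cat sumn_cat. Qed.

Definition code_move k cs cs' : Prop :=
  [/\ perm_eq (code_verts cs) (code_verts cs'), valid_code cs -> valid_code cs',
      uniq (code_verts cs) -> mutrel k (code_arrows cs) (code_arrows cs') &
      forall d, pfree d cs = pfree d cs' /\ ptri d cs = ptri d cs'].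

Lemma code_move_sym k cs cs' : (valid_code cs' -> valid_code cs) -> code_move k cs cs' ->
    code_move k cs' cs.
Proof.
move=> vv [pv _ mr pr]; split=> //.
- by rewrite perm_sym.
- by move=> u; apply: mutrel_sym; apply: mr; rewrite (perm_uniq pv).
- by move=> d; have [-> ->] := pr d.
Qed.

(** Mutation at [z] cancels the cycle arrow between [x] and its successor and reverses the two
    triangle sides, so [z] enters the cycle between them with both new arrows in direction [d]. A
    neighbour of [z] in the tree forms a path through [z] with one of the old sides; this decides
    over which of the new arrows it becomes an apex. *)
Definition split_cells (d : bool) x z b : seq cell :=
  match b with
  | Nil => [:: (x, d, Some (z, b))]
  | Ar dz z' b' => if d == dz then [:: (x, d, None); (z, d, Some (z', b'))]
                   else [:: (x, d, Some (z', b')); (z, d, None)]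
  | Tr z1 b1 z2 b2 => if d then [:: (x, d, Some (z2, b2)); (z, d, Some (z1, b1))]
                      else [:: (x, d, Some (z1, b1)); (z, d, Some (z2, b2))]
  end.

Definition nonnil b := if b is Nil then false else true.

(* Mutation at the root of a glued tree that is not a single vertex. *)
Lemma code_move_split p q d x z b : nonnil b ->
  code_move z (p ++ (x, d, Some (z, b)) :: q) (p ++ split_cells d x z b ++ q).
Proof.
move=> nb.
have pv : perm_eq (code_verts (p ++ (x, d, Some (z, b)) :: q)) (code_verts (p ++
    split_cells d x z b ++ q)).
  rewrite !verts_cat /code_verts; case: b nb => // [dz z' b'|z1 b1 z2 b2] _ /=;
      last by case: d => /=; permlia.
  by case: ifP => _ /=; permlia.
split=> //.
- rewrite /valid_code (perm_uniq pv) !has_cat => /and3P[-> + +] /=.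
  by case: b nb {pv} => // [[] z' b'|z1 b1 z2 b2] _; case: (d);
    rewrite /cell_dir /=; do ?[case: (has _ _)].
- move=> u.
  have [zx zb zp zq] : [/\ z != x, z \notin branch_verts b,
      z \notin code_verts p & z \notin code_verts q].
    have : uniq (z :: x :: branch_verts b ++ code_verts p ++ code_verts q).
      by apply: (uniq_perm_eq u); rewrite verts_cat {2}/code_verts /= -/(code_verts q); permlia.
    by rewrite /= inE !mem_cat !negb_or => /andP[/and4P[]].
  have ze := neq_next zx zp; have zy := neq_next ze zq.
  have zP := notin_segment zx zp; have zQ := notin_segment ze zq.
  have pA := arrows_cat p x d (Some (z, b)) q.
  case: b {u pv} nb zb pA => // [dz z' b'|z1 b1 z2 b2] _ zb pA.
    have [zz' zb'] : z != z' /\ z \notin branch_verts b' by move: zb;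
        rewrite inE negb_or => /andP.
    rewrite /split_cells; case: eqP pA => [<-|dd] pA /=.
      have pA' := arrows_cat2 p x d None z d (Some (z', b')) q.
      move: pA pA' zy zP zQ; move: (next_vertex q _) (segment_arrows _ _) (segment_arrows _ _)
          => y P R pA pA' zy zP zR.
      rewrite perm_sym in pA; rewrite perm_sym in pA'; apply: mutrel_perm pA pA' _.
      clear zb; case: d; rewrite /ecell_glued.
        by apply: (@mutrelI _ z [:: y] [:: x; z'] [:: (x, y)] [:: (y, z')] [:: (x, y)]
          (branch_arrows z' b' ++ P ++ R)); try permlia; kside.
      by apply: (@mutrelI _ z [:: x; z'] [:: y] [:: (y, x)] [:: (z', y)] [:: (y, x)]
          (branch_arrows z' b' ++ P ++ R)); try permlia; kside.
    have pA' := arrows_cat2 p x d (Some (z', b')) z d None q.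
    have {}dd : dz = ~~ d by case: (d) (dz) dd => -[].
    subst dz.
    move: pA pA' zy zP zQ; move: (next_vertex q _) (segment_arrows _ _) (segment_arrows _ _) =>
        y P R pA pA' zy zP zR.
    rewrite perm_sym in pA; rewrite perm_sym in pA'; apply: mutrel_perm pA pA' _.
    clear zb; case: d; rewrite /ecell_glued.
      by apply: (@mutrelI _ z [:: y; z'] [:: x] [:: (x, y)] [:: (z', x)] [:: (x, y)]
        (branch_arrows z' b' ++ P ++ R)); try permlia; kside.
    by apply: (@mutrelI _ z [:: x] [:: y; z'] [:: (y, x)] [:: (x, z')] [:: (y, x)]
        (branch_arrows z' b' ++ P ++ R)); try permlia; kside.
  have [z1z z2z zb1 zb2] : [/\ z != z1, z != z2, z \notin branch_verts b1 & z \notin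
      branch_verts b2].
    by move: zb; rewrite /= !inE mem_cat !negb_or => /and4P.
  clear zb; case: d pA => pA.
    have pA' := arrows_cat2 p x true (Some (z2, b2)) z true (Some (z1, b1)) q.
    move: pA pA' zy zP zQ; move: (next_vertex q _) (segment_arrows _ _) (segment_arrows _ _) =>
        y P R pA pA' zy zP zR.
    rewrite perm_sym in pA; rewrite perm_sym in pA'; apply: mutrel_perm pA pA' _;
        rewrite /ecell_glued.
    by apply: (@mutrelI _ z [:: y; z2] [:: x; z1] [:: (x, y); (z1, z2)] [:: (y, z1); (z2, x)]
      [:: (x, y); (z1, z2)] (branch_arrows z1 b1 ++ branch_arrows z2 b2 ++ P ++ R));
          try permlia; kside.
  have pA' := arrows_cat2 p x false (Some (z1, b1)) z false (Some (z2, b2)) q.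
  move: pA pA' zy zP zQ; move: (next_vertex q _) (segment_arrows _ _) (segment_arrows _ _) =>
      y P R pA pA' zy zP zR.
  rewrite perm_sym in pA; rewrite perm_sym in pA'; apply: mutrel_perm pA pA' _;
      rewrite /ecell_glued.
  by apply: (@mutrelI _ z [:: x; z2] [:: y; z1] [:: (y, x); (z1, z2)] [:: (x, z1); (z2, y)]
    [:: (y, x); (z1, z2)] (branch_arrows z1 b1 ++ branch_arrows z2 b2 ++ P ++ R));
        try permlia; kside.
- move=> d'; rewrite !pfree_cat !ptri_cat /pfree /ptri.
  by case: b nb {pv} => // [[] z' b'|z1 b1 z2 b2] _; case: (d); case: d';
    rewrite /cell_dir /= /nfree /ntri /= ?size_cat; split; lia.
Qed.

(** The leaf is a sink or a source, so no path runs through it and only its arrow turns. *)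
Lemma code_move_leaf p q d x z dw w :
  code_move w (p ++ (x, d, Some (z, Ar dw w (@Nil L))) :: q)
    (p ++ (x, d, Some (z, Ar (~~ dw) w (@Nil L))) :: q).
Proof.
have pv : perm_eq (code_verts (p ++ (x, d, Some (z, Ar dw w (@Nil L))) :: q))
  (code_verts (p ++ (x, d, Some (z, Ar (~~ dw) w (@Nil L))) ::
      q)) by rewrite !verts_cat /code_verts; permlia.
split=> //.
- by rewrite /valid_code (perm_uniq pv) !has_cat.
- move=> u.
  have [wz wx wp wq] : [/\ w != z, w != x, w \notin code_verts p & w \notin code_verts q].
    have : uniq (w :: z :: x :: code_verts p ++ code_verts q).
      by apply: (uniq_perm_eq u); rewrite verts_cat {2}/code_verts /= -/(code_verts q); permlia.
    by rewrite /= !inE !mem_cat !negb_or => /andP[/and4P[]].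
  have we := neq_next wx wp; have wy := neq_next we wq.
  have wP := notin_segment wx wp; have wQ := notin_segment we wq.
  have pA := arrows_cat p x d (Some (z, Ar dw w (@Nil L))) q.
  have pA' := arrows_cat p x d (Some (z, Ar (~~ dw) w (@Nil L))) q.
  move: pA pA' wy wP wQ; move: (next_vertex q _) (segment_arrows _ _) (segment_arrows _ _) =>
      y P R pA pA' wy wP wR.
  have [n1 n2] : w != (ori d x y).1 /\ w != (ori d x y).2 by case: (d).
  rewrite perm_sym in pA; rewrite perm_sym in pA'; apply: mutrel_perm pA pA' _.
  rewrite /ecell_glued; move: (ori d x y) n1 n2 => -[a1 a2] /= n1 n2.
  clear u pv; case: dw.
    by apply: (@mutrelI _ w [:: z] [::] [::] [::] [::] ([:: (a1, a2); (a2, z);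
        (z, a1)] ++ P ++ R)); try permlia; kside.
  by apply: (@mutrelI _ w [::] [:: z] [::] [::] [::] ([:: (a1, a2); (a2, z);
      (z, a1)] ++ P ++ R)); try permlia; kside.
- by move=> d'; rewrite !pfree_cat !ptri_cat /pfree /ptri /= /cell_dir /=; case: (d == d').
Qed.

(* At a sink or source of the non-oriented cycle. *)
Lemma code_move_turn p q d x o1 k o2 :
  code_move k (p ++ (x, d, o1) :: (k, ~~ d, o2) :: q) (p ++ (x, ~~ d, o2) :: (k, d, o1) :: q).
Proof.
have pv : perm_eq (code_verts (p ++ (x, d, o1) :: (k, ~~ d, o2) :: q))
    (code_verts (p ++ (x, ~~ d, o2) :: (k, d, o1) :: q)).
  by rewrite !verts_cat /code_verts /cell_glued /=; move:
      (glued_verts o1) (glued_verts o2) => s1 s2; permlia.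
split=> //.
- rewrite /valid_code (perm_uniq pv) !has_cat => /and3P[-> + +] /=.
  by rewrite /cell_dir /=; case: (d) => /=; do ?[case: (has _ _)].
- move=> u.
  have [kx ko1 ko2 kp kq] : [/\ k != x, k \notin glued_verts o1, k \notin glued_verts o2,
      k \notin code_verts p & k \notin code_verts q].
    have : uniq (k :: x :: glued_verts o1 ++ glued_verts o2 ++ code_verts p ++ code_verts q).
      apply: (uniq_perm_eq u); rewrite verts_cat {2}/code_verts /= -/(code_verts q) /cell_glued
          /=.
      by move: (glued_verts o1) (glued_verts o2) => s1 s2; permlia.
    by rewrite /= inE !mem_cat !negb_or => /andP[/and5P[]].
  have ke := neq_next kx kp; have ky := neq_next ke kq.
  have kP := notin_segment kx kp; have kQ := notin_segment ke kq.
  have pA := arrows_cat2 p x d o1 k (~~ d) o2 q.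
  have pA' := arrows_cat2 p x (~~ d) o2 k d o1 q.
  move: pA pA' ky kP kQ; move: (next_vertex q _) (segment_arrows _ _) (segment_arrows _ _) =>
      y P R pA pA' ky kP kR.
  rewrite perm_sym in pA; rewrite perm_sym in pA'; apply: mutrel_perm pA pA' _.
  clear u pv.
  case: o1 o2 ko1 ko2 => [[z1 b1]|] [[z2 b2]|]; rewrite /ecell_glued /= ?inE ?negb_or =>
      ko1 ko2; splithyps;
    case: d => /=.
  + by apply: (@mutrelI _ k [:: x; y] [:: z1; z2] [:: (z1, x); (z2, y)] [:: (x, z2); (y, z1)]
     [:: (z1, x); (z2, y)] (branch_arrows z1 b1 ++ branch_arrows z2 b2 ++ P ++ R));
         try permlia; kside.
  + by apply: (@mutrelI _ k [:: z1; z2] [:: x; y] [:: (x, z1); (y, z2)] [:: (z2, x); (z1, y)]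
     [:: (x, z1); (y, z2)] (branch_arrows z1 b1 ++ branch_arrows z2 b2 ++ P ++ R));
         try permlia; kside.
  + by apply: (@mutrelI _ k [:: x; y] [:: z1] [:: (z1, x)] [:: (y, z1)]
     [:: (z1, x)] (branch_arrows z1 b1 ++ P ++ R)); try permlia; kside.
  + by apply: (@mutrelI _ k [:: z1] [:: x; y] [:: (x, z1)] [:: (z1, y)]
     [:: (x, z1)] (branch_arrows z1 b1 ++ P ++ R)); try permlia; kside.
  + by apply: (@mutrelI _ k [:: x; y] [:: z2] [:: (z2, y)] [:: (x, z2)]
     [:: (z2, y)] (branch_arrows z2 b2 ++ P ++ R)); try permlia; kside.
  + by apply: (@mutrelI _ k [:: z2] [:: x; y] [:: (y, z2)] [:: (z2, x)]
     [:: (y, z2)] (branch_arrows z2 b2 ++ P ++ R)); try permlia; kside.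
  + by apply: (@mutrelI _ k [:: x; y] [::] [::] [::] [::] (P ++ R)); try permlia; kside.
  + by apply: (@mutrelI _ k [::] [:: x; y] [::] [::] [::] (P ++ R)); try permlia; kside.
- move=> d'; rewrite !pfree_cat !ptri_cat /pfree /ptri /= /cell_dir /=.
  by case: (d); case: d' => /=; rewrite /nfree /ntri.
Qed.

End Codes.

(** * The cycle of a code, and codes as built quivers *)

Section CodeFacts.
Variable L : eqType.
Implicit Types (cs p q : seq (cell L)) (E : ecell L) (e v : L).

Definition code_tris cs : seq (L * L * L) := flatten (map (@ecell_tris L) (code_ecells cs)).

Lemma count_ends_cons (a : L * L) A v :
  count_mem v (ends (a :: A)) = (a.1 == v) + (a.2 == v) + count_mem v (ends A).
Proof. by rewrite /ends /= !count_cat /=; natlia. Qed.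

(** Degrees along an open segment: its first vertex lacks one incidence and the closing vertex [e]
    has one in excess. For a cyclic word these are the same vertex, and the corrections cancel. *)
Lemma count_ends_ecells cs e v :
  count_mem v (ends (map (@ecell_arrow L) (ecells cs e))) + (next_vertex cs e == v) =
  2 * count_mem v (map (@cell_vertex L) cs) + (e == v).
Proof.
elim: cs => [|c cs] //; rewrite [ecells (c :: cs) e]/= [map _ (_ ::
    _)]/= count_ends_cons /ecell_arrow /=.
by case: (cell_dir c) => /=; natlia.
Qed.

Lemma perm_verts cs : perm_eq (code_verts cs) (map (@cell_vertex L) cs ++
    flatten [seq glued_verts (cell_glued c) | c <- cs]).
Proof.
elim: cs => //= c cs /permP IH; apply/permP => P; have := IH P.
by rewrite /code_verts /= ?count_cat /= ?count_cat; natlia.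
Qed.

Lemma uniq_vertex cs : uniq (code_verts cs) -> uniq (map (@cell_vertex L) cs).
Proof. by rewrite (perm_uniq (perm_verts cs)) cat_uniq => /andP[]. Qed.

Lemma ecell_arrow_closed (P : pred L) cs e :
  (forall a, a \in map (@ecell_arrow L) (ecells cs e) -> P a.1 = P a.2) ->
  forall c, c \in cs -> P (cell_vertex c) = P e.
Proof.
elim: cs => //= c cs IH h.
have {}IH : forall c, c \in cs -> P (cell_vertex c) = P e.
  by apply: IH => a aE; apply: h; rewrite inE aE orbT.
have Pc : P (cell_vertex c) = P (next_vertex cs e).
  by have := h _ (mem_head _ _); rewrite /ecell_arrow; case: (cell_dir c).
move=> c'; rewrite inE => /orP[/eqP->|]; last exact: IH.
by rewrite Pc; case: cs IH {h Pc} => //= c2 cs; apply; rewrite mem_head.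
Qed.

Lemma turn_split (A : Type) (f : pred A) s : has f s -> has (fun x => ~~ f x) s ->
  exists (p : seq A) a b (q : seq A), s = p ++ a :: b :: q /\ f b = ~~ f a.
Proof.
elim: s => [|a [|b s] IH] //.
  by rewrite /= !orbF => ->.
have [e|ne] := eqVneq (f b) (~~ f a); first by exists [::], a, b, s.
have e : f a = f b by case: (f a) (f b) ne => -[].
rewrite (_ : has f _ = has f (b :: s)); last by rewrite /= e orbA orbb.
rewrite (_ : has (fun x => ~~ f x) _ = has (fun x => ~~ f x) (b :: s));
    last by rewrite /= e orbA orbb.
by move=> h1 h2; have [p [a' [b' [q [-> h]]]]] := IH h1 h2; exists (a :: p), a', b', q.
Qed.

Lemma ring_code cs : valid_code cs -> ring (map (@cell_vertex L) cs) (code_ring cs).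
Proof.
case/and3P=> u h1 h2; have uX := uniq_vertex u.
have deg v : count_mem v (ends (code_ring cs)) = 2 * count_mem v (map (@cell_vertex L) cs).
  case: cs h1 {h2 u uX} => // c cs _; have := count_ends_ecells (c :: cs) (cell_vertex c) v.
  by rewrite /code_ring /code_ecells [next_vertex _ _]/=; natlia.
split.
- move=> v; rewrite -!has_pred1 !has_count deg; natlia.
- by move=> v vX; rewrite deg count_uniq_mem // vX.
- case: cs h1 {h2 u uX deg} => // c0 cs _ P cl /hasP [x /mapP [c cC ->] Pc].
  apply/allP => y /mapP [c' cC' ->].
  by rewrite (ecell_arrow_closed cl cC') -(ecell_arrow_closed cl cC).
(* Two neighbouring cells have opposite directions, and the vertex between them is a sink or a
   source. *)
- have [p [[[x d] o] [[[x' d'] o'] [q [e /= ed]]]]] := turn_split h1 h2.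
  have x'X : x' \in map (@cell_vertex L) cs by rewrite e map_cat mem_cat /= !inE eqxx !orbT.
  exists x' => //; have : count_mem x' (ends (code_ring cs)) = 2 by rewrite deg count_uniq_mem
      // x'X.
  rewrite e.
  rewrite /code_ring code_ecells_cat map_cat /= /ecell_arrow /= /cell_dir /= in ed *.
  rewrite /ends /unzip1 /unzip2 !count_cat !map_cat !count_cat /= ed.
  by case: (d); rewrite /= eqxx; natlia.
Qed.

Lemma built_cells X A0 V N TL (Es : seq (ecell L)) : built X A0 V N TL ->
  {subset map (@ecell_arrow L) Es <= A0} -> uniq (flatten [seq glued_verts E.2 | E <- Es] ++
      V) ->
  built X A0 (flatten [seq glued_verts E.2 | E <- Es] ++ V) (flatten (map (@ecell_glued L) Es)
      ++ N)
    (flatten (map (@ecell_tris L) Es) ++ TL).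
Proof.
move=> bt; elim: Es => //= [[[[x y] d] o]] Es IH sub u.
have {}IH := IH (fun a aE => sub a (mem_behead (s := _ :: _) aE)).
have aA : ori d x y \in A0 by apply: sub; apply: mem_head.
case: o u {sub} => [[z b]|]; rewrite /ecell_glued /ecell_tris /= => u; last by apply: IH.
have u1 : uniq (flatten [seq glued_verts E.2 | E <- Es] ++ V).
  by have /andP[_] := u; rewrite -catA cat_uniq => /and3P[].
have zN : z \notin flatten [seq glued_verts E.2 | E <- Es] ++ V.
  by have /andP[] := u; rewrite -catA mem_cat negb_or => /andP[].
have bt1 : built X A0 (z :: flatten [seq glued_verts E.2 | E <- Es] ++ V)
    [:: ((ori d x y).2, z), (z, (ori d x y).1) & flatten (map (@ecell_glued L) Es) ++ N]
    ((ori d x y, z) :: flatten (map (@ecell_tris L) Es) ++ TL).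
  case eo : (ori d x y) aA => [a1 a2] aA.
  by apply: BuiltTri zN; [exact: IH | rewrite mem_cat aA].
have u2 : uniq (branch_verts b ++ z :: flatten [seq glued_verts E.2 | E <- Es] ++ V).
  by apply: (@uniq_perm_eq _ ((z :: branch_verts b ++ flatten [seq glued_verts E.2 | E <- Es])
      ++ V)) => //; permlia.
by apply: (BuiltPerm (built_branch bt1 (mem_head _ _) u2)); permlia.
Qed.

Lemma ecells_glued cs : [seq glued_verts E.2 | E <- code_ecells cs] = [seq glued_verts
    (cell_glued c) | c <- cs].
Proof.
case: cs => // c0 cs; rewrite /code_ecells; move: (cell_vertex c0) => e.
by elim: (c0 :: cs) => //= c s ->.
Qed.

Lemma code_built cs : uniq (code_verts cs) ->
  built (map (@cell_vertex L) cs) (code_ring cs) (code_verts cs) (code_glued cs) (code_tris cs).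
Proof.
move=> u.
have pv : perm_eq (code_verts cs) (flatten [seq glued_verts E.2 | E <- code_ecells cs] ++
    map (@cell_vertex L) cs).
  by rewrite ecells_glued perm_sym perm_catC perm_sym; apply: perm_verts.
have := built_cells (Built0 (map (@cell_vertex L) cs) (code_ring cs)) (fun a aE => aE).
rewrite -(perm_uniq pv) => /(_ u) bt.
by apply: (BuiltPerm bt); [rewrite perm_sym | rewrite cats0 | rewrite cats0].
Qed.

Lemma code_no_2cycle cs a b : valid_code cs -> (a, b) \in code_arrows cs ->
    (b, a) \notin code_arrows cs.
Proof.
move=> vc; have rg := ring_code vc; have /andP[u _] := vc.
have bt := code_built u.
apply: (built_no_2cycle _ _ _ bt); [exact: uniq_vertex | exact: ring_supp rg | ].
by move=> p q; apply: ring_no_2cycle rg.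
Qed.

End CodeFacts.

(** * Mutation sequences between codes *)

Section CodeRep.
Variable T : finType.
Implicit Types (Q : quiver T) (cs p q : seq (cell T)).

Definition code_rep Q cs : Prop :=
  [/\ valid_code cs, forall x, x \in code_verts cs & forall i j, Q i j = count_mem (i,
      j) (code_arrows cs)].

Lemma code_rep_mut Q k cs cs' : code_move k cs cs' -> code_rep Q cs ->
    code_rep (mutate Q k) cs'.
Proof.
move=> [pv vv mr _] [vc cov QE]; have vc' := vv vc; have /andP[u _] := vc.
split=> //; first by move=> x; rewrite -(perm_mem pv).
have := @mutP _ _ id Q k (code_arrows cs) (code_arrows cs') (fun x y e => e) QE (mr u).
by apply=> x y; apply: code_no_2cycle.
Qed.

Definition same_par cs cs' : Prop :=
  forall d, pfree d cs = pfree d cs' /\ ptri d cs = ptri d cs'.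

(** A code determines its quiver, so [ks] can be chosen before [Q]. Every prefix, the empty and the
    full one included, must have a code with the parameters of [cs], as the theorem constrains all
    intermediate quivers. *)
Definition reach cs cs' : Prop := exists ks, forall Q, code_rep Q cs ->
  code_rep (mutate_seq Q ks) cs' /\
  forall i, i <= size ks -> exists2 c, code_rep (mutate_seq Q (take i ks)) c & same_par cs c.

Lemma reach_refl cs : reach cs cs.
Proof. by exists [::] => Q h; split=> // i _; exists cs. Qed.

Lemma reach_move k cs cs' : code_move k cs cs' -> reach cs cs'.
Proof.
move=> mv; exists [:: k] => Q h; have h' := code_rep_mut mv h; split=> // -[|[|i]] // _.
  by exists cs.
by exists cs' => //; case: mv.
Qed.

Lemma reach_trans cs2 cs1 cs3 : same_par cs1 cs2 -> reach cs1 cs2 -> reach cs2 cs3 ->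
    reach cs1 cs3.
Proof.
move=> sp [s h] [t h']; exists (s ++ t) => Q r; have [r2 pr] := h Q r; have [r3 pr'] := h' _ r2.
split; first by rewrite mutate_seq_cat.
move=> i; rewrite size_cat take_cat => li; case: ltnP => lis; first by apply: pr; apply: ltnW.
rewrite mutate_seq_cat; have [c rc sc] := pr' (i - size s) (ltac:(lia)).
by exists c => // d; have [-> ->] := sp d; apply: sc.
Qed.

End CodeRep.

(** Adjacent exchanges generate all permutations: [front] carries an entry over a block, and [gen]
    places the entries one by one behind a growing prefix [u]. *)
Lemma perm_swap_ind (A : eqType) (R : seq A -> seq A -> Prop) :
  (forall s, R s s) -> (forall s t u, R s t -> R t u -> R s u) ->
  (forall p a b q, R (p ++ a :: b :: q) (p ++ b :: a :: q)) ->
  forall s t, perm_eq s t -> R s t.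
Proof.
move=> Rr Rt Rs.
have front p a q : forall u, R (u ++ p ++ a :: q) (u ++ a :: p ++ q).
  elim: p => [|b p IH] u //=.
  by apply: Rt (Rs u b a (p ++ q)); have := IH (rcons u b); rewrite !cat_rcons.
have gen t : forall u s, perm_eq s t -> R (u ++ s) (u ++ t).
  elim: t => [|a t IH] u s; first by move/perm_nilP => ->.
  move=> pst; have /path.splitPr as_ : a \in s by rewrite (perm_mem pst) mem_head.
  case: as_ pst => s1 s2 pst.
  apply: Rt (front s1 a s2 u) _; rewrite -!cat_rcons; apply: IH.
  by rewrite -(perm_cons a) -(permPr pst) perm_sym; permlia.
by move=> s t pst; apply: (gen t [::]).
Qed.

(** * Reduction to flat codes *)

Section Reach.
Variable T : finType.
Implicit Types (Q : quiver T) (cs p q : seq (cell T)).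

Definition flat (c : cell T) : bool := if cell_glued c is Some (_,
    b) then ~~ nonnil b else true.
Definition kind (c : cell T) : bool * bool := (cell_dir c, cell_glued c == None).

Definition treesize (c : cell T) : nat := if cell_glued c is Some (_,
    b) then size (branch_verts b) else 0.

Lemma same_par_trans cs2 cs1 cs3 : same_par cs1 cs2 -> same_par cs2 cs3 -> same_par cs1 cs3.
Proof. by move=> h h' d; have [-> ->] := h d; apply: h'. Qed.

(** A split turns one or two vertices of a branch into roots, which [treesize] does not count, so
    the total of [treesize] drops. *)
Lemma reach_flat cs : exists cs', [/\ all flat cs', reach cs cs' & same_par cs cs'].
Proof.
have [n] := ubnP (sumn (map treesize cs)); elim: n cs => // n IH cs.
rewrite ltnS => le.
have [fl|] := boolP (all flat cs); first by exists cs; split=> //; apply: reach_refl.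
rewrite -has_predC => /hasP [c /path.splitPr ccs].
case: ccs le => p q; case: c => [[x d] [[z b]|]] //= le; rewrite /flat /= negbK => nb.
have mv := code_move_split p q d x z nb.
have [|cs' [f r s]] := IH (p ++ split_cells d x z b ++ q).
  apply: leq_trans le; move: (nb); rewrite !map_cat !sumn_cat /=;
      case: b nb {mv} => // [dz z' b'|z1 b1 z2 b2] _ _.
    by rewrite /split_cells /treesize; case: ifP => _ /=; lia.
  by rewrite /split_cells /treesize; case: (d) => /=; rewrite size_cat; lia.
have sp : same_par (p ++ (x, d, Some (z, b)) :: q) (p ++ split_cells d x z b ++ q) by case: mv.
exists cs'; split=> //; first exact: reach_trans sp (reach_move mv) r.
exact: same_par_trans sp s.
Qed.

Lemma valid_code_merge p q d x v z dz :
  valid_code (p ++ split_cells d x v (Ar dz z (@Nil T)) ++ q) ->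
  valid_code (p ++ (x, d, Some (v, Ar dz z (@Nil T))) :: q).
Proof.
have pv : perm_eq (code_verts (p ++ (x, d, Some (v, Ar dz z (@Nil T))) :: q))
   (code_verts (p ++ split_cells d x v (Ar dz z (@Nil T)) ++
       q)) by case: (code_move_split p q d x v (b := Ar dz z (@Nil T))).
rewrite /valid_code (perm_uniq pv) !has_cat => /and3P[-> + +]; rewrite /split_cells /=.
by case: ifP => _; rewrite /cell_dir /=; case: (d); do ?[case: (has _ _)].
Qed.

(* Merge the two cells, flip the leaf, and split again. *)
Lemma reach_slide p q d x v z e :
  let c1 := if e then [:: (x, d, None); (v, d, Some (z, @Nil T))]
                 else [:: (x, d, Some (z, @Nil T)); (v, d, None)] in
  let c2 := if e then [:: (x, d, Some (z, @Nil T)); (v, d, None)]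
                 else [:: (x, d, None); (v, d, Some (z, @Nil T))] in
  reach (p ++ c1 ++ q) (p ++ c2 ++ q) /\ same_par (p ++ c1 ++ q) (p ++ c2 ++ q).
Proof.
move=> c1 c2.
(* A leaf in direction [d] splits into the bare cell followed by the glued one, a leaf in the other
   direction into the opposite order; hence [d (+) ~~ e], and flipping the leaf exchanges the
   two. *)
have E1 : c1 = split_cells d x v (Ar (d (+) ~~ e) z (@Nil T)) by rewrite /c1; case: (d);
    case: (e).
have E2 : c2 = split_cells d x v (Ar (~~ (d (+) ~~ e)) z (@Nil T)) by rewrite /c2; case: (d);
    case: (e).
rewrite E1 E2; set dz := d (+) ~~ e.
have m1 := code_move_sym (@valid_code_merge p q d x v z dz) (code_move_split p q d x v (isT :
    nonnil (Ar dz z (@Nil T)))).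
have m2 := code_move_leaf p q d x v dz z.
have m3 := code_move_split p q d x v (isT : nonnil (Ar (~~ dz) z (@Nil T))).
have s1 : same_par _ _ := let: And4 _ _ _ s := m1 in s.
have s2 : same_par _ _ := let: And4 _ _ _ s := m2 in s.
have s3 : same_par _ _ := let: And4 _ _ _ s := m3 in s.
split; last exact: same_par_trans s1 (same_par_trans s2 s3).
exact: reach_trans s1 (reach_move m1) (reach_trans s2 (reach_move m2) (reach_move m3)).
Qed.

Lemma reach_kinds cs K : all flat cs -> perm_eq (map kind cs) K ->
  exists cs', [/\ all flat cs', map kind cs' = K, reach cs cs' & same_par cs cs'].
Proof.
move=> + /(@perm_swap_ind _ (fun s t => forall cs, all flat cs -> map kind cs = s -> exists cs',
  [/\ all flat cs', map kind cs' = t, reach cs cs' & same_par cs cs'])) H.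
move=> fl; apply: H fl _ => // [s {}cs fl e|s t u h1 h2 {}cs fl e|p a b q {}cs fl e].
- by exists cs; split=> //; apply: reach_refl.
- have [c2 [f2 e2 r2 s2]] := h1 _ fl e; have [c3 [f3 e3 r3 s3]] := h2 _ f2 e2.
  by exists c3; split=> //; [apply: reach_trans s2 r2 r3 | apply: same_par_trans s2 s3].
have [p' [q' [ca1 [cb1 [ec1 ep ea eb eq]]]]] : exists p' q' c c',
    [/\ cs = p' ++ c :: c' :: q', map kind p' = p, kind c = a, kind c' = b & map kind q' = q].
  exists (take (size p) cs), (drop (size p).+2 cs).
  have : map kind (drop (size p) cs) = [:: a, b & q] by rewrite map_drop e drop_size_cat.
  case ed : (drop (size p) cs) => [|c [|c' s]] //= [<- <- eq].
  exists c, c'; split=> //; last by rewrite -eq -[(size p).+2]/(2 + size p) -drop_drop ed /=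
      drop0.
    by rewrite -[(size p).+2]/(2 + size p) -drop_drop ed /= drop0 -ed cat_take_drop.
  by rewrite map_take e take_size_cat.
subst.
(* Exchanging two letters of the same kind is invisible in the list of kinds. *)
have [kE|kN] := eqVneq (kind ca1) (kind cb1).
  by exists (p' ++ ca1 :: cb1 :: q'); split=> //; [rewrite map_cat /= kE | apply: reach_refl].
move: fl; rewrite all_cat /= => /and4P[fp fa fb fq].
case: ca1 cb1 kN fa fb {e} => [[x d] o1] [[v d'] o2] kN fa fb.
have [dd|dd] := eqVneq d' (~~ d).
  rewrite dd in fb *; have mv := code_move_turn p' q' d x o1 v o2.
  exists (p' ++ (x, ~~ d, o2) :: (v, d, o1) :: q'); split; last by case: mv.
  - by rewrite all_cat fp /= fq andbT; apply/andP; split; [exact: fb | exact: fa].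
  - by rewrite map_cat.
  - exact: reach_move mv.
have {}dd : d' = d by case: (d) (d') dd => -[].
subst d'; case: o1 o2 fa fb kN => [[z1 b1]|] [[z2 b2]|] //; rewrite /kind /flat /= ?eqxx //.
  case: b1 => // _ _ _.
  have [r s] := reach_slide p' q' d x v z1 false.
  by eexists; split; last (exact: s); last (exact: r); rewrite ?all_cat /= ?fp ?fq // !map_cat.
case: b2 => // _ _ _.
have [r s] := reach_slide p' q' d x v z2 true.
by eexists; split; last (exact: s); last (exact: r); rewrite ?all_cat /= ?fp ?fq // !map_cat.
Qed.

Lemma count_kind cs k : all flat cs -> count_mem k (map kind cs) =
  if k.2 then pfree k.1 cs else ptri k.1 cs.
Proof.
case: k => d o; elim: cs => [_|[[x d'] o'] cs IH] /=; first by case: o.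
move=> /andP[fc /IH {IH}]; rewrite /pfree /ptri /= {2 4}/cell_dir /=; move: fc.
rewrite /flat /kind /= xpair_eqE.
by case: o' => [[z [||]]|] //= _; case: o => /= ->; case: (d' == d); rewrite /nfree /ntri.
Qed.

End Reach.

(** * Relabelling codes, and isomorphism of flat codes *)

Section MapCode.
Variables (L L' : eqType) (g : L -> L').

Fixpoint map_branch (b : branch L) : branch L' :=
  match b with
  | Nil => Nil L'
  | Ar d x b => Ar d (g x) (map_branch b)
  | Tr x b y c => Tr (g x) (map_branch b) (g y) (map_branch c)
  end.

Definition map_cell (c : cell L) : cell L' :=
  (g (cell_vertex c), cell_dir c, omap (fun zb => (g zb.1, map_branch zb.2)) (cell_glued c)).

Definition map_arrow (a : L * L) : L' * L' := (g a.1, g a.2).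

Lemma branch_verts_map b : branch_verts (map_branch b) = map g (branch_verts b).
Proof. by elim: b => //= [d x b ->|x b -> y c ->] //; rewrite map_cat. Qed.

Lemma ori_map d x y : ori d (g x) (g y) = map_arrow (ori d x y).
Proof. by case: d. Qed.

Lemma branch_arrows_map v b : branch_arrows (g v) (map_branch b) = map map_arrow (branch_arrows
    v b).
Proof. by elim: b v => //= [d x b IH|x b IH y c IH'] v; rewrite ?IH ?IH' ?ori_map ?map_cat. Qed.

Lemma glued_verts_map c : glued_verts (cell_glued (map_cell c)) = map g (glued_verts
    (cell_glued c)).
Proof. by case: c => [[x d] [[z b]|]] //=; rewrite branch_verts_map. Qed.

Lemma verts_map cs : code_verts (map map_cell cs) = map g (code_verts cs).
Proof. by elim: cs => //= c cs IH; rewrite /code_verts /= in IH *;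
    rewrite IH glued_verts_map map_cat. Qed.

Lemma ecells_map cs e : map (@ecell_arrow L') (ecells (map map_cell cs) (g e)) = map map_arrow
    (map (@ecell_arrow L) (ecells cs e)) /\
  flatten (map (@ecell_glued L') (ecells (map map_cell cs) (g e))) = map map_arrow (flatten
      (map (@ecell_glued L) (ecells cs e))).
Proof.
elim: cs => //= [[[x d] o]] cs [-> ->].
have -> : next_vertex (map map_cell cs) (g e) = g (next_vertex cs e) by case: cs.
rewrite /map_cell /cell_vertex /cell_dir /cell_glued /ecell_arrow /= ori_map map_cat;
    split=> //; congr (_ ++ _).
by case: o => [[z b]|] //; rewrite /ecell_glued /= branch_arrows_map.
Qed.

Lemma arrows_map cs : code_arrows (map map_cell cs) = map map_arrow (code_arrows cs).
Proof.
case: cs => // c cs; have [e1 e2] := ecells_map (c :: cs) (cell_vertex c).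
rewrite /code_arrows map_cat; congr (_ ++ _); [exact: e1 | exact: e2].
Qed.

Lemma branch_sizes_map v v' b : size (branch_free v' (map_branch b)) = size (branch_free v b) /\
  size (branch_tris v' (map_branch b)) = size (branch_tris v b).
Proof.
elim: b v v' => //= [d x b IH|x b IH y c IH'] v v'; first by have [-> ->] := IH x (g x).
by rewrite !size_cat; have [-> ->] := IH x (g x); have [-> ->] := IH' y (g y).
Qed.

Lemma par_map d cs : pfree d (map map_cell cs) = pfree d cs /\
    ptri d (map map_cell cs) = ptri d cs.
Proof.
have e c : nfree (map_cell c) = nfree c /\ ntri (map_cell c) = ntri c.
  case: c => [[x d'] [[z b]|]] //; rewrite /nfree /ntri /=.
  by have [-> ->] := branch_sizes_map z (g z) b.
rewrite /pfree /ptri !filter_map -!map_comp.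
by split; congr sumn; rewrite -(eq_filter (a1 := fun c => cell_dir c == d)) //;
    apply: eq_map => c /=; case: (e c).
Qed.

End MapCode.

Section Transport.
Variables (T T' : finType) (h : T -> T').

Lemma code_rep_map (Q : quiver T) (Q' : quiver T') cs : bijective h ->
  (forall i j, Q' (h i) (h j) = Q i j) -> code_rep Q cs -> code_rep Q' (map (map_cell h) cs).
Proof.
move=> [h' hK h'K] hE [/and3P[u f1 f2] cov QE]; have hI := can_inj hK; split.
- rewrite /valid_code verts_map map_inj_uniq // u !has_map /=.
  by rewrite (eq_has (a2 := @cell_dir _)) // f1 (eq_has (a2 := fun c => ~~ cell_dir c)).
- by move=> x; rewrite verts_map -(h'K x) map_f.
- move=> i j; rewrite -(h'K i) -(h'K j) hE QE arrows_map count_map.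
  apply: eq_count => -[a b] /=; rewrite /map_arrow !xpair_eqE /=.
  by rewrite !h'K !(can2_eq hK h'K).
Qed.

End Transport.

Lemma flat_map (T T' : finType) (h : T -> T') cs cs' :
  all (@flat T) cs -> all (@flat T') cs' -> map (@kind T) cs = map (@kind T') cs' ->
  map h (code_verts cs) = code_verts cs' -> cs' = map (map_cell h) cs.
Proof.
elim: cs cs' => [|[[x d] o] cs IH] [|[[x' d'] o'] cs'] //= /andP[fo fl] /andP[fo' fl'] [dd oo
    kk].
rewrite /code_verts /= map_cat /cell_glued /=; move: dd oo fo fo';
    rewrite /flat /map_cell /cell_vertex /cell_dir /cell_glued /= => dd.
case: o o' => [[z [|? ? ?|? ? ? ?]]|] [[z' [|? ? ?|? ? ? ?]]|] //= _ _ _.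
  by case=> xx zz mv; rewrite -xx -zz dd -(IH cs').
by case=> xx mv; rewrite -xx dd -(IH cs').
Qed.

(** Flat codes with the same kinds list cycle vertices and apexes at the same positions, so the
    isomorphism matches the two vertex lists entry by entry. *)
Lemma flat_iso (T T' : finType) (Q : quiver T) (Q' : quiver T') cs cs' :
  code_rep Q cs -> code_rep Q' cs' -> all (@flat T) cs -> all (@flat T') cs' ->
  map (@kind T) cs = map (@kind T') cs' ->
  exists h : T -> T', bijective h /\ forall i j, Q' (h i) (h j) = Q i j.
Proof.
move=> [/and3P[u f _] cov QE] [/and3P[u' f' _] cov' QE'] fl fl' kk.
have [x0 x0'] : T * T'.
  by case: cs cs' f f' {u cov QE u' cov' QE' fl fl' kk} => // c ? [|c' ?] // _ _; split;
      [exact: cell_vertex c | exact: cell_vertex c'].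
have sz : size (code_verts cs) = size (code_verts cs').
  elim: cs cs' kk fl fl' {u f cov QE u' f' cov' QE'} => [|[[x d] o] cs IH] [|[[x' d'] o'] cs']
      //=.
  case=> _ oo e /andP[f1 f2] /andP[f1' f2']; rewrite /code_verts /= !size_cat;
      congr (_ + _).+1; last exact: IH.
  move: oo f1 f1'; rewrite /cell_glued /= /flat /=.
  by case: o o' => [[z [|? ? ?|? ? ? ?]]|] [[z' [|? ? ?|? ? ? ?]]|] //=.
pose h x := nth x0' (code_verts cs') (index x (code_verts cs)).
pose h' x := nth x0 (code_verts cs) (index x (code_verts cs')).
have hK : cancel h h'.
  by move=> x; rewrite /h' /h index_uniq ?nth_index // -sz index_mem.
have h'K : cancel h' h.
  by move=> x; rewrite /h' /h index_uniq ?nth_index // sz index_mem.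
exists h; split; first by exists h'.
have mv : map h (code_verts cs) = code_verts cs'.
  apply: (@eq_from_nth _ x0'); rewrite size_map // => i li.
  by rewrite (nth_map x0) // /h index_uniq.
have mc := flat_map fl fl' kk mv.
move=> i j; rewrite QE' mc arrows_map count_map QE; apply: eq_count => -[a b] /=.
by rewrite /map_arrow !xpair_eqE /= !(inj_eq (can_inj hK)).
Qed.

(** * Reflection of the non-oriented cycle *)

Section Reverse.
Variable T : finType.
Implicit Types (cs : seq (cell T)) (Q : quiver T).

Definition rcell (E : ecell T) : cell T := let: (x, y, d, o) := E in (y, ~~ d, o).
Definition recell (E : ecell T) : ecell T := let: (x, y, d, o) := E in (y, x, ~~ d, o).
(* The same quiver, read in the opposite direction. *)
Definition rcode cs : seq (cell T) := rev (map rcell (code_ecells cs)).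

(** Reversal exchanges the first vertex of a segment with its closing vertex [e]. *)
Lemma next_rev cs e : next_vertex (rev (map rcell (ecells cs e))) (next_vertex cs e) = e.
Proof. by elim: cs => //= c cs IH; rewrite rev_cons -cats1 next_cat. Qed.

Lemma ecells_rev cs e : ecells (rev (map rcell (ecells cs e))) (next_vertex cs e) = rev (map
    recell (ecells cs e)).
Proof. by elim: cs => //= c cs IH; rewrite !rev_cons -!cats1 ecells_cat /= IH. Qed.

Lemma ecells_rev_code cs : code_ecells (rcode cs) = rev (map recell (code_ecells cs)).
Proof.
case: cs => // c cs; rewrite -[code_ecells (c :: cs)]/(ecells (c :: cs) (cell_vertex c)).
have h1 := next_rev (c :: cs) (cell_vertex c); have h2 := ecells_rev (c ::
    cs) (cell_vertex c); rewrite -h2.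
rewrite -[rcode _]/(rev (map rcell (ecells (c :: cs) (cell_vertex c)))) in h1 *.
rewrite [next_vertex (c :: cs) _]/= in h1 *.
by case: (rev _) h1 => //= c' s ->.
Qed.

Lemma map_ecells cs : [seq (E.1.2, E.2) | E <- code_ecells cs] = [seq (cell_dir c,
    cell_glued c) | c <- cs].
Proof.
case: cs => // c0 cs; rewrite /code_ecells; move: (cell_vertex c0) => e.
by elim: (c0 :: cs) => //= c s ->.
Qed.

Lemma map_ecells_vertex cs : [seq E.1.1.1 | E <- code_ecells cs] = [seq cell_vertex c | c <-
    cs].
Proof.
case: cs => // c0 cs; rewrite /code_ecells; move: (cell_vertex c0) => e.
by elim: (c0 :: cs) => //= c s ->.
Qed.

Lemma perm_rev_code_vertex cs : perm_eq [seq cell_vertex c | c <- rcode cs] [seq cell_vertex c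
    | c <- cs].
Proof.
rewrite /rcode map_rev perm_rev -map_comp.
case: cs => // c0 cs; rewrite /code_ecells.
have gen (s : seq (cell T)) e : perm_eq (next_vertex s e ::
    [seq cell_vertex (rcell i) | i <- ecells s e]) (e :: [seq cell_vertex c | c <- s]).
  elim: s e => //= c s IH e; apply: (@perm_trans _ [:: cell_vertex c,
      next_vertex s e & [seq cell_vertex (rcell i) | i <- ecells s e]]) => //.
  by apply: (@perm_trans _ (cell_vertex c :: e :: [seq cell_vertex c | c <- s]));
      [rewrite perm_cons | permlia].
by have := gen (c0 :: cs) (cell_vertex c0); rewrite [next_vertex _ _]/= perm_cons.
Qed.

(** [ori (~~ d) y x] equals [ori d x y], so reading backwards yields the same arrows and triangles
    in another order. *)
Lemma code_rep_rev_code Q cs : code_rep Q cs -> code_rep Q (rcode cs).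
Proof.
move=> [/and3P[u f1 f2] cov QE].
have pv : perm_eq (code_verts (rcode cs)) (code_verts cs).
  apply: (perm_trans (perm_verts _)); rewrite perm_sym; apply: (perm_trans (perm_verts _)).
  apply: perm_cat; first by rewrite perm_sym; apply: perm_rev_code_vertex.
  rewrite -ecells_glued -ecells_glued ecells_rev_code map_rev -map_comp.
  apply: perm_flatten; rewrite perm_sym perm_rev.
  by rewrite (eq_map (g := fun E => glued_verts E.2)) // => -[[[]]].
have hd f : has f (map (@cell_dir T) (rcode cs)) = has (fun d =>
    f (~~ d)) (map (@cell_dir T) cs).
  rewrite /rcode map_rev has_rev -map_comp.
  rewrite (_ : map (@cell_dir T) cs = map fst [seq (cell_dir c, cell_glued c) | c <- cs]);
      last by rewrite -map_comp.
  by rewrite -map_ecells -map_comp !has_map; apply: eq_has => -[[[]]].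
split.
- rewrite /valid_code (perm_uniq pv) u /=.
  have := hd id; have := hd negb; rewrite !has_map /preim /= => -> ->.
  by rewrite f2 /= (eq_has (a2 := @cell_dir T)) // => c /=; rewrite negbK.
- by move=> x; rewrite (perm_mem pv).
- move=> i j; rewrite QE; apply/permP; rewrite /code_arrows /code_ring /code_glued
    ecells_rev_code !map_rev perm_sym.
  apply: perm_cat; first by rewrite perm_rev -map_comp (eq_map (g := @ecell_arrow T)) // =>
      -[[[x y] []] o].
  apply: perm_flatten; rewrite perm_rev -map_comp (eq_map (g := @ecell_glued T)) // =>
      -[[[x y] []] o] //.
Qed.

Lemma par_rev_code d cs : pfree d (rcode cs) = pfree (~~ d) cs /\
    ptri d (rcode cs) = ptri (~~ d) cs.
Proof.
have gen (F : bool * option (T * branch T) -> nat) :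
    sumn [seq F (cell_dir c, cell_glued c) | c <- rcode cs] = sumn [seq F (~~ cell_dir c,
        cell_glued c) | c <- cs].
  rewrite (_ : [seq F (~~ cell_dir c, cell_glued c) | c <- cs] =
    [seq F (~~ do_.1, do_.2) | do_ <- [seq (cell_dir c, cell_glued c) | c <- cs]]);
        last by rewrite -map_comp.
  rewrite -map_ecells /rcode map_rev sumn_rev -!map_comp.
  by congr sumn; apply: eq_map => -[[[]]].
have sf (f : cell T -> nat) s e : sumn [seq f c | c <- s & cell_dir c == e] = sumn [seq
    (cell_dir c == e) * f c | c <- s].
  by elim: s => //= c s IH; case: eqP => _ /=; rewrite IH ?mul1n.
rewrite /pfree /ptri !sf.
have h1 := gen (fun x => (x.1 == d) * (if x.2 is Some (z,
    b) then size (branch_free z b) else 1)).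
have h2 := gen (fun x => (x.1 == d) * (if x.2 is Some (z,
    b) then (size (branch_tris z b)).+1 else 0)).
split; [rewrite [LHS]h1 | rewrite [LHS]h2]; congr sumn; apply: eq_map => c /=;
  by case: (cell_dir c); case: (d).
Qed.

End Reverse.

(** * Triangles of built quivers *)

Section BuiltTriangles.
Variable L : eqType.

Definition tri_pairs (t : L * L * L) : seq (L * L) :=
  let: (p, q, r) := t in [:: (p, q); (q, r); (r, p)].

Lemma perm_branch v b : perm_eq (branch_arrows v b) (branch_free v b ++
    flatten (map tri_pairs (branch_tris v b))).
Proof.
elim: b v => //= [d x b IH|x b IH y c IH'] v; first by rewrite perm_cons.
apply/permP => P; have /permP/(_ P) := IH x; have /permP/(_ P) := IH' y.
by repeat (progress rewrite /= ?(map_cat, flatten_cat, count_cat)); natlia.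
Qed.

(** Of two different triangles, the apex of the later one did not exist when the earlier one was
    made. So they never contain each other's apex, a symmetric form that will apply where only the
    arrow sets are known. *)
Lemma built_TL_uniq (X V : seq L) A0 N TL : uniq X -> {subset ends A0 <= X} ->
    built X A0 V N TL ->
  [/\ forall t, t \in TL -> [&& t.1.1 \in V, t.1.2 \in V & t.2 \in V], uniq TL &
  forall t t', t \in TL -> t' \in TL -> t'.2 \in [:: t.1.1; t.1.2; t.2] ->
    t.2 \in [:: t'.1.1; t'.1.2; t'.2] -> t = t'].
Proof.
move=> uX sup; elim=> {V N TL} //.
- move=> V N TL d u v _ [h1 h2 h3] _ _; split=> // t /h1.
  by rewrite !inE => /and3P[-> -> ->]; rewrite !orbT.
- move=> V N TL a b u bt [h1 h2 h3] abN uV.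
  have [_ _ sN _ _] := built_basic bt uX sup.
  have aV := sN _ (ends1 abN); have bV := sN _ (ends2 abN).
  have nu t : t \in TL -> u \notin [:: t.1.1; t.1.2; t.2].
    by move=> /h1 /and3P[v1 v2 v3]; rewrite !inE; apply/negP => /or3P[]/eqP e; move: uV;
        rewrite e ?v1 ?v2 ?v3.
  split.
  + move=> t; rewrite inE => /orP[/eqP->|/h1/and3P[v1 v2 v3]]; rewrite /= !inE.
      by rewrite aV bV eqxx !orbT.
    by rewrite v1 v2 v3 !orbT.
  + by rewrite /= h2 andbT; apply/negP => /nu; rewrite !inE eqxx !orbT.
  + move=> t t'; rewrite ![_ \in _ :: TL]inE => /orP[/eqP->|tT] /orP[/eqP->|tT'] //;
      last exact: h3.
      by move=> _; rewrite /= (negbTE (nu _ tT')).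
    by rewrite /= (negbTE (nu _ tT)).
- move=> V V' N N' TL TL' _ [h1 h2 h3] pV pN pT; split.
  + by move=> t; rewrite -!(perm_mem pV) -(perm_mem pT); apply: h1.
  + by rewrite -(perm_uniq pT).
  + by move=> t t'; rewrite -!(perm_mem pT); apply: h3.
Qed.

Lemma uniq_flatten_inj (A B : eqType) (F : A -> seq B) s x y v : uniq (flatten (map F s)) ->
  x \in s -> y \in s -> v \in F x -> v \in F y -> x = y.
Proof.
elim: s => //= a s IH; rewrite cat_uniq => /and3P[_ /hasPn h u].
have mf z : z \in s -> v \in F z -> v \in flatten (map F s).
  by move=> zs vz; apply/flattenP; exists (F z) => //; apply: map_f.
rewrite !inE => /orP[/eqP->|xs] /orP[/eqP->|ys] // vx vy; last exact: IH.
  by have := h _ (mf _ ys vy); rewrite vx.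
by have := h _ (mf _ xs vx); rewrite vy.
Qed.

Lemma uniq_flatten_each (A B : eqType) (F : A -> seq B) s x : uniq (flatten (map F s)) ->
  x \in s -> uniq (F x).
Proof.
elim: s => //= a s IH; rewrite cat_uniq => /and3P[u1 _ u2].
by rewrite inE => /orP[/eqP->|/IH]; last apply.
Qed.

Lemma flatten_uniq (A B : eqType) (F : A -> seq B) s : uniq s ->
  (forall x, x \in s -> uniq (F x)) ->
  (forall x y v, x \in s -> y \in s -> v \in F x -> v \in F y -> x = y) ->
  uniq (flatten (map F s)).
Proof.
elim: s => //= a s IH /andP[as_ us] h1 h2; rewrite cat_uniq h1 ?mem_head //=; apply/andP; split.
  apply/hasPn => v /flattenP [_ /mapP [x xs ->] vx]; apply/negP => va.
  by move: as_; rewrite (h2 a x v) ?xs ?inE ?eqxx ?xs ?orbT.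
apply: IH => // [x xs|x y v xs ys]; first by apply: h1; rewrite inE xs orbT.
by apply: h2; rewrite inE ?xs ?ys orbT.
Qed.

End BuiltTriangles.

(** * Individual arrows and their endpoints *)

Section ArrowSets.
Variables (T : finType) (Q : quiver T).
Implicit Types (a : arrow Q).

Lemma arrow_pos a : 0 < Q (tag a).1 (tag a).2.
Proof. by case: a => p i; apply: leq_ltn_trans (ltn_ord i). Qed.

Lemma arrow_exists x y : 0 < Q x y -> exists a : arrow Q, tag a = (x, y).
Proof. by move=> h; exists (Tagged (fun p : T * T => 'I_(Q p.1 p.2)) (Ordinal h : 'I_(Q (x,
    y).1 (x, y).2))). Qed.

Lemma card_arrows p : #|[pred a : arrow Q | tag a == p]| = Q p.1 p.2.
Proof.
pose F (i : 'I_(Q p.1 p.2)) : arrow Q := Tagged (fun p : T * T => 'I_(Q p.1 p.2)) i.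
have FI : injective F by move=> i j e; apply: eq_from_Tagged e.
rewrite -[RHS]card_ord -(card_codom FI); apply: eq_card => -[p' i]; rewrite !inE /=.
by apply/eqP/codomP => [e|[j e]]; [subst p'; exists i | apply: (congr1 tag e)].
Qed.

Lemma arrow_unique a b : tag a = tag b -> Q (tag a).1 (tag a).2 <= 1 -> a = b.
Proof.
move=> e; rewrite -card_arrows => le.
by apply: (card_le1_eqP le); rewrite inE /= ?e.
Qed.

Lemma count_tags (l : seq (arrow Q)) p : uniq l -> (forall a, tag a = p -> a \in l) ->
  count_mem p (map tag l) = Q p.1 p.2.
Proof.
move=> u h; rewrite -card_arrows count_map -size_filter -(card_uniqP (filter_uniq _ u)).
apply: eq_card => a; rewrite mem_filter /=.
by apply/andP/idP => [[]|e] //; split=> //; apply: h; apply/eqP.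
Qed.

Lemma count_tags_all (l : seq (arrow Q)) a : uniq l ->
  Q (tag a).1 (tag a).2 <= count_mem (tag a) (map tag l) -> a \in l.
Proof.
move=> u le; apply: contraTT le => al; rewrite -ltnNge -card_arrows count_map -size_filter.
rewrite -(card_uniqP (filter_uniq _ u)); apply: proper_card; apply/properP; split.
  by apply/subsetP => b; rewrite mem_filter inE => /andP[].
by exists a; rewrite ?inE // mem_filter (negbTE al) andbF.
Qed.

Lemma tags_realized (ps : seq (T * T)) : (forall p, count_mem p ps <= Q p.1 p.2) ->
  exists l : seq (arrow Q), map tag l = ps /\ uniq l.
Proof.
elim: ps => [|p ps IH] h; first by exists [::].
have [q|l [e u]] := IH; first by apply: leq_trans (h q) => /=; apply: leq_addl.
case: (pickP [pred a : arrow Q | (tag a == p) && (a \notin l)]) => [a|no].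
  by move=> /andP[/eqP ta al]; exists (a :: l); rewrite /= ta e al.
have := h p; rewrite -e /= eqxx (count_tags u) ?ltnn // => a ta.
by have := no a; rewrite /= ta eqxx /= => /negbFE.
Qed.

Definition allNone (w : seq (step Q)) : seq (cell T) := [seq (step_start s, s.2,
    None) | s <- w].

(** The glued parts of [cs] are left open, so that this serves a bare cycle as well as a code read
    off a drawing. *)
Lemma walk_ring (w : seq (step Q)) (cs : seq (cell T)) :
  [seq (step_start s, s.2) | s <- w] = [seq (cell_vertex c, cell_dir c) | c <- cs] ->
  cycle (fun s t => step_end s == step_start t) w -> map tag (map fst w) = code_ring cs.
Proof.
case: w cs => [|s w] [|c cs] //=; rewrite /code_ring /code_ecells.
have gen (t s' : step Q) w' c' cs' : [seq (step_start s, s.2) | s <- s' ::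
    w'] = [seq (cell_vertex c, cell_dir c) | c <- c' :: cs'] ->
    path (fun s t => step_end s == step_start t) s' (rcons w' t) ->
    map tag (map fst (s' :: w')) = map (@ecell_arrow T) (ecells (c' :: cs') (step_start t)).
  have ot (s2 : step Q) y : step_end s2 = y -> tag s2.1 = ori s2.2 (step_start s2) y.
    by move=> <-; case: s2 => [[[u v] i] []].
  elim: w' s' c' cs' => [|s2 w' IH] s' c' [|c2 cs'] //= [e1 e2].
    by rewrite andbT => /eqP /ot ->; rewrite /ecell_arrow e1 e2.
  move=> e3 e4 e5 /andP[/eqP/ot -> pa]; congr (_ :: _); first by rewrite /ecell_arrow e1 e2 e3.
  have := IH s2 c2 cs'; rewrite /= e3 e4 e5 => /(_ erefl pa).
  by rewrite /ecell_arrow.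
by move=> [e1 e2 e3] pa; rewrite -e1; apply: gen pa; rewrite /= e1 e2 e3.
Qed.

(** Any non-oriented cycle is the ring of a code with nothing glued to it, so [ring_code]
    applies. *)
Lemma cycle_ring (w : seq (step Q)) : full_nonoriented_cycle w ->
  ring (map (@step_start _ _) w) (map tag (map fst w)).
Proof.
move=> [_ cyc [us _] _ /andP[h1 h2]].
pose cs := allNone w.
have e0 : code_verts cs = map (@step_start _ _) w by rewrite /cs; elim: (w) => //= s v;
    rewrite /code_verts /= => ->.
have <- : map (@cell_vertex T) cs = map (@step_start _ _) w by rewrite -map_comp.
rewrite (walk_ring (cs := cs)) //; last by rewrite -!map_comp.
by apply: ring_code; rewrite /valid_code e0 us !has_map h1 h2.
Qed.

End ArrowSets.

(** * Drawing a code *)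

Section CodeGraph.
Variables (T : finType) (Q : quiver T) (cs : seq (cell T)).
Hypothesis rep : code_rep Q cs.
Variables (w : seq (step Q)) (z : arrow Q -> option T).

(* The drawing given by [w] and [z] is the one described by the code [cs]. *)
Definition compat : Prop :=
  [/\ [seq (tag s.1, s.2, z s.1) | s <- w] =
        [seq (ecell_arrow E, E.1.2, omap fst E.2) | E <- code_ecells cs],
      uniq (map fst w) & forall a, a \notin map fst w -> z a = None].

Let vc : valid_code cs := let: And3 h _ _ := rep in h.
Let cov x : x \in code_verts cs := let: And3 _ h _ := rep in h x.
Let QE i j : Q i j = count_mem (i, j) (code_arrows cs) := let: And3 _ _ h := rep in h i j.
Let u : uniq (code_verts cs) := let: conj h _ := andP vc in h.
Let uX : uniq (map (@cell_vertex T) cs) := uniq_vertex u.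
Let rg : ring (map (@cell_vertex T) cs) (code_ring cs) := ring_code vc.
Let sup := ring_supp rg.
Let bt : built (map (@cell_vertex T) cs) (code_ring cs) (code_verts cs) (code_glued cs)
    (code_tris cs) := code_built u.
Let bas := built_basic bt uX sup.
Local Notation X := (map (@cell_vertex T) cs).

Lemma tag_arrows (a : arrow Q) : tag a \in code_arrows cs.
Proof. by have := arrow_pos a; rewrite QE -surjective_pairing -has_count has_pred1. Qed.

Lemma glued_notX p : p \in code_glued cs -> (p.1 \notin X) || (p.2 \notin X).
Proof. by case: bas => _ _ _ _; apply. Qed.

Lemma glued_notin_ring p : p \in code_glued cs -> p \notin code_ring cs.
Proof.
move=> /glued_notX h; apply: contraL h => pr.
by rewrite negb_or !negbK !sup ?ends1 ?ends2.
Qed.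

Lemma Q_glued p : p \in code_glued cs -> Q p.1 p.2 = 1.
Proof.
move=> pd; rewrite QE -surjective_pairing count_cat (count_memPn (glued_notin_ring pd)).
by rewrite count_uniq_mem ?pd //; case: bas.
Qed.

Lemma glued_arrow_unique (a b : arrow Q) : tag a = tag b -> tag a \in code_glued cs -> a = b.
Proof. by move=> e /Q_glued le; apply: arrow_unique e _; rewrite le. Qed.

Lemma glued_arrow p : p \in code_glued cs -> exists a : arrow Q, tag a = p.
Proof.
move=> /Q_glued le; have [|a ta] := @arrow_exists _ Q p.1 p.2; first by rewrite le.
by exists a; rewrite ta -surjective_pairing.
Qed.

Lemma ecells_start_inj E E' : E \in code_ecells cs -> E' \in code_ecells cs ->
    E.1.1.1 = E'.1.1.1 -> E = E'.
Proof.
move=> h h' e; apply: (@uniq_flatten_inj _ _ (fun F : ecell T =>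
    [:: F.1.1.1]) (code_ecells cs) _ _ E.1.1.1) => //.
- by rewrite flatten_map1 map_ecells_vertex.
- by rewrite mem_head.
- by rewrite e mem_head.
Qed.

Lemma uniq_trees : uniq (flatten [seq glued_verts E.2 | E <- code_ecells cs] ++ X).
Proof. by rewrite ecells_glued uniq_catC -(perm_uniq (perm_verts cs)). Qed.

Lemma tree_notX E v : E \in code_ecells cs -> v \in glued_verts E.2 -> v \notin X.
Proof.
move=> EE vE; have := uniq_trees; rewrite uniq_catC cat_uniq => /and3P[_ /hasPn h _]; apply: h.
by apply/flattenP; exists (glued_verts E.2) => //; apply: map_f.
Qed.

Lemma tree_inj E E' v : E \in code_ecells cs -> E' \in code_ecells cs ->
    v \in glued_verts E.2 -> v \in glued_verts E'.2 -> E = E'.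
Proof.
have := uniq_trees; rewrite cat_uniq => /and3P[h _ _].
exact: (@uniq_flatten_inj _ _ (fun E : ecell T => glued_verts E.2) (code_ecells cs) E E' v h).
Qed.

Lemma mem_gluedP p : reflect (exists2 E, E \in code_ecells cs & p \in ecell_glued E) (p \in
    code_glued cs).
Proof.
apply: (iffP flattenP) => [[_ /mapP [E EE ->] h]|[E EE h]]; first by exists E.
by exists (ecell_glued E) => //; apply: map_f.
Qed.

Lemma ecell_gluedP E p : E \in code_ecells cs -> p \in ecell_glued E ->
    exists v b, E.2 = Some (v, b) /\
  [\/ p = ((ecell_arrow E).2, v), p = (v, (ecell_arrow E).1) | p \in branch_arrows v b].
Proof.
move=> _; case: E => [[[x y] d] [[v b]|]] //; rewrite /ecell_glued !inE /ecell_arrow => h;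
    exists v, b; split=> //.
by case/or3P: h => [/eqP->|/eqP->|h]; [constructor 1 | constructor 2 | constructor 3].
Qed.

Lemma glued_verts_root (E : ecell T) v b : E.2 = Some (v, b) ->
    glued_verts E.2 = v :: branch_verts b.
Proof. by move=> ->. Qed.

Lemma ecell_arrow_X E : E \in code_ecells cs -> (ecell_arrow E).1 \in X /\
    (ecell_arrow E).2 \in X.
Proof. by move=> EE; split; apply: sup; [apply: ends1 | apply: ends2]; apply: map_f. Qed.

(** Trees of different cells are disjoint and avoid the cycle, so an endpoint in the tree determines
    the cell to which the arrow belongs. *)
Lemma arrows_at_tree E v b p : E \in code_ecells cs -> E.2 = Some (v, b) ->
    p \in code_arrows cs ->
  (p.1 \in v :: branch_verts b) || (p.2 \in v :: branch_verts b) ->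
  [\/ p = ((ecell_arrow E).2, v), p = (v, (ecell_arrow E).1) | p \in branch_arrows v b].
Proof.
move=> EE Eb; rewrite mem_cat => /orP[pr|/mem_gluedP [E' EE' pE]] h.
  have n1 := sup (ends1 pr); have n2 := sup (ends2 pr); case/orP: h;
      rewrite -(glued_verts_root Eb) => h.
    by have := tree_notX EE h; rewrite n1.
  by have := tree_notX EE h; rewrite n2.
have [v' [b' [Eb' c]]] := ecell_gluedP EE' pE; have [X1 X2] := ecell_arrow_X EE'.
have vE : v' \in glued_verts E'.2 by rewrite Eb' mem_head.
suff e : E' = E by move: Eb' c; rewrite e Eb => -[<- <-].
have key x : x \in v :: branch_verts b -> x \in v' :: branch_verts b' -> E' = E.
  by rewrite -(glued_verts_root Eb) -(glued_verts_root Eb') => h1 h2; apply: tree_inj h2 h1.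
have nX x : x \in X -> x \in v :: branch_verts b -> E' = E.
  by rewrite -(glued_verts_root Eb) => xX /(tree_notX EE); rewrite xX.
case: c h => [->|->|/[dup]/ends1/ends_branch h1 /ends2/ends_branch h2] /=.
- by case/orP=> [/(nX _ X2)//|/key]; apply; rewrite mem_head.
- by case/orP=> [/key|/(nX _ X1)//]; apply; rewrite mem_head.
- by case/orP=> /key; apply.
Qed.

Lemma arrows_in_tree E v b p : E \in code_ecells cs -> E.2 = Some (v, b) ->
    p \in code_arrows cs ->
  p.1 \in v :: branch_verts b -> p.2 \in v :: branch_verts b -> p \in branch_arrows v b.
Proof.
move=> EE Eb pc h1 h2; have := arrows_at_tree EE Eb pc; rewrite h1 => /(_ isT) [e|e|//];
  have [X1 X2] := ecell_arrow_X EE; move: h1 h2; rewrite -(glued_verts_root Eb) =>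
      /(tree_notX EE) h1 /(tree_notX EE) h2.
- by move: h1; rewrite e X2.
- by move: h2; rewrite e X1.
Qed.

Lemma branch_arrows_glued E v b p : E \in code_ecells cs -> E.2 = Some (v, b) ->
    p \in branch_arrows v b -> p \in code_glued cs.
Proof.
move=> EE Eb h; apply/mem_gluedP; exists E => //.
by case: E EE Eb => [[[x y] d] o] _ /= ->; rewrite /ecell_glued !inE h !orbT.
Qed.

Lemma count_tree E v b i j : E \in code_ecells cs -> E.2 = Some (v, b) ->
  i \in v :: branch_verts b -> j \in v :: branch_verts b ->
      Q i j = count_mem (i, j) (branch_arrows v b).
Proof.
move=> EE Eb hi hj.
have ub : uniq (branch_arrows v b).
  have ud : uniq (flatten (map (@ecell_glued T) (code_ecells cs))) by case: bas.
  have := uniq_flatten_each ud EE; case: E EE Eb => [[[x y] d] o] _ /= ->.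
  by rewrite /ecell_glued /= => /and3P[].
rewrite [RHS]count_uniq_mem //; have [h|h] := boolP ((i, j) \in branch_arrows v b).
  exact: (Q_glued (branch_arrows_glued EE Eb h)).
by rewrite QE; apply/count_memPn; apply: contra h => /(arrows_in_tree EE Eb); apply.
Qed.

Lemma code_connected : connected Q.
Proof.
have symA : symmetric (adjacent Q) by move=> x y; rewrite /adjacent orbC.
have [x0 x0X _] := ring_turn rg.
have cl a : a \in code_arrows cs -> connect (adjacent Q) x0 a.1 = connect (adjacent Q) x0 a.2.
  move=> aA; have ad : adjacent Q a.1 a.2.
    by rewrite /adjacent QE -surjective_pairing -has_count has_pred1 aA.
  apply/idP/idP => h; apply: connect_trans h (connect1 _) => //.
  by rewrite symA.
have aX : all (connect (adjacent Q) x0) X.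
  apply: (ring_conn rg) => [a aA|]; first by apply: cl; rewrite mem_cat aA.
  by apply/hasP; exists x0 => //; apply: connect0.
have all' := built_conn uX sup bt cl aX.
move=> x y; apply: (@connect_trans _ _ x0); last exact: (allP all').
by rewrite (sym_connect_sym symA); apply: (allP all').
Qed.

End CodeGraph.

Section CodeCycle.
Variables (T : finType) (Q : quiver T) (cs : seq (cell T)).
Variables (w : seq (step Q)) (z : arrow Q -> option T).
Hypotheses (rep : code_rep Q cs) (hc : compat cs w z).
Local Notation X := (map (@cell_vertex T) cs).

Let vc : valid_code cs := let: And3 h _ _ := rep in h.
Let u : uniq (code_verts cs) := let: conj h _ := andP vc in h.
Let uX : uniq X := uniq_vertex u.
Let QE i j : Q i j = count_mem (i, j) (code_arrows cs) := let: And3 _ _ h := rep in h i j.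
Let rg : ring X (code_ring cs) := ring_code vc.
Let bt : built X (code_ring cs) (code_verts cs) (code_glued cs) (code_tris cs) := code_built u.
Let uw : uniq (map fst w) := let: And3 _ h _ := hc in h.

Lemma compat_tags : map tag (map fst w) = code_ring cs.
Proof.
have [e _ _] := hc; have := congr1 (map (fun x => x.1.1)) e.
by rewrite -!map_comp.
Qed.

Lemma step_startE (s : step Q) x y : tag s.1 = ori s.2 x y -> step_start s = x.
Proof. by rewrite /step_start /src /tgt; case: s => a [] /= ->. Qed.

Lemma step_endE (s : step Q) x y : tag s.1 = ori s.2 x y -> step_end s = y.
Proof. by rewrite /step_end /src /tgt; case: s => a [] /= ->. Qed.

Lemma compat_steps : [seq (step_start s, step_end s, s.2, z s.1) | s <- w] =
  [seq (E.1.1.1, E.1.1.2, E.1.2, omap fst E.2) | E <- code_ecells cs].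
Proof.
have [e _ _] := hc; elim: w (code_ecells cs) e => [|s v IH] [|E Es] //= [e1 e2 e3 /IH ->].
congr (_ :: _); move: e1 e2 e3; case: E => [[[x y] d] o] /= e1 e2 ->;
    rewrite /ecell_arrow -e2 in e1.
by rewrite (step_startE e1) (step_endE e1) e2.
Qed.

Lemma compat_starts : map (@step_start _ _) w = X.
Proof.
have := congr1 (map (fun x => x.1.1.1)) compat_steps; rewrite -!map_comp.
by rewrite -map_ecells_vertex.
Qed.

Lemma walk_vertsE : walk_verts w =i X.
Proof. by move=> x; rewrite inE compat_starts. Qed.

Lemma step_cell (s : step Q) : s \in w -> exists2 E, E \in code_ecells cs &
  [/\ tag s.1 = ecell_arrow E, s.2 = E.1.2, z s.1 = omap fst E.2 & step_start s = E.1.1.1].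
Proof.
move=> sw; have [e _ _] := hc.
have : (tag s.1, s.2, z s.1) \in [seq (ecell_arrow E, E.1.2,
    omap fst E.2) | E <- code_ecells cs].
  by rewrite -e; apply: map_f.
case/mapP=> [[[[x y] d] o] EE [e1 e2 e3]]; exists (x, y, d, o) => //; split=> //.
by apply: (@step_startE s x y); rewrite e1 e2.
Qed.

Lemma cell_step E : E \in code_ecells cs -> exists2 s, s \in w &
  [/\ tag s.1 = ecell_arrow E, s.2 = E.1.2, z s.1 = omap fst E.2 & step_start s = E.1.1.1].
Proof.
move=> EE; have [e _ _] := hc.
have : (ecell_arrow E, E.1.2, omap fst E.2) \in [seq (tag s.1, s.2, z s.1) | s <- w].
  by rewrite e; apply: (map_f (fun E => (ecell_arrow E, E.1.2, omap fst E.2))).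
case/mapP=> s sw [e1 e2 e3]; exists s => //; split=> //.
by case: E {EE} e1 e2 e3 => [[[x y] d] o] e1 e2 e3; apply: (@step_startE s x y);
    rewrite -e1 -e2.
Qed.

Lemma w_start_inj (s t : step Q) : s \in w -> t \in w -> step_start s = step_start t -> s = t.
Proof.
move=> h h' e; apply: (@uniq_flatten_inj _ _ (fun F : step Q =>
    [:: step_start F]) w _ _ (step_start s)) => //.
- by rewrite flatten_map1 compat_starts.
- by rewrite mem_head.
- by rewrite e mem_head.
Qed.

Lemma w_arrow_inj (s t : step Q) : s \in w -> t \in w -> s.1 = t.1 -> s = t.
Proof.
move=> h h' e; apply: (@uniq_flatten_inj _ _ (fun F : step Q => [:: F.1]) w _ _ s.1) => //.
- by rewrite flatten_map1 uw.
- by rewrite mem_head.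
- by rewrite e mem_head.
Qed.

Lemma z_cell a v : z a = Some v -> exists x y d b,
  [/\ (x, y, d, Some (v, b)) \in code_ecells cs, tag a = ori d x y, (a,
      d) \in w & a \in map fst w].
Proof.
move=> za; have aw : a \in map fst w.
  by apply: contraT => na; have [_ _ /(_ a na)] := hc; rewrite za.
have /mapP [s sw e] := aw; have [[[[x y] d] o] EE [e1 e2 e3 _]] := step_cell sw.
rewrite /ecell_arrow /= in e1 e2.
subst a; move: e3; rewrite za; case: o EE => [[v' b]|] //= EE [ev]; subst v'.
exists x, y, d, b; split=> //; rewrite -e2.
by case: (s) sw.
Qed.

Lemma cell_z E v b : E \in code_ecells cs -> E.2 = Some (v, b) ->
  exists a, [/\ (a, E.1.2) \in w, a \in map fst w, tag a = ecell_arrow E & z a = Some v].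
Proof.
move=> EE Eb; have [[a d] sw [/= e1 e2 e3 _]] := cell_step EE; exists a; split=> //.
- by rewrite -e2.
- by apply: (map_f fst sw).
- by rewrite e3 Eb.
Qed.

(** No glued arrow is parallel to one of the ring, so over each pair of the ring [w] has as many
    arrows as [Q] and misses none of the parallel ones. *)
Lemma w_complete (a : arrow Q) : tag a \in code_ring cs -> a \in map fst w.
Proof.
move=> ar; apply: count_tags_all => //; rewrite compat_tags QE -surjective_pairing count_cat.
by rewrite (@count_memPn _ _ (code_glued cs) _) ?addn0 //;
    apply: contraL ar => /(glued_notin_ring rep).
Qed.

Lemma w_ring (a : arrow Q) : a \in map fst w -> tag a \in code_ring cs.
Proof. by move=> aw; rewrite -compat_tags map_f. Qed.

Lemma in_wE (a : arrow Q) : (a \in map fst w) = (tag a \in code_ring cs).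
Proof. by apply/idP/idP; [exact: w_ring | exact: w_complete]. Qed.

Lemma tree_root_inj E E' v b v' b' x : E \in code_ecells cs -> E' \in code_ecells cs ->
  E.2 = Some (v, b) -> E'.2 = Some (v', b') -> x \in v :: branch_verts b ->
      x \in v' :: branch_verts b' -> E = E'.
Proof.
by move=> EE EE' e e'; rewrite -(glued_verts_root e) -(glued_verts_root e');
    apply: (tree_inj rep).
Qed.

Lemma z_inj a b v : z a = Some v -> z b = Some v -> a = b.
Proof.
move=> /z_cell [x [y [d [c [EE ta ad _]]]]] /z_cell [x' [y' [d' [c' [EE' tb bd _]]]]].
have [e1 e2 e3 _] := tree_root_inj EE EE' erefl erefl (mem_head _ _) (mem_head _ _).
have e : (a, d) = (b, d').
  apply: w_start_inj => //.
  by rewrite (@step_startE (a, d) _ _ ta) (@step_startE (b, d') _ _ tb).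
by case: e.
Qed.

Lemma code_nonoriented : full_nonoriented_cycle w.
Proof.
have /and3P[_ h1 h2] := vc.
have dd : map snd w = map (@cell_dir T) cs.
  have [e _ _] := hc; have := congr1 (map (fun x => x.1.2)) e; rewrite -!map_comp => e1.
  by have := congr1 (map fst) (map_ecells cs); rewrite -!map_comp; apply: etrans e1.
have hd : has (fun s => s.2) w && has (fun s => ~~ s.2) w.
  rewrite (_ : has (fun s => s.2) w = has id (map snd w)); last by rewrite has_map.
  rewrite (_ : has (fun s => ~~ s.2) w = has negb (map snd w)); last by rewrite has_map.
  by rewrite dd !has_map h1.
split=> //.
- by case: (w) hd => [|s [|s' v]] //=; rewrite !orbF andbN.
- have gen (t : step Q) v c cs' e : [seq (step_start s, step_end s) | s <- t :: v] =
      [seq E.1.1 | E <- ecells (c :: cs') e] -> forall t0, step_start t0 = e ->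
      path (fun s t => step_end s == step_start t) t (rcons v t0).
    elim: v t c cs' => [|s v IH] t c [|c' cs'] //= [e1 e2].
      by move=> t0 ->; rewrite e2 eqxx.
    move=> e3 e4 e5 t0 te; rewrite e2 e3 eqxx; apply: (IH s c' cs') => //=.
    by rewrite e3 e4 e5.
  have := compat_steps; case: (w) => // s v; case: (cs) => // c cs' e.
  have e' : [seq (step_start s0, step_end s0) | s0 <- s ::
      v] = [seq E.1.1 | E <- ecells (c :: cs') (cell_vertex c)].
    have := congr1 (map (fun x => x.1.1)) e; rewrite -!map_comp => e1.
    transitivity (map ((fun x => x.1.1) \o (fun s : step Q =>
        (step_start s, step_end s, s.2, z s.1))) (s :: v)) => //.
    by rewrite e1; apply: eq_map => -[[[]]].
  by refine (gen _ _ _ _ _ e' _ _); case: e'.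
- by rewrite compat_starts uX.
- apply/setP => a; rewrite !inE !compat_starts in_wE; apply/andP/idP => [[h3 h4]|h].
    have := tag_arrows rep a; rewrite mem_cat => /orP[//|/(glued_notX rep)].
    by rewrite [_ \in X]h3 [_ \in X]h4.
  by split; apply: (ring_supp rg); [apply: ends1 | apply: ends2].
Qed.

(** Fullness says that the arrows of [w'] are all arrows of the code between its vertices, with
    multiplicity; this is the restriction in [ring_unique]. *)
Lemma code_cycle_unique (w' : seq (step Q)) : full_nonoriented_cycle w' ->
    walk_verts w' = walk_verts w :> {set T}.
Proof.
move=> fw; have rg' := cycle_ring fw; have [_ _ [us' uf'] /setP ai _] := fw.
apply/setP => x; rewrite walk_vertsE inE.
apply: (ring_unique uX rg bt) => [y _|]; first by case: rep.
apply: ring_perm rg'.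
apply/allP => p _ /=; apply/eqP; rewrite -/(code_arrows cs) /restr count_filter.
have [/andP[h1 h2]|h] := boolP ((p.1 \in map (@step_start _ _) w') &&
    (p.2 \in map (@step_start _ _) w')).
  rewrite (count_tags uf') => [|a ta].
    rewrite QE -surjective_pairing; apply: eq_count => q /=.
    by case: eqP => // ->; rewrite h1 h2.
  by have := ai a; rewrite !inE /src /tgt ta h1 h2 => <-.
rewrite (_ : count _ (code_arrows cs) = 0).
  apply/count_memPn; apply: contra h => /mapP [a aw ->].
  by have := ai a; rewrite !inE aw => ->.
apply/eqP; rewrite -leqn0 leqNgt -has_count; apply/hasPn => q _ /=.
by case: eqP => // ->; rewrite (negbTE h).
Qed.

End CodeCycle.

Lemma card_le_tags (T : finType) (Q : quiver T) (S : {set arrow Q}) (l : seq (T * T)) :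
  (forall a, a \in S -> tag a \in l) -> (forall a b, a \in S -> b \in S -> tag a = tag b ->
      a = b) ->
  #|S| <= size l.
Proof.
move=> h inj; rewrite cardE -(size_map tag); apply: uniq_leq_size.
  by rewrite map_inj_in_uniq ?enum_uniq // => a b; rewrite !mem_enum; apply: inj.
by move=> p /mapP [a]; rewrite mem_enum => aS ->; apply: h.
Qed.

Lemma card_tags (T : finType) (Q : quiver T) (S : {set arrow Q}) (l : seq (T * T)) : uniq l ->
  (forall a, a \in S -> tag a \in l) -> (forall a b, a \in S -> b \in S -> tag a = tag b ->
      a = b) ->
  (forall p, p \in l -> exists2 a, a \in S & tag a = p) -> #|S| = size l.
Proof.
move=> ul h inj ex; apply/eqP; rewrite eqn_leq card_le_tags //= cardE -(size_map tag).
by apply: uniq_leq_size => // p /ex [a aS <-]; apply: map_f; rewrite mem_enum.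
Qed.

Section CodePieces.
Variables (T : finType) (Q : quiver T) (cs : seq (cell T)).
Variables (w : seq (step Q)) (z : arrow Q -> option T).
Hypotheses (rep : code_rep Q cs) (hc : compat cs w z).
Local Notation X := (map (@cell_vertex T) cs).

Let vc : valid_code cs := let: And3 h _ _ := rep in h.
Let u : uniq (code_verts cs) := let: conj h _ := andP vc in h.
Let uX : uniq X := uniq_vertex u.
Let QE i j : Q i j = count_mem (i, j) (code_arrows cs) := let: And3 _ _ h := rep in h i j.
Let rg : ring X (code_ring cs) := ring_code vc.
Let bt : built X (code_ring cs) (code_verts cs) (code_glued cs) (code_tris cs) := code_built u.
Let WX x : (x \in walk_verts w) = (x \in X) := walk_vertsE hc x.

Lemma Q_pos p : p \in code_arrows cs -> 0 < Q p.1 p.2.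
Proof. by move=> h; rewrite QE -surjective_pairing -has_count has_pred1. Qed.

(** Only the two sides of the triangle at the root leave the tree, and they end on the cycle; so off
    the cycle the tree is closed under adjacency. Conversely each branch is connected to its
    root. *)
Lemma piece_glued E v b : E \in code_ecells cs -> E.2 = Some (v, b) ->
    piece w v =i v :: branch_verts b.
Proof.
move=> EE Eb x; rewrite inE; set R := (fun x y => [&& _, _ & _]).
have symR : symmetric R by move=> a c; rewrite /R /adjacent andbCA (orbC (0 < Q a c)).
have nX y : y \in v :: branch_verts b -> y \in ~: walk_verts w.
  by rewrite -(glued_verts_root Eb) => /(tree_notX rep EE); rewrite !inE (compat_starts hc).
apply/idP/idP => [h|].
  have cl : closed R [pred y | y \in v :: branch_verts b].
    apply: (intro_closed (sym_connect_sym symR)) => y y' /and3P[_ yX ad];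
        rewrite !inE -!(in_cons v) => hy.
    have : exists2 p, p \in code_arrows cs & [\/ p = (y, y') | p = (y', y)].
      case/orP: ad; rewrite QE -has_count has_pred1 => h1; by eexists; [exact: h1|]; auto.
    case=> p pc pe; have [X1 X2] := ecell_arrow_X rep EE.
    have yX' : y' \notin X by move: yX; rewrite !inE (compat_starts hc).
    have : (p.1 \in v :: branch_verts b) || (p.2 \in v :: branch_verts b) by case: pe => ->;
        rewrite /= hy ?orbT.
    case/(arrows_at_tree rep EE Eb pc) => [e|e|/[dup]/ends1/ends_branch h1 /ends2/ends_branch
        h2].
    - by case: pe e => -> [e1 e2]; [rewrite e2 mem_head | move: yX'; rewrite e1 X2].
    - by case: pe e => -> [e1 e2]; [move: yX'; rewrite e2 X1 | rewrite e1 mem_head].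
    - by case: pe h1 h2 => ->.
  by rewrite -[x \in _]/(x \in [pred y | y \in v :: branch_verts b]) -(closed_connect cl h)
      !inE eqxx.
have gen b' y : {subset y :: branch_verts b' <= v :: branch_verts b} ->
    {subset branch_arrows y b' <= branch_arrows v b} ->
    forall x, x \in y :: branch_verts b' -> connect R y x.
  have st p : p \in branch_arrows v b -> R p.1 p.2.
    move=> pb; have := ends_branch (ends1 pb); have := ends_branch (ends2 pb).
    move=> /nX h2 /nX h1; rewrite /R h1 h2 /= /adjacent Q_pos // mem_cat.
    by rewrite (branch_arrows_glued EE Eb pb) orbT.
  elim: b' y => [|d x' b1 IH|x' b1 IH1 y' b2 IH2] y s1 s2 x0.
  - by rewrite /= inE => /eqP->; apply: connect0.
  - rewrite /= inE; case/orP=> [/eqP->|hx]; first exact: connect0.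
    apply: (@connect_trans _ _ x').
      have := st _ (s2 _ (mem_head _ _)); case: (d) => /= h; apply: connect1 => //.
      by rewrite symR.
    apply: IH => // [a ha|a ha]; [apply: s1 | apply: s2]; by rewrite /= inE ha orbT.
  - rewrite /= !inE mem_cat => hx.
    have c1 : connect R y x'.
      by apply: connect1; apply: (st (y, x')); apply: s2; rewrite /= !inE eqxx !orbT.
    have c2 : connect R y y'.
      by apply: connect1; rewrite symR; apply: (st (y', y)); apply: s2;
          rewrite /= !inE eqxx !orbT.
    case/or4P: hx => [/eqP->|/eqP->|/eqP->|/orP[hx|hx]] //.
    + apply: connect_trans c1 (IH1 _ _ _ _ _); last by rewrite inE hx orbT.
        by move=> a; rewrite inE => /orP[/eqP->|ha]; apply: s1;
            rewrite /= !inE ?eqxx ?mem_cat ?ha ?orbT.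
      by move=> a ha; apply: s2; rewrite /= !inE mem_cat ha !orbT.
    + apply: connect_trans c2 (IH2 _ _ _ _ _); last by rewrite inE hx orbT.
        by move=> a; rewrite inE => /orP[/eqP->|ha]; apply: s1;
            rewrite /= !inE ?eqxx ?mem_cat ?ha ?orbT.
      by move=> a ha; apply: s2; rewrite /= !inE mem_cat ha !orbT.
by apply: gen.
Qed.

Lemma arrows_pieceE E v b (a : arrow Q) : E \in code_ecells cs -> E.2 = Some (v, b) ->
  (a \in arrows_in Q (piece w v)) = (tag a \in branch_arrows v b).
Proof.
move=> EE Eb; rewrite inE !(piece_glued EE Eb); apply/andP/idP => [[h1 h2]|h].
  by apply: (arrows_in_tree rep EE Eb) => //; apply: (tag_arrows rep).
by split; apply: ends_branch; [apply: ends1 | apply: ends2].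
Qed.

Lemma piece_arrow_unique E v b (a a' : arrow Q) : E \in code_ecells cs -> E.2 = Some (v, b) ->
  tag a \in branch_arrows v b -> tag a = tag a' -> a = a'.
Proof. by move=> EE Eb h e; apply: (glued_arrow_unique rep) => //;
    apply: (branch_arrows_glued EE Eb). Qed.

Lemma code_incident (b : arrow Q) : (src b \in walk_verts w) || (tgt b \in walk_verts w) ->
    b \in map fst w \/
    exists a v, z a = Some v /\
      ((src b = tgt a /\ tgt b = v) \/ (src b = v /\ tgt b = src a)).
Proof.
rewrite !WX => h; have := tag_arrows rep b; rewrite mem_cat => /orP[|/mem_gluedP [E EE be]].
  by rewrite -(in_wE rep hc); left.
right; have [v [c [Eb cc]]] := ecell_gluedP EE be; have [a [_ _ ta za]] := cell_z hc EE Eb.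
exists a, v; split=> //; rewrite /src /tgt ta.
case: cc h => [->|->|/[dup]/ends1/ends_branch h1 /ends2/ends_branch h2]; [by left | by right |].
by move: h1 h2; rewrite /src /tgt -(glued_verts_root Eb) => /(tree_notX rep EE) /negbTE->
    /(tree_notX rep EE) /negbTE->.
Qed.

Lemma branch_root_arrows (v : T) b p : uniq (v :: branch_verts b) ->
    p \in branch_arrows v b -> (p.1 == v) || (p.2 == v) ->
  match b with
  | Nil => False
  | Ar d x _ => p = ori d v x
  | Tr x _ y _ => p \in [:: (y, v); (v, x)]
  end.
Proof.
case: b => //= [d x b|x b y c] uv.
  rewrite inE => /orP[/eqP //|h1 h2].
  have /andP[vn _] := uv.
  have /ends_branch : v \in ends (branch_arrows x b) by apply/endsP; exists p.
  by rewrite (negbTE vn).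
rewrite !inE mem_cat; have /andP[+ _] := uv; rewrite !inE mem_cat !negb_or =>
    /and4P[vx vy vb vc'].
case/or4P => [/eqP->|->|->|/orP[h1|h1]] h2; rewrite ?orbT //.
- by move: h2; rewrite /= !(eq_sym _ v) (negbTE vx) (negbTE vy).
- have /ends_branch : v \in ends (branch_arrows x b) by apply/endsP; exists p.
  by rewrite inE (negbTE vx) (negbTE vb).
- have /ends_branch : v \in ends (branch_arrows y c) by apply/endsP; exists p.
  by rewrite inE (negbTE vy) (negbTE vc').
Qed.

Lemma tree_uniq E v b : E \in code_ecells cs -> E.2 = Some (v, b) -> uniq (v :: branch_verts b).
Proof.
move=> EE Eb; have := uniq_trees rep; rewrite cat_uniq => /and3P[h _ _].
by have := uniq_flatten_each h EE; rewrite (glued_verts_root Eb).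
Qed.

(* The arrow set of a triangle; for the triangle at an arrow of the
   non-oriented cycle, only the arrow that owns its vertex is taken. *)
Definition tri_arrows (t : T * T * T) : {set arrow Q} :=
  [set b | (tag b \in tri_pairs t) && ((b \in map fst w) ==> (z b == Some t.2))].

Lemma code_tri_cell t : t \in code_tris cs -> exists E v b, [/\ E \in code_ecells cs,
    E.2 = Some (v, b), t \in ecell_tris E &
  (t = (ecell_arrow E, v)) \/ (t \in branch_tris v b)].
Proof.
case/flattenP => [_ /mapP [E EE ->] tE]; move: (tE).
case: E EE tE => [[[x y] d] [[v b]|]] // EE tE; rewrite /ecell_tris !inE => h.
exists (x, y, d, Some (v, b)), v, b; split=> //.
by case/orP: h => [/eqP->|h]; [left | right].
Qed.

Lemma branch_tris_arrows (v : T) b t p : t \in branch_tris v b -> p \in tri_pairs t ->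
    p \in branch_arrows v b.
Proof.
move=> tb pt; rewrite (perm_mem (perm_branch v b)) mem_cat; apply/orP; right.
by apply/flattenP; exists (tri_pairs t) => //; apply: map_f.
Qed.

Lemma code_tri_arrows p q r : (p, q, r) \in code_tris cs ->
  [/\ (p, q) \in code_arrows cs, (q, r) \in code_glued cs, (r,
      p) \in code_glued cs & r \notin X].
Proof. by apply: (built_TL _ _ bt); [exact: uX | exact: (ring_supp rg)]. Qed.

Lemma glued_notw (a : arrow Q) : tag a \in code_glued cs -> a \notin map fst w.
Proof. by move=> h; rewrite (in_wE rep hc); apply: (glued_notin_ring rep). Qed.

Lemma tri_arrows_ex t p : t \in code_tris cs -> p \in tri_pairs t ->
    exists2 a, a \in tri_arrows t & tag a = p.
Proof.
case: t => [[x y] v] tc pt.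
have [h1 h2 h3 vX] := code_tri_arrows tc.
have key q : q \in tri_pairs (x, y, v) -> q \in code_glued cs ->
    exists2 a, a \in tri_arrows (x, y, v) & tag a = q.
  move=> qt qc; have [a ta] := glued_arrow rep qc; exists a => //.
  by rewrite inE ta qt (negbTE (glued_notw _)) // ta.
have := pt; rewrite /= !inE => /or3P[]/eqP e; subst p; last first.
- exact: key.
- exact: key.
have [E [v' [b [EE Eb tE [te|tb]]]]] := code_tri_cell tc.
  move: te => [te1 te2]; subst v'.
  have [a [_ aw ta za]] := cell_z hc EE Eb; exists a; last by rewrite ta te1.
  by rewrite inE ta -te1 pt za eqxx implybT.
by apply: key => //; apply: (branch_arrows_glued EE Eb); apply: branch_tris_arrows tb _.
Qed.

(** Glued arrows are single, and among parallel arrows of the cycle the injective map [z] singles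
    out the one that owns the apex. *)
Lemma tri_arrows_uniq t a b : t \in code_tris cs -> a \in tri_arrows t ->
    b \in tri_arrows t -> tag a = tag b -> a = b.
Proof.
move=> tc; rewrite !inE => /andP[_ ha] /andP[_ hb] e.
have := tag_arrows rep a; rewrite mem_cat => /orP[ar|ad]; last exact: (glued_arrow_unique rep).
have aw : a \in map fst w by rewrite (in_wE rep hc).
have bw : b \in map fst w by rewrite (in_wE rep hc) -e.
move: ha hb; rewrite aw bw => /eqP za /eqP zb.
exact: (z_inj rep hc za zb).
Qed.

Lemma tri_arrows_set t (a b c : arrow Q) : t \in code_tris cs -> a \in tri_arrows t ->
    b \in tri_arrows t -> c \in tri_arrows t ->
  tag a = t.1 -> tag b = (t.1.2, t.2) -> tag c = (t.2, t.1.1) -> tri_arrows t = [set a; b; c].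
Proof.
move=> tc aD bD cD ta tb tc'; apply/setP => e; rewrite !inE; apply/idP/idP => [h|]; last first.
  by case/orP => [/orP[]|] /eqP->; [move: aD | move: bD | move: cD]; rewrite inE.
have eD : e \in tri_arrows t by rewrite inE.
move: (h) => /andP[+ _]; case: t tc aD bD cD ta tb tc' {h} eD =>
    [[p q] r] tc aD bD cD /= ta tb tc' eD.
rewrite -ta -tb -tc' !inE => /or3P[]/eqP te.
- by rewrite (tri_arrows_uniq tc eD aD te) eqxx.
- by rewrite (tri_arrows_uniq tc eD bD te) eqxx orbT.
- by rewrite (tri_arrows_uniq tc eD cD te) eqxx !orbT.
Qed.

Lemma tri_arrows_set3 t : t \in code_tris cs -> exists a b c : arrow Q,
  [/\ tag a = t.1, tag b = (t.1.2, t.2), tag c = (t.2, t.1.1) & tri_arrows t = [set a; b; c]].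
Proof.
move=> tc; have ex p := @tri_arrows_ex t p tc.
have [a aD ta] : exists2 a, a \in tri_arrows t & tag a = t.1.
  by apply: ex; case: (t) => [[p q] r]; rewrite /= !inE eqxx.
have [b bD tb] : exists2 a, a \in tri_arrows t & tag a = (t.1.2, t.2).
  by apply: ex; case: (t) => [[p q] r]; rewrite /= !inE eqxx orbT.
have [c cD tc'] : exists2 a, a \in tri_arrows t & tag a = (t.2, t.1.1).
  by apply: ex; case: (t) => [[p q] r]; rewrite /= !inE eqxx !orbT.
by exists a, b, c; split=> //; apply: tri_arrows_set.
Qed.

Lemma tri_arrows_oriented t : t \in code_tris cs -> oriented_3cycle (tri_arrows t).
Proof.
move=> /tri_arrows_set3 [a [b [c [ta tb tc ->]]]].
apply/existsP; exists a; apply/existsP; exists b; apply/existsP; exists c.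
by rewrite /src /tgt ta tb tc /= !eqxx.
Qed.

Lemma tri_arrows_chosen t : t \in code_tris cs -> chosen_3cycle w z (tri_arrows t).
Proof.
move=> tc; rewrite /chosen_3cycle tri_arrows_oriented //=; apply/forallP => a;
    apply/implyP => aD.
apply/implyP => aw; move: aD; rewrite inE aw => /andP[_ /eqP->].
have [a1 [b1 [c [_ _ tc' De]]]] := tri_arrows_set3 tc.
by apply/existsP; exists c; rewrite De !inE eqxx orbT /= /src tc' eqxx.
Qed.

Lemma chosen_tri_arrows D : chosen_3cycle w z D -> exists2 t,
    t \in code_tris cs & D = tri_arrows t.
Proof.
case/andP=> /existsP [a /existsP [b /existsP [c /and4P[/eqP ab /eqP bc /eqP ca' /eqP De]]]] ch.
have ta : tag a = (src a, src b) by rewrite -ab -surjective_pairing.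
have tb : tag b = (src b, src c) by rewrite -bc -surjective_pairing.
have tc : tag c = (src c, src a) by rewrite -ca' -surjective_pairing.
have key (a1 b1 c1 : arrow Q) p q r : tag a1 = (p, q) -> tag b1 = (q, r) -> tag c1 = (r, p) ->
    (p, q, r) \in code_tris cs -> D = [set a1; b1; c1] -> D = tri_arrows (p, q, r).
  move=> {}ta {}tb {}tc t3 {}De; have [_ h2 h3 rX] := code_tri_arrows t3.
  rewrite De; symmetry; apply: tri_arrows_set => //.
  - rewrite inE ta /= mem_head /=; apply/implyP => aw.
    have aD : a1 \in D by rewrite De !inE eqxx.
    (* Some arrow of the 3-cycle starts at the vertex attached to [a1]. This vertex is off the
       cycle, whereas [p] and [q] are on it, so it is the apex [r]. *)
    have := forallP ch a1; rewrite aD aw => /existsP [e /andP[eD /eqP ze]].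
    have [x [y [d [b' [EE _ _ _]]]]] := z_cell hc ze.
    have := tree_notX rep EE (mem_head _ _).
    have := w_ring hc aw; rewrite ta => /[dup] /ends1/(ring_supp rg)/= pX /ends2/(ring_supp
        rg)/= qX.
    move: eD ze; rewrite De !inE => /orP[/orP[]|] /eqP->; rewrite /src ?ta ?tb ?tc /= => ->.
    + by rewrite pX.
    + by rewrite qX.
    + by rewrite eqxx.
  - by rewrite inE tb !inE eqxx orbT /= (negbTE (glued_notw _)) // tb.
  - by rewrite inE tc !inE eqxx !orbT /= (negbTE (glued_notw _)) // tc.
have := tag_arrows rep a; have := tag_arrows rep b; have := tag_arrows rep c;
    rewrite ta tb tc => mc mb ma.
have no2 p q : (p, q) \in code_ring cs -> (q, p) \notin code_ring cs by apply:
    ring_no_2cycle rg.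
have no3 p q r : (p, q) \in code_ring cs -> (q, r) \in code_ring cs ->
    (r, p) \notin code_ring cs.
  by apply: ring_no_3cycle rg.
have := built_3cycle uX (ring_supp rg) no2 no3 bt ma mb mc.
(* The recorded triangle may start at any of the three vertices; the set [D] is the same for all
   rotations. *)
case/or3P => t3.
- by exists (src a, src b, src c) => //; apply: key De.
- exists (src b, src c, src a) => //; apply: (key b c a) => //.
  by rewrite De; apply/setP => e; rewrite !inE; case: (e == a); case: (e == b); case: (e == c).
- exists (src c, src a, src b) => //; apply: (key c a b) => //.
  by rewrite De; apply/setP => e; rewrite !inE; case: (e == a); case: (e == b); case: (e == c).
Qed.

Lemma code_drawing : drawing w z.
Proof.
split.
- exact: code_nonoriented rep hc.
- exact: code_cycle_unique rep hc.
- move=> a v za; have [x [y [d [b [EE ta ad aw]]]]] := z_cell hc za; split=> //.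
  + by rewrite WX; apply: (tree_notX rep EE); rewrite mem_head.
  + apply: (Q_glued rep (p := (tgt a, v))); apply/mem_gluedP;
      exists (x, y, d, Some (v, b)) => //.
    by rewrite /ecell_glued /tgt ta mem_head.
  + apply: (Q_glued rep (p := (v, src a))); apply/mem_gluedP;
      exists (x, y, d, Some (v, b)) => //.
    by rewrite /ecell_glued /src ta !inE eqxx orbT.
- exact: code_incident.
- move=> x; rewrite WX => xX; have : x \in code_verts cs by case: rep.
  rewrite (perm_mem (perm_verts cs)) mem_cat (negbTE xX) -ecells_glued =>
      /flattenP [_ /mapP [E EE ->]].
  case Eb : E.2 => [[v b]|] //= xE; have [a [_ _ _ za]] := cell_z hc EE Eb.
  by exists a, v; rewrite (piece_glued EE Eb).
- move=> a b v v' za zb; have [x [y [d [c [EE _ _ _]]]]] := z_cell hc za.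
  have [x' [y' [d' [c' [EE' _ _ _]]]]] := z_cell hc zb.
  rewrite (piece_glued EE erefl) => h.
  have [_ _ _ e _] := tree_root_inj rep EE EE' erefl erefl h (mem_head _ _).
  by subst v'; apply: (z_inj rep hc za zb).
- move=> a v za; have [x [y [d [b [EE _ _ _]]]]] := z_cell hc za.
  have pE := piece_glued EE erefl.
  exists (size (v :: branch_verts b)) => //; apply: (@tree_rep_type_A _ _ val); split.
  + exact: val_inj.
  + by rewrite /tree_verts /=; apply: (tree_uniq EE erefl).
  + move=> l; rewrite -[l \in tree_verts _]/(l \in v :: branch_verts b) -pE;
      apply/codomP/idP => [[[m mP] ->] //|lP].
    by exists (exist _ l lP).
  + by move=> [i iP] [j jP]; rewrite /= /sub_narr /tree_arrows /= (count_tree rep EE erefl)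
      -?pE.
- move=> a v za; have [x [y [d [b [EE _ _ _]]]]] := z_cell hc za.
  have uv := tree_uniq EE erefl.
  set S := [set _ in _ | _].
  have SP c : c \in S -> tag c \in branch_arrows v b /\ ((tag c).1 == v) || ((tag c).2 == v).
    by rewrite inE (arrows_pieceE _ EE erefl) => /andP.
  have inj c c' : c \in S -> c' \in S -> tag c = tag c' -> c = c'.
    by move=> /SP [h _] _; apply: (piece_arrow_unique EE erefl).
  have [l lS ls] : exists2 l : seq (T * T), (forall c, c \in S -> tag c \in l) & size l <= 2.
    have aux c (cS : c \in S) := branch_root_arrows uv (SP c cS).1 (SP c cS).2.
    case: (b) aux => [|d' x' b1|x' b1 y' b2] aux.
    - by exists [::] => // c /aux.
    - by exists [:: ori d' v x'] => // c /aux ->; rewrite mem_head.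
    - by exists [:: (y', v); (v, x')].
  exact: leq_trans (card_le_tags lS inj) ls.
- move=> a v za; have [x [y [d [b [EE _ _ _]]]]] := z_cell hc za.
  have uv := tree_uniq EE erefl.
  set S := [set _ in _ | _].
  have SP c : c \in S -> tag c \in branch_arrows v b /\ ((tag c).1 == v) || ((tag c).2 == v).
    by rewrite inE (arrows_pieceE _ EE erefl) => /andP.
  have inj c c' : c \in S -> c' \in S -> tag c = tag c' -> c = c'.
    by move=> /SP [h _] _; apply: (piece_arrow_unique EE erefl).
  have aux c (cS : c \in S) := branch_root_arrows uv (SP c cS).1 (SP c cS).2.
  (* An empty branch or a single arrow leaves at most one arrow at the root, so valency two forces a
     triangle. *)
  case: b EE uv SP aux => [|d' x' b1|x' b1 y' b2] EE uv SP aux S2.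
  + have l0 c : c \in S -> tag c \in [::] by move=> /aux.
    by have := card_le_tags l0 inj; rewrite S2.
  + have l1 c : c \in S -> tag c \in [:: ori d' v x'] by move=> /aux ->; rewrite mem_head.
    by have := card_le_tags l1 inj; rewrite S2.
  + have t3 : (v, x', y') \in code_tris cs.
      apply/flattenP; exists (ecell_tris (x, y, d, Some (v, Tr x' b1 y' b2)));
          first exact: map_f.
      by rewrite /ecell_tris !inE eqxx orbT.
    exists (tri_arrows (v, x', y')); split; first exact: tri_arrows_oriented.
      apply/subsetP => c; rewrite (arrows_pieceE _ EE erefl) inE => /andP[+ _].
      by apply: branch_tris_arrows; rewrite /= mem_head.
    have [c [c2 [c3 [tc _ _ ->]]]] := tri_arrows_set3 t3.
    by exists c; rewrite ?inE ?eqxx // /src tc.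
Qed.

End CodePieces.

(** * Parameters of a code *)

Section CodeParams.
Variables (T : finType) (Q : quiver T) (cs : seq (cell T)).
Variables (w : seq (step Q)) (z : arrow Q -> option T).
Hypotheses (rep : code_rep Q cs) (hc : compat cs w z).
Local Notation X := (map (@cell_vertex T) cs).

Let vc : valid_code cs := let: And3 h _ _ := rep in h.
Let u : uniq (code_verts cs) := let: conj h _ := andP vc in h.
Let uX : uniq X := uniq_vertex u.
Let rg : ring X (code_ring cs) := ring_code vc.
Let bt : built X (code_ring cs) (code_verts cs) (code_glued cs) (code_tris cs) := code_built u.

Let uE : uniq (code_ecells cs).
Proof. by apply: (map_uniq (f := fun E : ecell T => E.1.1.1)); rewrite map_ecells_vertex. Qed.

Lemma apex_tree E t : E \in code_ecells cs -> t \in ecell_tris E ->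
    exists v b, E.2 = Some (v, b) /\ t.2 \in v :: branch_verts b.
Proof.
case: E => [[[x y] d] [[v b]|]] // EE; rewrite /ecell_tris inE => /orP[/eqP->|tb];
    exists v, b; split=> //.
  by rewrite mem_head.
case: t tb => [[p q] r] tb; have := branch_tris_arrows tb (p := (q, r));
    rewrite /= !inE eqxx orbT => /(_ isT).
by move=> /ends2/ends_branch; rewrite !inE.
Qed.

(** The arrow set forgets which vertex is the apex, but equal sets put each apex on the other
    triangle, which suffices by [built_TL_uniq]. *)
Lemma code_tri_inj t t' : t \in code_tris cs -> t' \in code_tris cs ->
    tri_arrows w z t = tri_arrows w z t' -> t = t'.
Proof.
have aux s s' : s \in code_tris cs -> s' \in code_tris cs ->
    tri_arrows w z s = tri_arrows w z s' -> s.2 \in [:: s'.1.1; s'.1.2; s'.2].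
  move=> sc sc' e; have [|a aD ta] := tri_arrows_ex rep hc (t := s) (p := (s.1.2, s.2)) sc.
    by case: (s) => [[p q] r]; rewrite /= !inE eqxx orbT.
  have : tag a \in tri_pairs s' by move: aD; rewrite e inE => /andP[].
  rewrite ta; case: (s') => [[p q] r] /=; rewrite !inE !xpair_eqE.
  by case/or3P => /andP[_ /eqP->]; rewrite eqxx ?orbT.
have [_ _ inj] := built_TL_uniq uX (ring_supp rg) bt.
by move=> tc tc' e; apply: inj => //; apply: aux.
Qed.

(** The apex lies in the tree of exactly one cell, and [z] assigns the root of that tree to exactly
    one arrow of the cycle; its direction is the only one that can occur. *)
Lemma ecell_tri_dir E t d : E \in code_ecells cs -> t \in ecell_tris E ->
  [exists a in tri_arrows w z t, (a, d) \in w] || [exists a,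
      in_piece_of w z d a (tri_arrows w z t)] = (E.1.2 == d).
Proof.
move=> EE tE; have tc : t \in code_tris cs by apply/flattenP; exists (ecell_tris E) => //;
    apply: map_f.
have [v [b [Eb tv]]] := apex_tree EE tE.
have [a0 [a0w a0w' ta0 za0]] := cell_z hc EE Eb.
have dirE (a : arrow Q) x y d' b' v' : (x, y, d', Some (v', b')) \in code_ecells cs ->
    t.2 \in v' :: branch_verts b' ->
    z a = Some v' -> (a, d) \in w -> E.1.2 == d.
  move=> EE' tv' za aw; have e := tree_root_inj rep EE EE' Eb erefl tv tv'.
  move: Eb; rewrite e => -[e1 _]; subst v'; have ea := z_inj rep hc za za0; subst a.
  by have [<-] := w_arrow_inj hc a0w aw erefl; rewrite e.
apply/idP/idP => [/orP[/existsP [a /andP[aD aw]]|/existsP [a /andP[aw]]]|/eqP <-].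
- have aw' : a \in map fst w by apply: (map_f fst aw).
  move: aD; rewrite inE aw' => /andP[_ /eqP za].
  have [x [y [d' [b' [EE' _ _ _]]]]] := z_cell hc za.
  by apply: (dirE a _ _ _ _ _ EE') za aw; rewrite mem_head.
- case za : (z a) => [v'|] // sub.
  have [x [y [d' [b' [EE' _ _ _]]]]] := z_cell hc za.
  apply: (dirE a _ _ _ _ _ EE') za aw.
  have [a1 [b1 [c1 [_ tb1 _ De]]]] := tri_arrows_set3 rep hc tc.
  have : b1 \in tri_arrows w z t by rewrite De !inE eqxx orbT.
  by move/(subsetP sub); rewrite (arrows_pieceE rep hc _ EE' erefl) tb1 => /ends2/ends_branch.
- move: tE; case: E EE Eb a0w ta0 {dirE} => [[[x y] d'] o] /= EE Eb a0w ta0; subst o.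
  rewrite /ecell_tris inE => /orP[/eqP te|tb].
    apply/orP; left; apply/existsP; exists a0; rewrite a0w andbT inE a0w' za0 te /= eqxx andbT
        ta0.
    by rewrite /ecell_arrow; case: (ori _ _ _) => p q; rewrite inE eqxx.
  apply/orP; right; apply/existsP; exists a0; rewrite /in_piece_of a0w za0 /=.
  apply/subsetP => c; rewrite inE => /andP[ct _].
  by rewrite (arrows_pieceE rep hc _ EE (erefl (Some (v, b)))); apply: branch_tris_arrows tb ct.
Qed.

Lemma sum_cells (F : cell T -> nat) (G : ecell T -> nat) d :
  (forall x y d' o, G (x, y, d', o) = F (x, d', o)) ->
  sumn [seq G E | E <- code_ecells cs & E.1.2 == d] = sumn [seq F c | c <- cs & cell_dir c ==
      d].
Proof.
move=> h; rewrite /code_ecells; case: cs => // c0 s; move: (cell_vertex c0) => e.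
by elim: (c0 :: s) => //= -[[x d'] o] s' IH; rewrite /cell_dir /=; case: eqP => _ //=;
    rewrite IH h.
Qed.

Lemma size_flatten_map (A B : Type) (F : A -> seq B) s : size (flatten (map F s)) = sumn [seq
    size (F x) | x <- s].
Proof. by rewrite size_flatten /shape -map_comp. Qed.

Lemma code_num_3cycles d : num_3cycles w z d = ptri d cs.
Proof.
pose l := flatten (map (@ecell_tris T) [seq E <- code_ecells cs | E.1.2 == d]).
have lP t : reflect (exists E, [/\ E \in code_ecells cs, E.1.2 == d & t \in ecell_tris E]) (t
    \in l).
  apply: (iffP flattenP) => [[_ /mapP [E + ->] tE]|[E [EE Ed tE]]].
    by rewrite mem_filter => /andP[h1 h2]; exists E.
  by exists (ecell_tris E) => //; apply: map_f; rewrite mem_filter Ed.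
have lc t : t \in l -> t \in code_tris cs.
  by move=> /lP [E [EE _ tE]]; apply/flattenP; exists (ecell_tris E) => //; apply: map_f.
have [_ uTL _] := built_TL_uniq uX (ring_supp rg) bt.
have ul : uniq l.
  apply: flatten_uniq; first exact: filter_uniq.
    by move=> E; rewrite mem_filter => /andP[_ EE]; apply: (uniq_flatten_each (F :=
        @ecell_tris T) uTL EE).
  move=> E E' t; rewrite !mem_filter => /andP[_ EE] /andP[_ EE'] tE tE'.
  exact: (@uniq_flatten_inj _ _ (@ecell_tris T) (code_ecells cs) _ _ t).
rewrite /num_3cycles (_ : [set _ | _] = [set tri_arrows w z t | t in [set t in l]]).
  rewrite card_in_imset => [|t t']; last by rewrite !inE => /lc tc /lc tc'; apply: code_tri_inj.
  rewrite cardsE (card_uniqP ul) size_flatten_map; apply: sum_cells.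
  by move=> x y d' [[v b]|].
apply/setP => D; rewrite inE; apply/andP/imsetP => [[/(chosen_tri_arrows rep hc) [t tc ->]]|[t
    + ->]].
  have /flattenP [_ /mapP [E EE ->] tE] := tc.
  by rewrite (ecell_tri_dir d EE tE) => Ed; exists t => //; rewrite inE; apply/lP; exists E.
rewrite inE => tl; have /lP [E [EE Ed tE]] := tl; split; last by rewrite (ecell_tri_dir d EE
    tE).
exact: (tri_arrows_chosen rep hc (lc _ tl)).
Qed.

(** Taking endpoints is a bijection from the counted arrows onto the free pairs of the cells of
    direction [d]. *)
Lemma code_num_arrows d : num_arrows w z d = pfree d cs.
Proof.
pose l := flatten (map (@ecell_free T) [seq E <- code_ecells cs | E.1.2 == d]).
have lP p : reflect (exists E, [/\ E \in code_ecells cs, E.1.2 == d & p \in ecell_free E]) (p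
    \in l).
  apply: (iffP flattenP) => [[_ /mapP [E + ->] tE]|[E [EE Ed tE]]].
    by rewrite mem_filter => /andP[h1 h2]; exists E.
  by exists (ecell_free E) => //; apply: map_f; rewrite mem_filter Ed.
have ub E v b : E \in code_ecells cs -> E.2 = Some (v, b) -> uniq (branch_arrows v b).
  move=> EE Eb; have ud : uniq (flatten (map (@ecell_glued T) (code_ecells cs))).
    by have [_ _ _ + _] := built_basic bt uX (ring_supp rg).
  have := uniq_flatten_each ud EE; case: E EE Eb => [[[x y] d'] o] _ /= ->.
  by rewrite /ecell_glued /= => /and3P[].
have fb (v : T) b p : p \in branch_free v b -> p \in branch_arrows v b by rewrite (perm_mem
    (perm_branch v b)) mem_cat => ->.
have efP E p : E \in code_ecells cs -> p \in ecell_free E ->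
    (E.2 = None /\ p = ecell_arrow E) \/
    exists v b, E.2 = Some (v, b) /\ p \in branch_free v b.
  move=> _; case: E => [[[x y] d'] [[v b]|]]; rewrite /ecell_free /= ?inE; first by right;
      exists v, b.
  by move/eqP=> ->; left.
have ul : uniq l.
  apply: flatten_uniq; first exact: filter_uniq.
    move=> E; rewrite mem_filter => /andP[_ EE]; case: E EE => [[[x y] d'] [[v b]|]] // EE.
    by have := ub _ _ _ EE erefl; rewrite (perm_uniq (perm_branch v b)) cat_uniq => /and3P[].
  move=> E E' p; rewrite !mem_filter => /andP[/eqP Ed EE] /andP[/eqP Ed' EE'].
  have dis E1 E2 v b : E1 \in code_ecells cs -> E2 \in code_ecells cs -> E1.2 = Some (v, b) ->
      ecell_arrow E2 \in branch_free v b -> False.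
    move=> h1 h2 Eb /fb /(branch_arrows_glued h1 Eb) /(glued_notin_ring rep).
    by move/negP; apply; apply: map_f.
  case/(efP _ _ EE) => [[En ep]|[v [b [Eb pb]]]]; case/(efP _ _ EE') =>
      [[En' ep']|[v' [b' [Eb' pb']]]].
  - apply: (ecells_start_inj rep) => //; move: ep'; rewrite ep.
    case: E E' Ed Ed' {En En' ep EE EE'} => [[[x y] d1] o] [[[x' y'] d2] o'] /= -> ->.
    by rewrite /ecell_arrow; case: (d) => -[].
  - by case: (dis E' E v' b'); rewrite -?ep.
  - by case: (dis E E' v b); rewrite -?ep'.
  - have := ends_branch (ends1 (fb _ _ _ pb)); have := ends_branch (ends1 (fb _ _ _ pb')) =>
      h1 h2.
    exact: (tree_root_inj rep EE EE' Eb Eb' h2 h1).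
rewrite /num_arrows; set S := [set _ | _].
have Sfree (a : arrow Q) t : a \in S -> t \in code_tris cs -> a \notin tri_arrows w z t.
  rewrite inE => /andP[/forallP h _] tc; have := h (tri_arrows w z t).
  by rewrite (tri_arrows_chosen rep hc tc).
have SP a : a \in S -> ((a, d) \in w) \/ exists E v b, [/\ E \in code_ecells cs, E.1.2 = d,
    E.2 = Some (v, b) & tag a \in branch_arrows v b].
  rewrite inE => /andP[_ /orP[]]; first by left.
  case/existsP => c /andP[cw]; case zc : (z c) => [v|] // sub; right.
  have [x [y [d' [b [EE tc cw' _]]]]] := z_cell hc zc.
  exists (x, y, d', Some (v, b)), v, b; split=> //=; first by have [] :=
      w_arrow_inj hc cw cw' erefl.
  by rewrite -(arrows_pieceE rep hc a EE erefl); apply: (subsetP sub); rewrite inE.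
have Sl a : a \in S -> tag a \in l.
  move=> aS; apply/lP; case: (SP a aS) => [aw|[E [v [b [EE Ed Eb ab]]]]].
    have [E EE [/= e1 e2 e3 _]] := step_cell hc aw; exists E; split=> //; first by rewrite e2.
    rewrite e1; case: E EE e1 e2 e3 => [[[x y] d'] [[v b]|]] EE e1 e2 e3;
        last by rewrite /ecell_free /= inE.
    (* A cycle arrow with a glued tree lies on its own chosen triangle, so it is not counted. *)
    have tc : (ori d' x y, v) \in code_tris cs.
      by apply/flattenP; exists (ecell_tris (x, y, d', Some (v, b)));
          [apply: map_f | rewrite /ecell_tris mem_head].
    have := Sfree a _ aS tc; rewrite inE e3 e1 /= eqxx implybT andbT /ecell_arrow.
    by case: (ori _ _ _) => p q; rewrite inE eqxx.
  exists E; split; rewrite ?Ed //.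
  move: ab; rewrite (perm_mem (perm_branch v b)) mem_cat =>
      /orP[h|/flattenP [_ /mapP [t tb ->] at_]].
    by case: (E) Eb => [[[x y] d'] o] /= ->.
  have tc : t \in code_tris cs.
    apply/flattenP; exists (ecell_tris E); first exact: map_f.
    by case: (E) Eb => [[[x y] d'] o] /= ->; rewrite /ecell_tris inE tb orbT.
  have := Sfree a _ aS tc; rewrite inE at_ (negbTE (glued_notw rep hc _)) //.
  by apply: (branch_arrows_glued EE Eb); apply: branch_tris_arrows tb at_.
rewrite (card_tags ul Sl).
- by rewrite size_flatten_map; apply: sum_cells => x y d' [[v b]|].
- move=> a b aS bS e.
  have cu (c c' : arrow Q) E v br : E \in code_ecells cs -> E.2 = Some (v, br) ->
      tag c \in branch_arrows v br -> tag c = tag c' -> c = c'.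
    by move=> EE Eb h; apply: (piece_arrow_unique rep EE Eb h).
  case: (SP a aS) => [aw|[E [v [br [EE _ Eb ab]]]]]; last exact: cu EE Eb ab e.
  case: (SP b bS) => [bw|[E [v [br [EE _ Eb ab]]]]]; last by symmetry;
      apply: cu EE Eb ab (esym e).
  (* Two cycle arrows with equal endpoints and the same direction start at the same vertex of the
     walk, hence agree; the arrows of a double arrow differ in direction. *)
  have := w_start_inj rep hc aw bw; rewrite /step_start /src /tgt /= e => /(_ erefl) e'.
  exact: (congr1 (fun s : step Q => s.1) e').
- move=> p /lP [E [EE /eqP Ed pE]].
  case: (efP _ _ EE pE) => [[En ep]|[v [b [Eb pb]]]].
    have [[a d'] aw [/= e1 e2 e3 _]] := cell_step hc EE; exists a; last by rewrite e1 ep.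
    move: e3; rewrite En /= => za; rewrite e2 Ed in aw; rewrite inE aw andbT.
    apply/forallP => D; apply/implyP => /(chosen_tri_arrows rep hc) [t tc ->].
    by rewrite inE (map_f fst aw) za andbF.
  have pd : p \in code_glued cs by apply: (branch_arrows_glued EE Eb); apply: fb.
  have [a ta] := glued_arrow rep pd; exists a => //.
  rewrite inE; apply/andP; split; last first.
    apply/orP; right; have [c [cw _ tc zc]] := cell_z hc EE Eb; apply/existsP; exists c.
    rewrite /in_piece_of -{1}Ed cw zc /=; apply/subsetP => a'; rewrite inE => /eqP->.
    by rewrite (arrows_pieceE rep hc _ EE Eb) ta; apply: fb.
  apply/forallP => D; apply/implyP => /(chosen_tri_arrows rep hc) [t tc ->].
  rewrite inE ta negb_and; apply/orP; left; apply/negP => pt.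
  have [E' [v' [b' [EE' Eb' tE' [te|tb']]]]] := code_tri_cell tc.
    have h1 := ends_branch (ends1 (fb _ _ _ pb)); have h2 := ends_branch (ends2 (fb _ _ _ pb)).
    move: h1 h2; rewrite -(glued_verts_root Eb) => /(tree_notX rep EE) h1 /(tree_notX rep EE)
        h2.
    have [X1 X2] := ecell_arrow_X rep EE'; move: pt; rewrite te.
    case eE : (ecell_arrow E') X1 X2 => [q1 q2] /= X1 X2; rewrite !inE => /or3P[]/eqP ep;
        move: h1 h2; rewrite ep /=.
    + by rewrite X1.
    + by rewrite X2.
    + by rewrite X1.
  have h := branch_tris_arrows tb' pt.
  have e := tree_root_inj rep EE EE' Eb Eb' (ends_branch (ends1 (fb _ _ _ pb))) (ends_branch
      (ends1 h)).
  subst E'; move: Eb'; rewrite Eb => -[ev eb]; subst v' b'.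
  have := ub _ _ _ EE Eb; rewrite (perm_uniq (perm_branch v b)) cat_uniq =>
      /and3P[_ /hasPn hn _].
  have : p \in flatten (map (@tri_pairs T) (branch_tris v b)) by apply/flattenP;
      exists (tri_pairs t) => //; apply: map_f.
  by move/hn; rewrite pb.
Qed.

End CodeParams.

Lemma map_index_nth (A : eqType) (B : Type) (b0 : B) (l : seq A) (os : seq B) :
  uniq l -> size l = size os -> [seq nth b0 os (index a l) | a <- l] = os.
Proof.
elim: l os => [|a l IH] [|o os] //= /andP[al ul] [sz]; rewrite eqxx /=; congr (_ :: _).
rewrite -[RHS](IH os ul sz); apply/eq_in_map => b bl.
by case: eqP => [e|//]; rewrite e bl in al.
Qed.

Lemma compat_exists (T : finType) (Q : quiver T) cs : code_rep Q cs ->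
    exists w z, @compat _ Q cs w z.
Proof.
move=> rep; have [vc _ QE] := rep.
have [|l [el ul]] := @tags_realized _ Q (code_ring cs).
  by move=> p; rewrite QE -surjective_pairing count_cat leq_addr.
pose ds := [seq E.1.2 | E <- code_ecells cs]; pose os := [seq omap fst E.2 | E <- code_ecells
    cs].
have sl : size l = size (code_ecells cs) by rewrite -(size_map tag) el size_map.
(* The default [None] covers the arrows off the cycle. *)
pose z a := nth None os (index a l).
have e1 : map fst (zip l ds) = l by rewrite -/(unzip1 _) unzip1_zip // size_map sl.
have ez : map z l = os by apply: map_index_nth; rewrite ?size_map.
exists (zip l ds), z; split; rewrite ?e1 //.
  move: el ez; rewrite /ds /os /code_ring {ul e1}; elim: l (code_ecells cs) sl {z os ds} (z) =>
      [|a l IH] [|E Es] //= [sl] z.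
  by case=> -> el [ez1 ez2]; rewrite ez1 (IH Es sl z el ez2).
move=> a al; apply: nth_default; rewrite size_map -sl.
by rewrite leqNgt index_mem.
Qed.

Lemma card_ge_tags (T : finType) (Q : quiver T) (S : {set arrow Q}) (l : seq (T * T)) :
    uniq l ->
  (forall p, p \in l -> exists2 a, a \in S & tag a = p) -> size l <= #|S|.
Proof.
move=> ul ex; rewrite cardE -(size_map tag).
by apply: uniq_leq_size => // p /ex [a aS <-]; apply: map_f; rewrite mem_enum.
Qed.

Definition root_arrows (L : eqType) (v : L) (b : branch L) : seq (L * L) :=
  match b with
  | Nil => [::]
  | Ar d x _ => [:: ori d v x]
  | Tr x _ y _ => [:: (y, v); (v, x)]
  end.

Lemma root_arrows_branch (L : eqType) (v : L) b p : p \in root_arrows v b ->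
  (p \in branch_arrows v b) && ((p.1 == v) || (p.2 == v)).
Proof.
case: b => [|d x b|x b y c] //=; rewrite !inE.
  by move/eqP->; rewrite eqxx; case: d; rewrite /= eqxx ?orbT.
by case/orP=> /eqP->; rewrite /= !eqxx ?orbT.
Qed.

(** * Reading a code off a drawing *)

Section ReadCode.
Variables (T : finType) (Q : quiver T).
Variables (w : seq (step Q)) (z : arrow Q -> option T).
Hypothesis dr : drawing w z.

Definition good (v : T) (b : branch T) : Prop :=
  [/\ uniq (v :: branch_verts b), piece w v =i v :: branch_verts b &
      forall i j, i \in v :: branch_verts b -> j \in v :: branch_verts b ->
          Q i j = count_mem (i, j) (branch_arrows v b)].

Lemma piece_root v : v \in piece w v.
Proof. by rewrite inE connect0. Qed.

(* Two branches at [v] would give [v] valency at least 3, or two arrows that do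
   not lie on a common 3-cycle. *)
Lemma root_Nil a v h b : z a = Some v ->
  tree_rep val (full_subquiver Q (piece w v)) (v, h, b) -> nonnil h -> nonnil b -> False.
Proof.
move=> za [_ uv cf QE] nh nb.
have le2 := draw_valency dr za; have tri := draw_valency2 dr za.
set S := [set _ in _ | _] in le2 tri.
have pv x : (x \in piece w v) = (x \in tree_verts (v, h, b)).
  rewrite -cf; apply/idP/codomP => [xP|[[y yP] ->] //]; by exists (exist _ x xP).
have QE' i j : i \in piece w v -> j \in piece w v -> Q i j = count_mem (i,
    j) (tree_arrows (v, h, b)).
  by move=> hi hj; apply: (QE (exist (fun x => x \in piece w v) i hi) (exist (fun x =>
      x \in piece w v) j hj)).
have real p : p \in tree_arrows (v, h, b) -> (p.1 == v) || (p.2 == v) ->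
    exists2 a, a \in S & tag a = p.
  move=> pa pe; have [p1 p2] : p.1 \in tree_verts (v, h, b) /\ p.2 \in tree_verts (v, h, b).
    move: pa; rewrite /tree_verts /tree_arrows /= mem_cat =>
        /orP[] /[dup] /ends1/ends_branch + /ends2/ends_branch;
    by rewrite !inE !mem_cat => /orP[]-> /orP[]->; rewrite ?orbT.
  rewrite -!pv in p1 p2.
  have [|c tc] := @arrow_exists _ Q p.1 p.2.
    by rewrite QE' // -surjective_pairing -has_count has_pred1.
  exists c; last by rewrite tc -surjective_pairing.
  by rewrite inE [c \in arrows_in _ _]inE /src /tgt tc /= p1 p2.
(* Three distinct arrows at [v] exceed the valency bound; this settles every case with a triangle
   and leaves two single arrows. *)
have ge l : uniq l -> {subset l <= root_arrows v h ++ root_arrows v b} -> size l <= 2.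
  move=> ul sl; apply: leq_trans le2; apply: card_ge_tags ul _ => p /sl.
  rewrite mem_cat => /orP[] /root_arrows_branch /andP[pb pe]; apply: real => //.
    by rewrite /tree_arrows mem_cat pb.
  by rewrite /tree_arrows mem_cat pb orbT.
have := uv; rewrite /tree_verts /= => /andP[]; rewrite mem_cat negb_or => /andP[vh vb].
rewrite cat_uniq => /and3P[uh /hasPn dis ub].
case: h b nh nb vh vb uh ub dis ge {uv QE} QE' pv real cf =>
    [|d x h1|x h1 x' h2] // [|e y b1|y b1 y' b2] // _ _ vh vb uh ub dis ge QE' pv real cf.
- move: vh vb; rewrite /= !in_cons !negb_or => /andP[vx vh] /andP[vy vb].
  have xy : x != y by apply: contraTneq (dis _ (mem_head _ _)) => ->; rewrite negbK mem_head.
  have S2 : #|S| = 2.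
    apply/eqP; rewrite eqn_leq le2 /=; apply: (@card_ge_tags _ _ _ [:: ori d v x; ori e v y]).
      rewrite /= inE andbT /ori; case: (d); case: (e); rewrite xpair_eqE ?eqxx ?(negbTE xy)
          ?andbF //=.
        by rewrite (negbTE vy).
      by rewrite eq_sym (negbTE vx).
    have io f t : ((ori f v t).1 == v) || ((ori f v t).2 == v) by case: f;
        rewrite /= eqxx ?orbT.
    move=> p; rewrite !inE => /orP[]/eqP->; apply: real (io _ _).
      by rewrite /tree_arrows mem_cat /= mem_head.
    by rewrite /tree_arrows mem_cat /= mem_head orbT.
  have [D [o3 sub [c cD cv']]] := tri S2.
  case/existsP: o3 => a1 /existsP [a2 /existsP [a3 /and4P[/eqP e12 /eqP e23 /eqP e31 /eqP De]]].
  have inA a' : a' \in D -> tag a' \in branch_arrows v (Ar d x h1) ++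
      branch_arrows v (Ar e y b1).
    move/(subsetP sub); rewrite inE => /andP[p1 p2].
    have := arrow_pos a'; rewrite -/(src a') -/(tgt a') QE' // -has_count has_pred1.
    by rewrite -surjective_pairing.
  (* The 3-cycle through [v] is rotated so as to start at [v]. *)
  have [p [q hc]] : exists q r, [/\ (v, q) \in branch_arrows v (Ar d x h1) ++
      branch_arrows v (Ar e y b1),
      (q, r) \in branch_arrows v (Ar d x h1) ++ branch_arrows v (Ar e y b1) &
      (r, v) \in branch_arrows v (Ar d x h1) ++ branch_arrows v (Ar e y b1)].
    have m1 := inA a1 ltac:(by rewrite De !inE eqxx).
    have m2 := inA a2 ltac:(by rewrite De !inE eqxx orbT).
    have m3 := inA a3 ltac:(by rewrite De !inE eqxx !orbT).
    have t1 : tag a1 = (src a1, src a2) by rewrite -e12 -surjective_pairing.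
    have t2 : tag a2 = (src a2, src a3) by rewrite -e23 -surjective_pairing.
    have t3 : tag a3 = (src a3, src a1) by rewrite -e31 -surjective_pairing.
    rewrite t1 in m1; rewrite t2 in m2; rewrite t3 in m3.
    move: cD; rewrite De !inE => /orP[/orP[]|] /eqP eqc; rewrite eqc in cv'.
    + by rewrite cv' in m1 m3; exists (src a2), (src a3).
    + by rewrite cv' in m1 m2; exists (src a3), (src a1).
    + by rewrite cv' in m2 m3; exists (src a1), (src a2).
  case: hc => h1' h2' h3'.
  have uh' : uniq (v :: branch_verts (Ar d x h1)) by rewrite cons_uniq uh inE negb_or vx vh.
  have ub' : uniq (v :: branch_verts (Ar e y b1)) by rewrite cons_uniq ub inE negb_or vy vb.
  have inc a' : a' \in branch_arrows v (Ar d x h1) ++ branch_arrows v (Ar e y b1) ->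
      (a'.1 == v) || (a'.2 == v) ->
      a' = ori d v x \/ a' = ori e v y.
    rewrite mem_cat => /orP[ha|ha] hv; [left | right].
      exact: (branch_root_arrows uh' ha hv).
    exact: (branch_root_arrows ub' ha hv).
  (* At [v] the 3-cycle uses the arrows to [x] and [y], so its third side would join two branches
     that have no common vertex. *)
  have noxy s t : (s, t) \in branch_arrows v (Ar d x h1) ++ branch_arrows v (Ar e y b1) ->
      (s == x) && (t == y) || (s == y) && (t == x) = false.
    have yv : y \notin v :: branch_verts (Ar d x h1).
      by rewrite inE negb_or eq_sym vy /=; have := dis y (mem_head _ _).
    have xv : x \notin v :: branch_verts (Ar e y b1).
      rewrite inE negb_or eq_sym vx /=; apply/negP => xb.
      by have := dis x xb; rewrite /= mem_head.
    rewrite mem_cat => /orP[hm|hm].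
      have hs : s \in v :: branch_verts (Ar d x h1) := ends_branch (ends1 hm).
      have ht : t \in v :: branch_verts (Ar d x h1) := ends_branch (ends2 hm).
      by apply/negP => /orP[] /andP[/eqP e1 /eqP e2]; move: yv;
          [rewrite -e2 ht | rewrite -e1 hs].
    have hs : s \in v :: branch_verts (Ar e y b1) := ends_branch (ends1 hm).
    have ht : t \in v :: branch_verts (Ar e y b1) := ends_branch (ends2 hm).
    by apply/negP => /orP[] /andP[/eqP e1 /eqP e2]; move: xv; [rewrite -e1 hs | rewrite -e2 ht].
  have := inc _ h1'; have := inc _ h3'; rewrite /= !eqxx ?orbT => /(_ isT) i1 /(_ isT) i2.
  have hx := noxy _ _ h2'; have {}vx := negbTE vx; have {}vy := negbTE vy.
  clear - vx vy hx i1 i2; move: i1 i2; rewrite /ori.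
  by case: (d); case: (e) => -[] i1 -[] i2;
    move: (congr1 fst i1) (congr1 snd i1) (congr1 fst i2) (congr1 snd i2) => /= f1 f2 g1 g2;
    subst; rewrite ?eqxx ?orbT /= in vx vy hx; rewrite ?eqxx ?orbT in hx.
- have h3 : uniq (root_arrows v (Ar d x h1) ++ root_arrows v (Tr y b1 y' b2));
    last by have := ge _ h3 (fun _ h => h).
  have xn : x \notin branch_verts (Tr y b1 y' b2) by apply/negP => /dis; rewrite /= mem_head.
  move: vh vb xn; rewrite /= !in_cons !negb_or => /andP[vx _] /and3P[vy vy' _] /and3P[xy xy' _].
  by case: (d); rewrite /= ?inE ?xpair_eqE ?(eq_sym _ v) ?(negbTE vx) ?(negbTE vy) ?(negbTE
      vy') ?(negbTE xy) ?(negbTE xy') ?andbF.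
- have h3 : uniq (root_arrows v (Tr x h1 x' h2) ++ root_arrows v (Ar e y b1));
    last by have := ge _ h3 (fun _ h => h).
  have xn : x \notin branch_verts (Ar e y b1) by apply/negP => /dis; rewrite /= mem_head.
  have xn' : x' \notin branch_verts (Ar e y b1) by apply/negP => /dis;
      rewrite /= !inE eqxx orbT.
  move: vh vb xn xn'; rewrite /= !in_cons !negb_or => /and3P[vx vx' _] /andP[vy _] /andP[xy _]
      /andP[xy' _].
  by case: (e); rewrite /= ?inE ?xpair_eqE ?(eq_sym _ v) ?(negbTE vx) ?(negbTE vy) ?(negbTE
      vx') ?(negbTE xy) ?(negbTE xy') ?andbF.
- have h3 : uniq (root_arrows v (Tr x h1 x' h2) ++ root_arrows v (Tr y b1 y' b2));
    last by have := ge _ h3 (fun _ h => h).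
  have xn : x \notin branch_verts (Tr y b1 y' b2) by apply/negP => /dis; rewrite /= mem_head.
  have xn' : x' \notin branch_verts (Tr y b1 y' b2) by apply/negP => /dis;
      rewrite /= !inE eqxx orbT.
  move: vh vb xn xn'; rewrite /= !in_cons !negb_or => /and3P[vx vx' _] /and3P[vy vy' _]
      /and3P[xy xy' _] /and3P[x'y x'y' _].
  by rewrite /= ?inE ?xpair_eqE ?(eq_sym _ v) ?(negbTE vx) ?(negbTE vy) ?(negbTE vx') ?(negbTE
      vy') ?(negbTE xy) ?(negbTE xy') ?(negbTE x'y) ?(negbTE x'y') ?andbF.
Qed.

Lemma root_code a v : z a = Some v -> exists b, good v b.
Proof.
move=> za; have [k k1 tA] := draw_type_A dr za.
have [p ar] := type_A_tree_rep (f := val) val_inj k1 tA.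
have vp : v \in tree_verts p.
  case: ar => _ _ <- _; apply/codomP; by exists (exist (fun x =>
      x \in piece w v) v (piece_root v)).
case: p ar vp => [[v0 h0] b0] ar vp.
have [h [b {}ar]] := tree_rep_reroot ar vp.
have [b' {}ar] : exists b', tree_rep val (full_subquiver Q (piece w v)) (v, @Nil T, b').
  have nilP (c : branch T) : nonnil c = false -> c = @Nil T by case: c.
  have := root_Nil za ar; case Eh: (nonnil h) => nn; last by exists b; rewrite -(nilP _ Eh).
  case Eb: (nonnil b) nn => nn; first by case: (nn isT isT).
  by exists h; rewrite -(nilP _ Eb); apply: tree_rep_swap.
exists b'; case: ar => _ uv cf QE.
have pE : piece w v =i v :: branch_verts b'.
  move=> x; rewrite -[x \in _ :: _]cf; apply/idP/codomP => [xP|[[y yP] ->] //].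
  by exists (exist (fun x => x \in piece w v) x xP).
split=> // i j; rewrite -!pE => iP jP.
exact: (QE (exist (fun x => x \in piece w v) i iP) (exist (fun x => x \in piece w v) j jP)).
Qed.

Lemma read_cells (w0 : seq (step Q)) : exists cs : seq (cell T),
  [seq (step_start s, s.2, z s.1) | s <- w0] = [seq (cell_vertex c, cell_dir c,
      omap fst (cell_glued c)) | c <- cs] /\
  forall c v b, c \in cs -> cell_glued c = Some (v, b) -> good v b.
Proof.
elim: w0 => [|s w0 [cs [e g]]]; first by exists [::].
have [o [eo go]] : exists o, z s.1 = omap fst o /\ forall v b, o = Some (v, b) -> good v b.
  case zs : (z s.1) => [v|]; last by exists None.
  by have [b gb] := root_code zs; exists (Some (v, b)); split=> // v' b' [<- <-].
exists ((step_start s, s.2, o) :: cs); split; first by rewrite /= e eo.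
by move=> c v b; rewrite inE => /orP[/eqP-> /go|/g]; last exact.
Qed.

Lemma piece_notX v x : v \notin walk_verts w -> x \in piece w v -> x \notin walk_verts w.
Proof.
move=> vX; rewrite inE => /connectP [p pa ->]; elim: p v vX pa =>
    //= y p IH v vX /andP[/and3P[_ yX _] pa].
by apply: IH pa; rewrite inE in yX.
Qed.

(** The clauses of a drawing account for every arrow by position: between cycle vertices by fullness
    of the cycle, between the cycle and its complement by [draw_incident], and off the cycle within
    a single tree, because pieces are connected components. *)
Lemma drawing_code : exists cs, code_rep Q cs /\ compat cs w z.
Proof.
have [cs [e g]] := read_cells w; exists cs.
have [w2 cyc [us uf] /setP ai /andP[d1 d2]] := draw_cycle dr.
have eX : map (@step_start _ _) w = map (@cell_vertex T) cs.
  by have := congr1 (map (fun x => x.1.1)) e; rewrite -!map_comp.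
have ed : map snd w = map (@cell_dir T) cs.
  by have := congr1 (map (fun x => x.1.2)) e; rewrite -!map_comp.
have ez : map (fun s => z s.1) w = map (fun c => omap fst (cell_glued c)) cs.
  by have := congr1 (map (fun x => x.2)) e; rewrite -!map_comp.
have cr_ : map tag (map fst w) = code_ring cs.
  by apply: walk_ring => //; have := congr1 (map fst) e; rewrite -!map_comp.
have hc : compat cs w z.
  split=> //; last first.
    move=> a aw; case za : (z a) => [v|] //.
    by have [h _ _ _] := draw_triangle dr za; rewrite h in aw.
  have ed' : map snd w = map (fun E : ecell T => E.1.2) (code_ecells cs).
    by rewrite ed; have := congr1 (map fst) (map_ecells cs); rewrite -!map_comp.
  have ez' : map (fun s => z s.1) w = map (fun E : ecell T => omap fst E.2) (code_ecells cs).
    by rewrite ez; have := congr1 (map (fun x => omap fst x.2)) (map_ecells cs);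
        rewrite -!map_comp.
  move: cr_ ed' ez'; rewrite /code_ring; elim: (w) (code_ecells cs) =>
      [|s v IH] [|E Es] //= [e1 e2] [e3 e4] [e5 e6].
  by rewrite (IH Es) // e1 e3 e5.
have WX x : (x \in walk_verts w) = (x \in map (@cell_vertex T) cs) by rewrite inE eX.
have gE E v b : E \in code_ecells cs -> E.2 = Some (v, b) -> good v b.
  move=> EE Eb; have : E.2 \in [seq E.2 | E <- code_ecells cs] by apply: map_f.
  have -> : [seq E.2 | E <- code_ecells cs] = map (@cell_glued T) cs.
    by have := congr1 (map snd) (map_ecells cs); rewrite -!map_comp.
  by case/mapP => c cC eqc; apply: (g c) => //; rewrite -eqc.
have zE E v b : E \in code_ecells cs -> E.2 = Some (v, b) ->
    exists2 a, z a = Some v & tag a = ecell_arrow E.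
  by move=> EE Eb; have [a [_ _ ta za]] := cell_z hc EE Eb; exists a.
have treeX E v b x : E \in code_ecells cs -> E.2 = Some (v, b) ->
    x \in v :: branch_verts b -> x \notin map (@cell_vertex T) cs.
  move=> EE Eb xv; have [a za _] := zE _ _ _ EE Eb; have [_ vX _ _] := draw_triangle dr za.
  by have [_ pE _] := gE _ _ _ EE Eb; rewrite -WX; apply: (piece_notX vX); rewrite pE.
have uX : uniq (map (@cell_vertex T) cs) by rewrite -eX.
have uEc : uniq (code_ecells cs) by apply: (map_uniq (f := fun E : ecell T => E.1.1.1));
    rewrite map_ecells_vertex.
have symR (S : {set T}) : symmetric (fun x y => [&& x \in S, y \in S & adjacent Q x y]).
  by move=> x y; rewrite andbCA /adjacent (orbC (0 < Q x y)).
have ucv : uniq (code_verts cs).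
  rewrite (perm_uniq (perm_verts cs)) cat_uniq uX -ecells_glued /=; apply/andP; split.
    apply/hasPn => x /flattenP [_ /mapP [E EE ->]] /=.
    by case Eb : E.2 => [[v b]|] //= xv; apply: treeX EE Eb xv.
  apply: flatten_uniq => //.
    by move=> E EE; case Eb : E.2 => [[v b]|] //=; have [] := gE _ _ _ EE Eb.
  move=> E E' x EE EE'; case Eb : E.2 => [[v b]|] //= xv; case Eb' : E'.2 => [[v' b']|] //= xv'.
  have [a [aw _ ta za]] := cell_z hc EE Eb; have [a' [aw' _ ta' za']] := cell_z hc EE' Eb'.
  have [_ pE _] := gE _ _ _ EE Eb; have [_ pE' _] := gE _ _ _ EE' Eb'.
  have xp : x \in piece w v by rewrite pE.
  have xp' : x \in piece w v' by rewrite pE'.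
  (* Two pieces with a common vertex are the same component, so [draw_disjoint] identifies the cycle
     arrows to which they are attached. *)
  have v'v : v' \in piece w v.
    move: xp xp'; rewrite !inE => c1 c2; apply: connect_trans c1 _.
    by rewrite (sym_connect_sym (symR _)).
  have aa' := draw_disjoint dr za za' v'v; subst a'.
  have e12 := w_arrow_inj hc aw aw' erefl.
  apply: (@uniq_flatten_inj _ _ (fun F : ecell T => [:: F.1.1.1]) (code_ecells cs) _ _ E.1.1.1)
      => //.
  - by rewrite flatten_map1 map_ecells_vertex.
  - by rewrite mem_head.
  - have := congr1 (fun s : step Q => s.2) e12; rewrite /= => dd.
    move: ta ta'; rewrite mem_seq1 => ->; case: (E) (E') dd =>
        [[[q1 q2] f] o] [[[q1' q2'] f'] o'] /= <-.
    by rewrite /ecell_arrow; case: (f) => -[f1 f2]; rewrite ?f1 ?f2 eqxx.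
have vc : valid_code cs by rewrite /valid_code ucv -!(has_map (@cell_dir T) id) -(has_map
    (@cell_dir T) negb) -ed !has_map d1.
have bt := code_built ucv.
have [_ _ _ ud nX] := built_basic bt uX (ring_supp (ring_code vc)).
have tree2 x : x \notin map (@cell_vertex T) cs -> exists E v b, [/\ E \in code_ecells cs,
    E.2 = Some (v, b) & x \in v :: branch_verts b].
  rewrite -WX => /(draw_cover dr) [a [v [za xv]]].
  have [q1 [q2 [f [b [EE _ _ _]]]]] := z_cell hc za; exists (q1, q2, f, Some (v, b)), v, b;
      split=> //.
  by have [_ <- _] := gE _ _ _ EE erefl.
exists => //.
  split=> // [x|i j].
    rewrite (perm_mem (perm_verts cs)) mem_cat; have [//|xX] := boolP (x \in _).
    have [E [v [b [EE Eb xv]]]] := tree2 x xX; rewrite -ecells_glued /=.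
    by apply/flattenP; exists (glued_verts E.2); [apply: map_f | rewrite Eb].
  rewrite count_cat; have [/andP[iX jX]|nij] := boolP ((i \in map (@cell_vertex T) cs) &&
      (j \in map (@cell_vertex T) cs)).
    rewrite (@count_memPn _ _ (code_glued cs) _) ?addn0; last first.
      by apply/negP => /nX; rewrite iX jX.
    rewrite -cr_ (count_tags uf) // => a ta.
    by have := ai a; rewrite !inE /src /tgt ta eX iX jX => <-.
  rewrite (@count_memPn _ _ (code_ring cs) _); last first.
    apply: contra nij => h; have sup := ring_supp (ring_code vc).
    by rewrite (sup _ (ends1 h)) (sup _ (ends2 h)).
  rewrite add0n count_uniq_mem //; have [h|h] := boolP ((i, j) \in code_glued cs).
    have [E EE pE] := mem_gluedP _ _ h.
    have [v [b [Eb cc]]] := ecell_gluedP EE pE; have [a za ta] := zE _ _ _ EE Eb.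
    have [_ _ q1 q2] := draw_triangle dr za.
    case: cc => [[-> ->]|[-> ->]|hb]; [by rewrite -ta | by rewrite -ta |].
    have [_ pE' QE] := gE _ _ _ EE Eb.
    rewrite (QE _ _ (ends_branch (ends1 hb)) (ends_branch (ends2 hb))) count_uniq_mem ?hb //.
    have := uniq_flatten_each ud EE; case: (E) Eb => [[[? ?] ?] ?] /= ->.
    by rewrite /ecell_glued /= => /and3P[].
  apply/eqP; rewrite -leqn0 leqNgt; apply: contra h => qij.
  have [c tc] := arrow_exists qij.
  have [/orP cX|] := boolP ((i \in map (@cell_vertex T) cs) || (j \in map (@cell_vertex T) cs)).
    have := draw_incident dr (b := c); rewrite /src /tgt tc !WX =>
        /(_ (introT orP cX)) [cw|[a [v [za cc]]]].
      by have := ai c; rewrite !inE cw /src /tgt tc eX /= (negbTE nij).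
    have [q1 [q2 [f [b [EE ta _ _]]]]] := z_cell hc za.
    apply/mem_gluedP; exists (q1, q2, f, Some (v, b)) => //; rewrite /ecell_glued !inE.
    by case: cc => -[/= -> ->]; rewrite ta eqxx ?orbT.
  rewrite negb_or => /andP[iX jX]; have [E [v [b [EE Eb iv]]]] := tree2 i iX.
  have [_ pE QE] := gE _ _ _ EE Eb.
  have jv : j \in v :: branch_verts b.
    rewrite -pE; have : i \in piece w v by rewrite pE.
    rewrite !inE => c1; apply: connect_trans c1 (connect1 _).
    by rewrite !inE eX iX jX /adjacent qij.
  apply/mem_gluedP; exists E => //.
  have : (i, j) \in branch_arrows v b by rewrite -has_pred1 has_count -QE.
  by case: (E) Eb => [[[? ?] ?] ?] /= -> hb; rewrite /ecell_glued !inE hb !orbT.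
Qed.

End ReadCode.

(** * Assembly of the mutation sequence *)

Definition code_has_params (T : finType) (cs : seq (cell T)) (r1 r2 s1 s2 : nat) : Prop :=
  [/\ r1 = pfree false cs, r2 = ptri false cs, s1 = pfree true cs & s2 = ptri true cs].

Lemma has_params_code (T : finType) (Q : quiver T) r1 r2 s1 s2 :
  has_params Q r1 r2 s1 s2 -> exists2 cs, code_rep Q cs & code_has_params cs r1 r2 s1 s2.
Proof.
case=> [w [z [dr -> -> -> ->]]]; have [cs [rep hc]] := drawing_code dr; exists cs => //.
by split; rewrite ?(code_num_arrows rep hc) ?(code_num_3cycles rep hc).
Qed.

Lemma code_good (T : finType) (Q : quiver T) cs n r1 r2 s1 s2 : code_rep Q cs -> #|T| = n.+1 ->
  code_has_params cs r1 r2 s1 s2 -> in_Qn Q n /\ has_params Q r1 r2 s1 s2.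
Proof.
move=> rep cT [-> -> -> ->]; have [w [z hc]] := compat_exists rep.
have dr := code_drawing rep hc.
split; first by split=> //; [exact: code_connected rep | exists w, z].
by exists w, z; rewrite !(code_num_arrows rep hc) !(code_num_3cycles rep hc).
Qed.

Lemma same_par_params (T : finType) (cs cs' : seq (cell T)) r1 r2 s1 s2 : same_par cs cs' ->
  code_has_params cs r1 r2 s1 s2 -> code_has_params cs' r1 r2 s1 s2.
Proof.
by move=> sp [-> -> -> ->]; have [e1 e2] := sp false; have [e3 e4] := sp true; split.
Qed.

Theorem lemma3p9 (n : nat) (hn : 1 <= n) (T1 T2 : finType)
    (Q1 : quiver T1) (Q2 : quiver T2)
    (hQ1 : in_Qn Q1 n) (hQ2 : in_Qn Q2 n) (r1 r2 s1 s2 : nat)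
    (hp1 : has_params Q1 r1 r2 s1 s2)
    (hp2 : has_params Q2 r1 r2 s1 s2 \/ has_params Q2 s1 s2 r1 r2) :
  exists ks : seq T1,
    (forall i : nat, i <= size ks ->
       in_Qn (mutate_seq Q1 (take i ks)) n /\
       (has_params (mutate_seq Q1 (take i ks)) r1 r2 s1 s2 \/
        has_params (mutate_seq Q1 (take i ks)) s1 s2 r1 r2)) /\
    quiver_iso (mutate_seq Q1 ks) Q2.
Proof.
have [c1 rep1 p1] := has_params_code hp1.
have [c2 rep2 p2] : exists2 cs, code_rep Q2 cs & code_has_params cs r1 r2 s1 s2.
  case: hp2 => /has_params_code [cs rep p]; first by exists cs.
  (* If the roles are interchanged, reading the word of [Q2] backwards restores the order of the
     parameters. *)
  exists (rcode cs); first exact: code_rep_rev_code.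
  case: p => -> -> -> ->; have [h1 h2] := par_rev_code false cs;
      have [h3 h4] := par_rev_code true cs.
  by split; rewrite ?h1 ?h2 ?h3 ?h4.
have cT1 : #|T1| = n.+1 by case: hQ1.
have [f1 [fl1 re1 sp1]] := reach_flat c1; have [f2 [fl2 [ks2 re2] sp2]] := reach_flat c2.
have pf1 := same_par_params sp1 p1; have pf2 := same_par_params sp2 p2.
have pk : perm_eq (map (@kind T1) f1) (map (@kind T2) f2).
  apply/allP => k _ /=; rewrite !count_kind //.
  case: pf1 pf2 => e1 e2 e3 e4 [e5 e6 e7 e8].
  by case: k => [[] []] /=; rewrite -?e1 -?e2 -?e3 -?e4 -?e5 -?e6 -?e7 -?e8.
have [g1 [flg kg re1' sp1']] := reach_kinds fl1 pk.
have [ks1 /(_ _ rep1) [repg pre1]] := reach_trans sp1 re1 re1'.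
have [repf pre2] := re2 _ rep2.
have [h [[h' hK h'K] hE]] := flat_iso repf repg fl2 flg (esym kg).
(* [h] carries [mutate_seq Q2 ks2] onto [mutate_seq Q1 ks1], so undoing [ks2] under [h] ends in a
   copy of [Q2]. *)
exists (ks1 ++ map h (rev ks2)); split=> [i li|]; last first.
  exists h'; first by exists h.
  move=> i j; rewrite mutate_seq_cat -{2}(h'K i) -{2}(h'K j).
  by rewrite (mutate_seq_iso _ (can_inj hK) hE) mutate_seq_rev.
suff [c rc pc] : exists2 c, code_rep (mutate_seq Q1 (take i (ks1 ++
    map h (rev ks2)))) c & code_has_params c r1 r2 s1 s2.
  by have [h1 h2] := code_good rc cT1 pc; split=> //; left.
rewrite take_cat; case: ltnP => lis.
  have [c rc sc] := pre1 i (ltnW lis); exists c => //; exact: same_par_params sc p1.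
(* Undoing the last steps of [ks2] leaves its prefix of length [m], so the quiver reached is the
   image under [h] of an intermediate quiver on the way from [Q2]. *)
rewrite mutate_seq_cat -map_take take_rev; set m := size ks2 - _.
have [c rc sc] := pre2 m (leq_subr _ _).
exists (map (map_cell h) c); last first.
  have := same_par_params sc p2; case=> -> -> -> ->.
  have [h1 h2] := par_map h false c; have [h3 h4] := par_map h true c.
  by split.
apply: (code_rep_map (Q := mutate_seq Q2 (take m ks2))) rc; first by exists h'.
move=> k l; rewrite (mutate_seq_iso _ (can_inj hK) hE) -{1}(cat_take_drop m ks2) mutate_seq_cat.
exact: mutate_seq_rev.
Qed.
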